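(* Let $t_0\in\mathbb R$, $A>0$ and $I=[t_0-A,t_0+A]$. Let $\Pi$ be a complex Banach(able) space with a fixed compatible norm $|\cdot|$, and let $O\subseteq I\times\Pi$ be open in the topology which $I\times\Pi$ inherits from $\mathbb R\times\Pi$. Let $E=E(I,\Pi,O)$ be the complex topological vector space of functions $\varphi:O\to\Pi$ defined in the context, let $E_2=\Pi\times E$ with the product topology, and let $F_1=C^1(I,\Pi)$. Let $\Sigma_1$ be the set of all $((\xi,\varphi),y)$ with $(\xi,\varphi)\in E_2$ and $y\in F_1$ such that $(t,y(t))\in O$ for all $t\in I$, and $$y'(t)=\varphi(t,y(t))\ \text{ for all } t\in I,\qquad y(t_0)=\xi .$$ Then: 1. $(E_2,F_1,\Sigma_1)\in\mathcal H_T$; that is, the relation $\Sigma_1$ is (the graph of) a function $(\xi,\varphi)\mapsto y$, and it is a holomorphic map from $E_2$ to $F_1$ in the sense of the class $\mathcal H_T$ defined in the context (in particular its domain is open in $E_2$). 2. The domain of $\Sigma_1$ contains every $(\xi,\varphi)\in E_2$ for which there is a real number $B_1>0$ such that the set $D=\{(t,\xi+\xi_1): t\in I,\ \xi_1\in\Pi,\ |\xi_1|<B_1\}$ satisfies $D\subseteq O$ and $$\sup_{(t,\eta)\in D}|\varphi(t,\eta)|<\frac{B_1}{2A}.$$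
   Context: **The class $\mathcal H_T$.** A triple $(G,H,g)$ belongs to $\mathcal H_T$ iff $G,H$ are complex Hausdorff locally convex spaces, $H$ is locally (= Mackey) complete, $g$ is a function whose domain $\operatorname{dom} g$ is an open subset of $G$ and whose values lie in $H$, $g$ is continuous on $\operatorname{dom} g$, and $g$ is directionally differentiable: for all $x\in\operatorname{dom} g$ and $u\in G$ the limit of $\tau^{-1}(g(x+\tau u)-g(x))$ as $\tau\to0$, $\tau\in\mathbb C\setminus\{0\}$, exists in $H$. Functions are identified with their graphs. **The space $F_1$.** $F_1=C^1(I,\Pi)$ is the complex Banach space of continuously differentiable functions $y:I\to\Pi$ (one-sided derivatives at the endpoints of $I$), with the topology of uniform convergence of $y$ and $y'$ on $I$. **The space $E=E(I,\Pi,O)$.** Let $\mathcal B$ be the set of all $B\subseteq O$ such that $\{\xi:(t,\xi)\in B\text{ for some }t\}$ is bounded in $\Pi$ and such that there is a neighbourhood $V$ of zero in $\Pi$ with $\{(t,\xi+\xi_1):(t,\xi)\in B,\ \xi_1\in V\}\subseteq O$. Let $S$ be the set of all functions $x:O\to\Pi$ such that - $x$ is continuous (for the topology on $O$ induced from $\mathbb R\times\Pi$), - for every $t\in I$, the partial function $x(t,\cdot)$, defined on $\{\xi:(t,\xi)\in O\}$, is holomorphic in the sense that $(\Pi,\Pi,x(t,\cdot))\in\mathcal H_T$, - for every $B\in\mathcal B$, the image $x[B]$ is bounded in $\Pi$. $E$ is $S$ with pointwise vector space operations, equipped with the vector topology for which the sets $N(B,V)=\{x\in S: x[B]\subseteq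 V\}$, with $B\in\mathcal B$ and $V$ a neighbourhood of zero in $\Pi$, form a filter basis for the filter of zero neighbourhoods (i.e. the topology of uniform convergence on the members of $\mathcal B$). *)

(* Defs.v *)
From HB Require Import structures.
From mathcomp Require Import all_boot all_order all_algebra.
From mathcomp Require Import interval_inference complex.
From mathcomp Require Import all_classical all_reals all_analysis.

Set Implicit Arguments.
Unset Strict Implicit.
Unset Printing Implicit Defensive.
Import Order.TTheory GRing.Theory Num.Theory.
Import numFieldNormedType.Exports.

Local Open Scope classical_set_scope.
Local Open Scope ring_scope.
Local Open Scope complex_scope.

Section absolutely_convex.
Context {K : numFieldType} {M : lmodType K}.

Definition absolutely_convex (W : set M) :=
  forall (x y : M) (a b : K), W x -> W y -> `|a| + `|b| <= 1 ->
    W (a *: x + b *: y).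

(** Sufficient conditions for a family [N] of sets to be a filter basis for the
    zero neighbourhoods of a locally convex vector topology. *)
Record zero_base (N : set (set M)) : Prop := ZeroBase {
  zb_nonempty : N !=set0 ;
  zb_meet : forall A B, N A -> N B -> exists2 C, N C & C `<=` A `&` B ;
  zb_absconv : forall A, N A ->
    exists2 W, N W & absolutely_convex W /\ W `<=` A ;
  zb_scale : forall A (c : K), N A ->
    exists2 W, N W & forall v, W v -> A (c *: v) ;
  zb_absorb : forall A x, N A -> exists2 c : K, c != 0 & A (c *: x)
}.

(** The neighbourhoods of [x] in the translation invariant topology having [N]
    as a filter basis for its zero neighbourhoods. *)
Definition vtop_nbhs (N : set (set M)) (x : M) : set_system M :=
  [set U | exists2 A, N A & forall v, A v -> U (x + v)].

Section zero_base_theory.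
Context (N : set (set M)) (NB : zero_base N).

Lemma abs_convex_scale W (a : K) x : absolutely_convex W -> W x ->
  `|a| <= 1 -> W (a *: x).
Proof.
move=> Wc Wx a1; have := Wc x x a 0 Wx Wx.
by rewrite normr0 addr0 scale0r addr0; exact.
Qed.

Lemma zb_mem0 A : N A -> A 0.
Proof. by move=> NA; have [c _] := zb_absorb NB 0 NA; rewrite scaler0. Qed.

Lemma zb_add A : N A -> exists2 W, N W &
  absolutely_convex W /\ forall v w, W v -> W w -> A (v + w).
Proof.
move=> NA; have [B NBB [Bc BA]] := zb_absconv NB NA.
have [C NC CB] := zb_scale NB 2 NBB.
have [W NW [Wc WC]] := zb_absconv NB NC.
exists W => //; split=> // v w Wv Ww; apply: BA.
have -> : v + w = 2^-1 *: (2 *: v) + 2^-1 *: (2 *: w).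
  by rewrite !scalerA mulVf// !scale1r.
apply: Bc; [exact/CB/WC|exact/CB/WC|].
by rewrite ger0_norm// [leRHS]splitr mul1r.
Qed.

Lemma vtop_nbhs_filter x : ProperFilter (vtop_nbhs N x).
Proof.
split.
  by move=> [A NA /(_ 0 (zb_mem0 NA))].
split.
- by have [A NA] := zb_nonempty NB; exists A.
- move=> P Q [A NA AP] [B NBB BQ].
  have [C NC CAB] := zb_meet NB NA NBB.
  by exists C => // v /CAB[Av Bv]; split; [exact: AP|exact: BQ].
- by move=> P Q PQ [A NA AP]; exists A => // v /AP /PQ.
Qed.

Lemma vtop_nbhs_singleton x U : vtop_nbhs N x U -> U x.
Proof. by move=> [A NA /(_ 0 (zb_mem0 NA))]; rewrite addr0. Qed.

Lemma vtop_nbhs_nbhs x U :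
  vtop_nbhs N x U -> vtop_nbhs N x (vtop_nbhs N ^~ U).
Proof.
move=> [A NA AU]; have [W NW [_ WA]] := zb_add NA.
by exists W => // v Wv; exists W => // w Ww; rewrite -addrA; exact/AU/WA.
Qed.

End zero_base_theory.

End absolutely_convex.

HB.factory Record Lmodule_isZeroBaseTvs (K : numFieldType) M
    & GRing.Lmodule K M := {
  zero_basis : set (set M) ;
  zero_basisP : zero_base zero_basis
}.

HB.builders Context K M & Lmodule_isZeroBaseTvs K M.

HB.instance Definition _ := hasNbhs.Build M (vtop_nbhs zero_basis).

HB.instance Definition _ := Nbhs_isNbhsTopological.Build M
  (vtop_nbhs_filter zero_basisP) (vtop_nbhs_singleton zero_basisP)
  (vtop_nbhs_nbhs zero_basisP).

Lemma zb_add_continuous : continuous (fun x : M * M => x.1 + x.2).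
Proof.
move=> [x y] U /= [A NA AU]; have [W NW [_ WA]] := zb_add zero_basisP NA.
exists ([set x + w | w in W], [set y + w | w in W]).
  by split; exists W => // v Wv; exists v.
move=> [_ _] /= [[v Wv <-] [w Ww <-]].
by rewrite addrACA; exact/AU/WA.
Qed.

Lemma zb_scale_continuous : continuous (fun z : K^o * M => z.1 *: z.2).
Proof.
move=> [a x] U /= [A NA AU].
have [B NB [_ BA]] := zb_add zero_basisP NA.
have [W NW [Wc WB]] := zb_add zero_basisP NB.
have [C NC CW] := zb_scale zero_basisP a NW.
have [D ND DCW] := zb_meet zero_basisP NC NW.
have [c c0 Wcx] := zb_absorb zero_basisP x NW.
have W0 := zb_mem0 zero_basisP NW.
exists ([set b | `|b - a| <= `|c| /\ `|b - a| <= 1], [set x + w | w in D]).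
  split; last by exists D => // v Wv; exists v.
  near=> b; rewrite /= distrC; split; near: b.
    by apply: cvgr_dist_le => //; rewrite normr_gt0.
  exact: cvgr_dist_le.
move=> [b _] /= [[bc b1] [w /DCW[Cw Ww] <-]].
have -> : b *: (x + w) =
    a *: x + ((b - a) *: x + a *: w + ((b - a) *: w + 0)).
  rewrite addr0 scalerDr !scalerBl.
  by rewrite -addrA [a *: w + _]addrC subrK addrA addrCA subrr addr0.
apply/AU/BA; apply: WB => //; last exact: abs_convex_scale.
  have -> : (b - a) *: x = ((b - a) / c) *: (c *: x).
    by rewrite scalerA divfK.
  apply: abs_convex_scale => //.
  by rewrite normrM normfV ler_pdivrMr ?normr_gt0// mul1r.
exact: CW.
Unshelve. all: by end_near. Qed.

Lemma zb_locally_convex : exists2 B : set_system M,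
  (forall b, b \in B -> convex_set b) & basis B.
Proof.
exists [set b | open b /\ convex_set b]; first by move=> b; rewrite inE => -[].
split; first by move=> b [].
move=> x U [A NA AU]; have [W NW [Wc WA]] := zb_absconv zero_basisP NA.
pose V : set M := [set y : M | nbhs y [set x + w | w in W]].
have xV : nbhs x [set x + w | w in W] by exists W => // v Wv; exists v.
exists V; last first.
  by move=> y /nbhs_singleton[w Ww <-]; exact/AU/WA.
split=> //; split.
  by rewrite openE => y yV; exact: vtop_nbhs_nbhs zero_basisP _ _ yV.
have VW y : V y -> exists2 P, zero_basis P & forall p, P p -> W (y + p - x).
  move=> [P NP PW]; exists P => // p /PW[w Ww <-].
  by rewrite addrC addKr.
move=> y z l; rewrite !inE => /VW[P NP PW] /VW[Q NQ QW].
have [T NT TPQ] := zb_meet zero_basisP NP NQ.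
exists T => // t /TPQ[Pt Qt].
exists (l%:num *: (y + t - x) + (1 - l%:num) *: (z + t - x)).
  apply: Wc; [exact: PW|exact: QW|].
  by rewrite !ger0_norm ?subr_ge0// addrC subrK.
rewrite !scalerBr !scalerDr addrACA -opprD -[in X in _ - X]scalerDl.
rewrite [_ + (1 - _)]addrC subrK scale1r [x + _]addrC subrK addrACA.
by rewrite -[in X in _ + X]scalerDl [_ + (1 - _)]addrC subrK scale1r.
Qed.

HB.instance Definition _ :=
  PreTopologicalNmodule_isTopologicalNmodule.Build M zb_add_continuous.
HB.instance Definition _ :=
  TopologicalNmodule_isTopologicalLmodule.Build K M zb_scale_continuous.
HB.instance Definition _ := PreTopologicalLmod_isTvs.Build K M
  zb_add_continuous zb_scale_continuous zb_locally_convex.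
HB.instance Definition _ := Uniform_isTvs.Build K M zb_locally_convex.

HB.end.

Section holomorphy.
Context {R : realType}.

Definition tvs_bounded {H : tvsType R[i]} (B : set H) :=
  forall V, nbhs 0 V -> exists2 r : R[i], 0 < r & B `<=` [set r *: v | v in V].

(** Cauchy with respect to the gauge of a bounded disk. *)
Definition mackey_cauchy {H : tvsType R[i]} (u : nat -> H) :=
  exists B : set H, [/\ tvs_bounded B, absolutely_convex B &
    forall e : R[i], 0 < e -> exists N, forall m n, (N <= m)%N -> (N <= n)%N ->
      exists2 b, B b & u m - u n = e *: b].

Definition mackey_complete (H : tvsType R[i]) :=
  forall u : nat -> H, mackey_cauchy u -> exists l : H, u @ \oo --> l.

Definition graph_dom {G H : Type} (g : set (G * H)) : set G :=
  [set x | exists y, g (x, y)].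

(** The function with graph [g], extended by [0] outside of its domain. *)
Definition graph_fun {G : Type} {H : zmodType} (g : set (G * H)) : G -> H :=
  fun_of_rel (fun=> 0) (fun x y => g (x, y)).

Definition directionally_differentiable {G H : tvsType R[i]}
    (g : set (G * H)) :=
  forall x u, graph_dom g x -> exists l : H,
    (fun tau : R[i] =>
      tau^-1 *: (graph_fun g (x + tau *: u) - graph_fun g x))
    @ (0 : R[i]^o)^' --> l.

(** The class $\mathcal H_T$; a function is identified with its graph, and
    local convexity of [G] and [H] is part of [tvsType]. *)
Record HT (G H : tvsType R[i]) (g : set (G * H)) : Prop := {
  HT_hausdorff_dom : hausdorff_space G ;
  HT_hausdorff_codom : hausdorff_space H ;
  HT_complete_codom : mackey_complete H ;
  HT_functional : is_fun (fun x y => g (x, y)) ;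
  HT_open_dom : open (graph_dom g) ;
  HT_continuous : {within graph_dom g, continuous (graph_fun g)} ;
  HT_derivable : directionally_differentiable g
}.

Lemma banach_mackey_complete (Pi : completeNormedModType R[i]) :
  mackey_complete Pi.
Proof.
move=> u [B [Bbnd _ Bu]].
suff /cauchy_cvgP uc : cauchy (u @ \oo) by exists (lim (u @ \oo)).
apply/cauchy_ballP => e e0.
have [r r0 Br] := Bbnd (ball 0 1) (nbhsx_ballx _ _ ltr01).
have [N uN] := Bu (e / r) (divr_gt0 e0 r0).
exists ([set u n | n in [set n | (N <= n)%N]],
        [set u n | n in [set n | (N <= n)%N]]) => /=.
  by split; exists N => // n Nn; exists n.
move=> [_ _] /= [[m Nm <-] [n Nn <-]].
have [b /Br[v v1 <-] uE] := uN _ _ Nm Nn.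
rewrite -ball_normE /= uE scalerA divfK ?gt_eqF// normrZ gtr0_norm//.
rewrite -[ltRHS]mulr1 ltr_pM2l// -normrN -sub0r.
by move: v1; rewrite -ball_normE.
Qed.

End holomorphy.

Arguments HT : clear implicits.

(** Sets open in the topology which [A] inherits from [T]. *)
Record relopen {T : topologicalType} (A : set T) := RelOpen {
  relopen_set :> set T ;
  relopenP : exists2 U, open U & relopen_set = A `&` U
}.

Definition relopen_pt {T : topologicalType} {A : set T} {O : relopen A} {p : T}
  (Op : relopen_set O p) : O := exist _ p (mem_set Op).

Section E_space.
Context {R : realType} (Pi : completeNormedModType R[i]) (I : set R).
Variable O : relopen (I `*` [set: Pi]).

Definition Ebornology (B : set (R * Pi)) :=
  [/\ B `<=` O, bounded_set (snd @` B) &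
      exists2 V, nbhs (0 : Pi) V &
        forall p xi1, B p -> V xi1 -> relopen_set O (p.1, p.2 + xi1)].

Definition section_graph (x : O -> Pi) (t : R) : set (Pi * Pi) :=
  [set p | exists h : relopen_set O (t, p.1), x (relopen_pt h) = p.2].

Definition Eimage (x : O -> Pi) (B : set (R * Pi)) : set Pi :=
  x @` (set_val @^-1` B).

Definition Eset : set (O -> Pi) :=
  [set x | [/\ continuous x,
               forall t, I t -> HT R Pi Pi (section_graph x t) &
               forall B, Ebornology B -> bounded_set (Eimage x B)]].

Lemma section_dom x t :
  graph_dom (section_graph x t) = [set xi | relopen_set O (t, xi)].
Proof.
apply/seteqP; split=> xi /=; first by move=> [y [h _]].
by move=> h; exists (x (relopen_pt h)), h.
Qed.

Lemma section_is_fun x t : is_fun (fun xi y => section_graph x t (xi, y)).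
Proof.
move=> xi y z /= [h /= xy] [h' /= xz]; rewrite -xy -xz.
by rewrite (Prop_irrelevance h h').
Qed.

Lemma section_funE x t xi (h : relopen_set O (t, xi)) :
  graph_fun (section_graph x t) xi = x (relopen_pt h).
Proof.
apply: fun_of_rel_uniq; first exact: section_is_fun.
by exists h.
Qed.

Lemma section_fun_lin x y t a : graph_fun (section_graph (a *: x + y) t) =
  (fun xi => a *: graph_fun (section_graph x t) xi
             + graph_fun (section_graph y t) xi).
Proof.
apply/funext => xi.
have [Oxi|nO] := pselect (relopen_set O (t, xi)).
  by rewrite !(section_funE _ Oxi).
have out z : graph_fun (section_graph z t) xi = 0.
  by rewrite /graph_fun /fun_of_rel xgetPN// => v [h _].
by rewrite !out scaler0 addr0.
Qed.

Lemma section_fun0 t : graph_fun (section_graph 0 t) = (fun=> 0).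
Proof.
apply/funext => xi; have [Oxi|nO] := pselect (relopen_set O (t, xi)).
  by rewrite (section_funE _ Oxi).
by rewrite /graph_fun /fun_of_rel xgetPN// => v [h _].
Qed.

Lemma section_open x t : I t -> open (graph_dom (section_graph x t)).
Proof.
move=> It; rewrite section_dom.
have [U oU OU] := relopenP O.
rewrite (_ : [set _ | _] = (fun xi => (t, xi)) @^-1` U); last first.
  by apply/seteqP; split=> xi /=; rewrite OU; [case|split].
apply: (@open_comp Pi (R * Pi)%type (fun xi => (t, xi))) => // xi _.
exact: (@cvg_pair _ _ _ (nbhs xi) (nbhs t) (nbhs xi) _ _ _ (cst t) id
  (@cvg_cst _ _ _ _ _) (@cvg_id _ _)).
Qed.

Lemma bounded_setP (A : set Pi) :
  bounded_set A <-> exists2 r : R[i], 0 < r & forall v, A v -> `|v| <= r.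
Proof.
split=> [/pinfty_ex_gt0[r r0 Ar]|[r r0 Ar]]; first by exists r.
exists r; split; first exact: gtr0_real.
by move=> s rs v /Ar /le_trans; apply; exact: ltW.
Qed.

Definition Epred : {pred O -> Pi} := mem Eset.

Lemma Eset_submod_closed : submod_closed Epred.
Proof.
split.
  rewrite inE; split=> [|t It|B _].
  - exact: cst_continuous.
  - split.
    + exact: norm_hausdorff.
    + exact: norm_hausdorff.
    + exact: banach_mackey_complete.
    + exact: section_is_fun.
    + exact: section_open.
    + by rewrite section_fun0; exact: cst_continuous.
    + move=> xi u _; exists 0; rewrite section_fun0.
      rewrite (_ : (fun _ => _) = cst 0); first exact: cvg_cst.
      by apply/funext => s; rewrite subrr scaler0.
  - apply/bounded_setP; exists 1 => // _ [p _ <-].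
    by rewrite normr0.
move=> a x y; rewrite !inE => -[cx hx bx] [cy hy by_]; split=> [p|t It|B BB].
- exact: (cvgD (cvgZl_tmp (cx p)) (cy p)).
- have := hx t It; have := hy t It => -[_ _ _ _ _ cyt dy] [_ _ _ _ _ cxt dx].
  split.
  + exact: norm_hausdorff.
  + exact: norm_hausdorff.
  + exact: banach_mackey_complete.
  + exact: section_is_fun.
  + exact: section_open.
  + rewrite section_fun_lin => xi.
    move: cxt cyt; rewrite !section_dom => cxt cyt.
    exact: (cvgD (cvgZl_tmp (cxt xi)) (cyt xi)).
  + move=> xi u; rewrite section_dom => Oxi.
    have [|lx hlx] := dx xi u; first by rewrite section_dom.
    have [|ly hly] := dy xi u; first by rewrite section_dom.
    exists (a *: lx + ly); rewrite section_fun_lin.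
    pose q z (s : R[i]) := s^-1 *: (graph_fun (section_graph z t) (xi + s *: u)
      - graph_fun (section_graph z t) xi).
    rewrite (_ : (fun _ => _) = (a \*: q x) + q y).
      exact: (cvgD (cvgZl_tmp hlx) hly).
    apply/funext => s; rewrite /q fctE /=.
    by rewrite !scalerA mulrC -scalerA -scalerDr opprD addrACA -scalerBr.
- have /bounded_setP[r r0 xr] := bx B BB.
  have /bounded_setP[s s0 ys] := by_ B BB.
  apply/bounded_setP; exists (`|a| * r + s).
    by rewrite ltr_wpDl ?mulr_ge0// ltW.
  move=> _ [p Bp <-]; rewrite (le_trans (ler_normD _ _))// lerD//.
    by rewrite normrZ ler_wpM2l//; apply: xr; exists p.
  by apply: ys; exists p.
Qed.

Record E_space := MkE {
  E_fun :> O -> Pi ;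
  _ : E_fun \in Epred
}.

HB.instance Definition _ := [isSub for E_fun].
HB.instance Definition _ := [Choice of E_space by <:].
HB.instance Definition _ :=
  GRing.isSubmodClosed.Build _ _ Epred Eset_submod_closed.
HB.instance Definition _ := [SubChoice_isSubLmodule of E_space by <:].

Definition Ezero_nbhs (B : set (R * Pi)) (V : set Pi) : set E_space :=
  [set x | Eimage x B `<=` V].

Definition Ezero_basis : set (set E_space) :=
  [set N | exists B V, [/\ Ebornology B, nbhs (0 : Pi) V & N = Ezero_nbhs B V]].

Lemma Ebornology0 : Ebornology set0.
Proof.
split=> //; last by exists setT => //; exact: filterT.
by apply/bounded_setP; exists 1 => // v [].
Qed.

Lemma EbornologyU B C : Ebornology B -> Ebornology C -> Ebornology (B `|` C).
Proof.
move=> [BO /bounded_setP[r r0 Br] [V V0 BV]].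
move=> [CO /bounded_setP[s s0 Cs] [W W0 CW]]; split.
- by move=> p [/BO|/CO].
- apply/bounded_setP; exists (r + s); first exact: addr_gt0.
  move=> _ [p [Bp|Cp] <-].
    by rewrite (le_trans (Br _ _)) ?lerDl ?ltW//; exists p.
  by rewrite (le_trans (Cs _ _)) ?lerDr ?ltW//; exists p.
- exists (V `&` W); first exact: filterI.
  by move=> p v [Bp|Cp] [Vv Wv]; [exact: BV|exact: CW].
Qed.

Lemma nbhs0_absconv (V : set Pi) : nbhs 0 V -> exists2 W, nbhs 0 W &
  absolutely_convex W /\ W `<=` V.
Proof.
move=> /nbhs_norm0P[e /= e0 eV]; exists [set v | `|v| < e].
  by apply/nbhs_norm0P; exists e.
split=> // v w a b /= ve we ab.
have [a0|a0] := eqVneq a 0.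
  rewrite a0 scale0r add0r normrZ (le_lt_trans _ we)// ler_piMl//.
  by rewrite (le_trans _ ab)// lerDr.
rewrite (le_lt_trans (ler_normD _ _))// !normrZ.
rewrite (@lt_le_trans _ _ (`|a| * e + `|b| * e))//.
  by rewrite ltr_leD ?ltr_pM2l ?normr_gt0// ler_wpM2l// ltW.
by rewrite -mulrDl ler_piMl// ltW.
Qed.

Lemma nbhs0_scale (V : set Pi) (c : R[i]) :
  nbhs 0 V -> nbhs 0 [set v | V (c *: v)].
Proof.
move=> V0; have : ( *:%R c : Pi -> Pi) @ (0 : Pi) --> c *: (0 : Pi).
  by apply: cvgZl_tmp; exact: cvg_id.
by rewrite scaler0; apply.
Qed.

Lemma nbhs0_absorb (V : set Pi) (r : R[i]) : nbhs 0 V -> 0 < r ->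
  exists2 c : R[i], c != 0 & forall v, `|v| <= r -> V (c *: v).
Proof.
move=> /nbhs_norm0P[e /= e0 eV] r0; exists (e / (r + r)).
  by rewrite gt_eqF// divr_gt0// addr_gt0.
move=> v vr; apply: eV; rewrite /= normrZ gtr0_norm ?divr_gt0 ?addr_gt0//.
rewrite mulrAC ltr_pdivrMr ?addr_gt0// ltr_pM2l//.
by rewrite (le_lt_trans vr)// ltrDl.
Qed.

Lemma Ezero_basisP : zero_base Ezero_basis.
Proof.
split.
- exists (Ezero_nbhs set0 setT), set0, setT.
  by split=> //; [exact: Ebornology0|exact: filterT].
- move=> _ _ [B [V [BB V0 ->]]] [C [W [CC W0 ->]]].
  exists (Ezero_nbhs (B `|` C) (V `&` W)).
    exists (B `|` C), (V `&` W).
    by split=> //; [exact: EbornologyU|exact: filterI].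
  move=> x xVW; split=> v [p Bp <-].
    by have [] : (V `&` W) (x p) by apply: xVW; exists p => //; left.
  by have [] : (V `&` W) (x p) by apply: xVW; exists p => //; right.
- move=> _ [B [V [BB V0 ->]]]; have [W W0 [Wc WV]] := nbhs0_absconv V0.
  exists (Ezero_nbhs B W); first by exists B, W.
  split; last by move=> x xW v /xW /WV.
  move=> x y a b xW yW ab _ [p Bp <-].
  by apply: Wc => //; [apply: xW; exists p|apply: yW; exists p].
- move=> _ c [B [V [BB V0 ->]]].
  exists (Ezero_nbhs B [set v | V (c *: v)]).
    by exists B, [set v | V (c *: v)]; split=> //; exact: nbhs0_scale.
  by move=> x xV _ [p Bp <-]; apply: xV; exists p.
- move=> _ x [B [V [BB V0 ->]]].
  have : (x : O -> Pi) \in Epred by exact: valP.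
  rewrite inE => -[_ _ /(_ B BB) /bounded_setP[r r0 xr]].
  have [c c0 cV] := nbhs0_absorb V0 r0.
  by exists c => // _ [p Bp <-]; apply: cV; apply: xr; exists p.
Qed.

HB.instance Definition _ :=
  Lmodule_isZeroBaseTvs.Build R[i] E_space Ezero_basisP.

Lemma E_nbhs0P (U : set E_space) : nbhs 0 U <->
  exists B V, [/\ Ebornology B, nbhs (0 : Pi) V & Ezero_nbhs B V `<=` U].
Proof.
split=> [[_ [B [V [BB V0 ->]]] VU]|[B [V [BB V0 VU]]]].
  by exists B, V; split=> // x /VU; rewrite add0r.
by exists (Ezero_nbhs B V); [exists B, V|move=> x /VU; rewrite add0r].
Qed.

End E_space.

Section C1_space.
Context {R : realType} (Pi : completeNormedModType R[i]).
Variables (t0 : R) (A : {posnum R}).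

Definition ivl : set R := `[t0 - A%:num, t0 + A%:num].

(** The (at the endpoints one-sided) derivative of [y] at [t]: the punctured
    neighbourhoods of [t] are taken in the subspace [ivl] of [R]. *)
Definition diff_quotient (y : ivl -> Pi) (t s : ivl) : Pi :=
  ((val s - val t)^-1)%:C *: (y s - y t).

Definition ivl_deriv (y : ivl -> Pi) (t : ivl) : Pi :=
  lim (diff_quotient y t @ t^').

Definition C1set : set (ivl -> Pi) :=
  [set y | (forall t, cvg (diff_quotient y t @ t^')) /\
           continuous (ivl_deriv y)].

Lemma ivl_dnbhs_proper (t : ivl) : ProperFilter (t^').
Proof.
apply: Build_ProperFilter_ex => P [/= _ [[U oU <-] /= Ut] UP].
have /nbhs_ballP[e /= e0 eU] : nbhs (val t) U by exact: open_nbhs_nbhs.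
pose d := Num.min (e / 2) A%:num.
have d0 : 0 < d by rewrite lt_min divr_gt0 //=.
have dA : d <= A%:num by rewrite ge_min lexx orbT.
have de : d < e.
  by rewrite gt_min ltr_pdivrMr// mulr_natr mulr2n ltrDl e0.
have := set_valP t; rewrite /ivl /= in_itv /= => /andP[t1 t2].
suff [s /mem_set Is [sd st]] : exists2 s, ivl s &
    `|val t - s| < e /\ s != val t.
  exists (exist _ s Is); apply: UP; first exact: eU.
  by apply: contra st => /eqP <-.
have [tt0|tt0] := leP (val t) t0.
  exists (val t + d).
    rewrite /ivl /= in_itv /= (le_trans t1) ?lerDl ?(ltW d0)//=.
    exact: lerD.
  split; last by rewrite -subr_eq0 addrAC subrr add0r gt_eqF.
  by rewrite opprD addrA subrr sub0r normrN gtr0_norm.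
exists (val t - d).
  rewrite /ivl /= in_itv /= lerB ?(ltW tt0)//=.
  by rewrite (le_trans _ t2)// gerBl ltW.
split; last by rewrite -subr_eq0 addrAC subrr add0r oppr_eq0 gt_eqF.
by rewrite opprB addrCA subrr addr0 gtr0_norm.
Qed.
#[local] Existing Instance ivl_dnbhs_proper.

Lemma diff_quotient_lin a x y t : diff_quotient (a *: x + y) t =
  (a \*: diff_quotient x t) + diff_quotient y t.
Proof.
apply/funext => s; rewrite /diff_quotient !fctE /=.
by rewrite !scalerA mulrC -scalerA -scalerDr opprD addrACA -scalerBr.
Qed.

Lemma cvg_diff_quotient_lin a x y t :
  cvg (diff_quotient x t @ t^') -> cvg (diff_quotient y t @ t^') ->
  diff_quotient (a *: x + y) t @ t^' --> a *: ivl_deriv x t + ivl_deriv y t.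
Proof.
by move=> xt yt; rewrite diff_quotient_lin; exact: (cvgD (cvgZl_tmp xt) yt).
Qed.

Lemma ivl_deriv_lin a x y t :
  cvg (diff_quotient x t @ t^') -> cvg (diff_quotient y t @ t^') ->
  ivl_deriv (a *: x + y) t = a *: ivl_deriv x t + ivl_deriv y t.
Proof.
move=> xt yt; apply: cvg_lim; first exact: norm_hausdorff.
exact: cvg_diff_quotient_lin.
Qed.

Definition C1pred : {pred ivl -> Pi} := mem C1set.

Lemma diff_quotient0 t : diff_quotient 0 t = cst 0.
Proof. by apply/funext => s; rewrite /diff_quotient subrr scaler0. Qed.

Lemma ivl_deriv0 : ivl_deriv 0 = cst 0.
Proof.
apply/funext => t; rewrite /ivl_deriv diff_quotient0.
by apply: cvg_lim; [exact: norm_hausdorff|exact: cvg_cst].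
Qed.

Lemma C1_submod_closed : submod_closed C1pred.
Proof.
split.
  rewrite inE; split=> [t|]; last by rewrite ivl_deriv0; exact: cst_continuous.
  by apply/cvg_ex; exists 0; rewrite diff_quotient0; exact: cvg_cst.
move=> a x y; rewrite !inE => -[dx cx] [dy cy]; split=> [t|].
  by apply/cvg_ex; eexists; exact: cvg_diff_quotient_lin.
rewrite (_ : ivl_deriv _ = (a \*: ivl_deriv x) + ivl_deriv y); last first.
  by apply/funext => t; exact: ivl_deriv_lin.
by move=> t; exact: (cvgD (cvgZl_tmp (cx t)) (cy t)).
Qed.

Record C1_space := MkC1 {
  C1_fun :> ivl -> Pi ;
  _ : C1_fun \in C1pred
}.

HB.instance Definition _ := [isSub for C1_fun].
HB.instance Definition _ := [Choice of C1_space by <:].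
HB.instance Definition _ :=
  GRing.isSubmodClosed.Build _ _ C1pred C1_submod_closed.
HB.instance Definition _ := [SubChoice_isSubLmodule of C1_space by <:].

Definition C1zero_nbhs (V : set Pi) : set C1_space :=
  [set y | forall t, V (y t) /\ V (ivl_deriv y t)].

(** Basis of zero neighbourhoods for uniform convergence of [y] and [y']. *)
Definition C1zero_basis : set (set C1_space) :=
  [set N | exists2 V, nbhs (0 : Pi) V & N = C1zero_nbhs V].

Lemma C1_valP (y : C1_space) : C1set y.
Proof. by have := valP y; rewrite inE. Qed.

Lemma C1_continuous (y : C1_space) : continuous y.
Proof.
move=> t; have [/(_ t) yt _] := C1_valP y.
have Ft : Filter (nbhs t) by exact: nbhs_filter.
have [M M0 yM] := pinfty_ex_gt0 (cvg_bounded _ _ yt).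
have vt : (val : ivl -> R) @ t --> val t by exact: initial_continuous.
have Mre : (complex.Re M)%:C = M by rewrite RRe_real// gtr0_real.
have Mre0 : 0 < complex.Re M by rewrite -ltcR Mre.
apply/cvgrPdist_lt => e e0.
have ere : (complex.Re e)%:C = e by rewrite RRe_real// gtr0_real.
have ere0 : 0 < complex.Re e by rewrite -ltcR ere.
have eM0 : 0 < complex.Re e / complex.Re M by exact: divr_gt0.
move/cvgrPdist_lt : vt => /(_ _ eM0) vt.
rewrite /dnbhs /within /= in yM.
near=> s.
have [->|st] := eqVneq s t; first by rewrite subrr normr0.
have qM : `|diff_quotient y t s| <= M by move: st; near: s; exact: yM.
have ste : `|val t - val s| < complex.Re e / complex.Re M by near: s; exact: vt.
have vst : val s - val t != 0.
  by rewrite subr_eq0; apply: contra st => /eqP /val_inj ->.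
have -> : y t - y s = - ((val s - val t)%:C *: diff_quotient y t s).
  by rewrite /diff_quotient scalerA -rmorphM divff// scale1r opprB.
rewrite normrN normrZ normc_def /= expr0n /= addr0 sqrtr_sqr distrC.
rewrite (@le_lt_trans _ _ (`|val t - val s|%:C * M))//.
  by rewrite ler_wpM2l// lecR.
by rewrite -Mre -ere -rmorphM ltcR -ltr_pdivlMr.
Unshelve. all: by end_near. Qed.

Lemma C1_deriv_lin a (x y : C1_space) t :
  ivl_deriv (a *: x + y : C1_space) t = a *: ivl_deriv x t + ivl_deriv y t.
Proof.
have [dx _] := C1_valP x; have [dy _] := C1_valP y.
exact: ivl_deriv_lin.
Qed.

Lemma C1_deriv_scale a (x : C1_space) t :
  ivl_deriv (a *: x : C1_space) t = a *: ivl_deriv x t.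
Proof.
have := C1_deriv_lin a x 0 t; rewrite addr0 => ->.
by rewrite [ivl_deriv (0 : C1_space)]ivl_deriv0 addr0.
Qed.

Lemma ivl_bounded (z : ivl -> Pi) : continuous z ->
  exists2 r : R[i], 0 < r & forall t, `|z t| <= r.
Proof.
move=> /(@subspace_valL_continuousP' _ ivl _ 0) cz.
have cn : continuous (fun v : Pi => complex.Re `|v| : R).
  move=> v; apply/cvgrPdist_lt => e e0.
  have : \forall w \near v, `|v - w| < e%:C.
    by apply: cvgr_dist_lt => //; rewrite ltcR.
  apply: filterS => w vw; rewrite -ltcR (le_lt_trans _ vw)//.
  have -> : complex.Re `|v| - complex.Re `|w| = complex.Re (`|v| - `|w|).
    by case: (`|v|) => ? ?; case: (`|w|).
  by rewrite (le_trans (normc_ge_Re _))// ler_dist_dist.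
have cf : {within ivl, continuous (fun t => complex.Re `|valL_ 0 z t| : R)}.
  by move=> t; exact: (continuous_comp (cz t) (cn _)).
have Ic : compact ivl by exact: segment_compact.
have := compact_bounded (continuous_compact cf Ic).
move=> /pinfty_ex_gt0[r r0 Hr].
exists r%:C; first by rewrite ltcR.
move=> t; rewrite -[leLHS]RRe_real ?normr_real// lecR.
apply: le_trans (ler_norm _) _; apply: Hr.
exists (val t); first exact: set_valP.
by rewrite -[in RHS](valLK 0 z).
Qed.

Lemma C1zero_basisP : zero_base C1zero_basis.
Proof.
split.
- by exists (C1zero_nbhs setT), setT => //; exact: filterT.
- move=> _ _ [V V0 ->] [W W0 ->]; exists (C1zero_nbhs (V `&` W)).
    by exists (V `&` W) => //; exact: filterI.
  by move=> y yVW; split=> t; have [[? ?] [? ?]] := yVW t.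
- move=> _ [V V0 ->]; have [W W0 [Wc WV]] := nbhs0_absconv V0.
  exists (C1zero_nbhs W); first by exists W.
  split; last by move=> y yW t; have [/WV ? /WV ?] := yW t.
  move=> x y a b xW yW ab t.
  have [? ?] := xW t; have [? ?] := yW t.
  by split; [exact: Wc|rewrite C1_deriv_lin C1_deriv_scale; exact: Wc].
- move=> _ c [V V0 ->]; exists (C1zero_nbhs [set v | V (c *: v)]).
    by exists [set v | V (c *: v)] => //; exact: nbhs0_scale.
  move=> y yV t; have [? ?] := yV t; split=> //.
  by rewrite C1_deriv_scale.
- move=> _ y [V V0 ->].
  have [r r0 yr] := ivl_bounded (@C1_continuous y).
  have [_ /ivl_bounded[s s0 ys]] := C1_valP y.
  have [c c0 cV] := nbhs0_absorb V0 (addr_gt0 r0 s0).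
  exists c => // t; split.
    by apply: cV; rewrite (le_trans (yr t))// lerDl ltW.
  by rewrite C1_deriv_scale; apply: cV; rewrite (le_trans (ys t))// lerDr ltW.
Qed.

HB.instance Definition _ :=
  Lmodule_isZeroBaseTvs.Build R[i] C1_space C1zero_basisP.

Lemma C1_nbhs0P (U : set C1_space) : nbhs 0 U <->
  exists2 V, nbhs (0 : Pi) V & C1zero_nbhs V `<=` U.
Proof.
split=> [[_ [V V0 ->] VU]|[V V0 VU]].
  by exists V => // y /VU; rewrite add0r.
by exists (C1zero_nbhs V); [exists V|move=> y /VU; rewrite add0r].
Qed.

Lemma ivl_center_subproof : t0 \in ivl.
Proof. by rewrite inE /ivl /= in_itv /= gerBl lerDl ge0. Qed.

Definition ivl_center : ivl := exist _ t0 ivl_center_subproof.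

End C1_space.

Section initial_value_problem.
Context {R : realType} {Pi : completeNormedModType R[i]}.
Context {t0 : R} {A : {posnum R}} (O : relopen (ivl t0 A `*` [set: Pi])).

(** The library norm of [Pi] is [R[i]]-valued; its values are real. *)
Definition rnorm (v : Pi) : R := complex.Re `|v|.

Definition ivp_solution (xi : Pi) (phi : E_space O) (y : C1_space Pi t0 A) :=
  exists yO : forall t : ivl t0 A, relopen_set O (val t, y t),
    (forall t, ivl_deriv y t = phi (relopen_pt (yO t))) /\
    y (ivl_center t0 A) = xi.

Definition ivp_graph : set ((Pi * E_space O) * C1_space Pi t0 A) :=
  [set p | ivp_solution p.1.1 p.1.2 p.2].

End initial_value_problem.

Arguments ivp_graph {R Pi t0 A} O.

(* Main.v *)
Require Import Defs.
From mathcomp Require Import all_boot all_order all_algebra.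
From mathcomp Require Import interval_inference complex.
From mathcomp Require Import all_classical all_reals all_analysis.
From mathcomp Require Import lra ring.
Import Order.TTheory GRing.Theory Num.Theory.
Import numFieldNormedType.Exports.
Local Open Scope classical_set_scope.
Local Open Scope ring_scope.
Local Open Scope complex_scope.

(** The solution of $y'=\varphi(t,y)$, $y(t_0)=\xi$ is studied by comparison
    arguments for the derivatives of curves.

    Along curves, the basic tool is [barrier]: if the velocity of a curve is
    bounded by the slope of a convex function $g$ as long as the curve itself is
    bounded by $g$, then the latter bound persists. Linear $g$ give the mean
    value inequality, exponential $g$ give [gronwall]. As a consequence, limits
    of curves whose slopes converge uniformly are differentiable
    ([near_primitive_limit]); this yields primitives of continuous curves, the
    completeness of $C^1$, and, by successive approximation in an exponentially
    weighted norm, global solutions for right hand sides that are Lipschitz in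
    the unknown ([ode_exists]).

    The functions $\varphi(t,\cdot)$ are only assumed to be continuous and
    complex differentiable along lines. That they are Lipschitz on bounded sets
    of the bornology, with a constant determined by a bound for $|\varphi|$, and
    that difference quotients converge at a uniform rate, follows from Cauchy
    estimates. These come from [goursat] for rectangles, stated with primitives
    along the sides in place of integrals. In polar coordinates it shows that the
    value of a function at the centre of a disc is bounded by its values on the
    boundary circle, even if the function is merely continuous at the centre
    ([center_bound]). Applied to difference quotients this bounds first
    derivatives ([cauchy_estimate]), and applied to differences of two
    difference quotients it bounds the variation of the derivative
    ([quadratic_remainder]).

    A solution $y$ for $(\xi,\varphi)$ has a tube around its graph that belongs
    to the bornology. A right hand side close to $\varphi$ on the tube is bounded,
    hence Lipschitz on a smaller tube. Composed with a retraction onto this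
    smaller tube it becomes globally Lipschitz and has a solution by
    [ode_exists], which by [gronwall] stays in the smaller tube and is close
    to $y$ ([solution_near]). This gives the openness of the domain and the
    continuity of the solution map, and [gronwall] also gives uniqueness
    ([solves_unique]). For the data $(\xi+u\eta,\varphi+u\psi)$ with complex
    $u\to0$, the difference quotients of the solutions obey a linear differential
    inequality with an inhomogeneous part of the order of $u$ ([quotients_near]),
    so they form a Cauchy family in the complete space $C^1$ and the directional
    derivative exists without being identified. Finally, if
    $|\varphi|<B_1/(2A)$ on the cylinder of radius $B_1$ about $\xi$, then
    the truncated solution moves by at most $A\cdot B_1/(2A)=B_1/2$
    ([ivp_dom_of_bound]), so it never meets the truncation at radius $B_1/2$,
    while the Lipschitz estimate at this radius may use the bound on the
    cylinder of twice the radius. *)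

Set Implicit Arguments.
Unset Strict Implicit.
Unset Printing Implicit Defensive.

(** * Linear identities in modules *)

Inductive lin_expr (K : Type) : Type :=
| LVar of nat
| LZero
| LAdd of lin_expr K & lin_expr K
| LOpp of lin_expr K
| LScale of K & lin_expr K.
Arguments LVar {K}.
Arguments LZero {K}.

Section lin_expr.
Context {K : pzRingType} {V : lmodType K}.

Fixpoint lin_eval (s : seq V) (e : lin_expr K) : V :=
  match e with
  | LVar n => nth 0 s n
  | LZero => 0
  | LAdd e1 e2 => lin_eval s e1 + lin_eval s e2
  | LOpp e1 => - lin_eval s e1
  | LScale a e1 => a *: lin_eval s e1
  end.

Fixpoint lin_coef (e : lin_expr K) (n : nat) : K :=
  match e with
  | LVar m => if eqn m n then 1 else 0
  | LZero => 0
  | LAdd e1 e2 => lin_coef e1 n + lin_coef e2 n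
  | LOpp e1 => - lin_coef e1 n
  | LScale a e1 => a * lin_coef e1 n
  end.

Fixpoint lin_coef_eq (e1 e2 : lin_expr K) (n : nat) : Prop :=
  match n with
  | 0 => True
  | n'.+1 => lin_coef e1 n' = lin_coef e2 n' /\ lin_coef_eq e1 e2 n'
  end.

Lemma lin_evalE s e : lin_eval s e = \sum_(i < size s) lin_coef e i *: s`_i.
Proof.
elim: e => [n||e1 IH1 e2 IH2|e IH|a e IH] /=.
- have [ns|ns] := ltnP n (size s); last first.
    rewrite nth_default// big1// => i _; rewrite -[eqn _ _]/(n == i).
    by rewrite gtn_eqF ?scale0r// (leq_trans (ltn_ord i)).
  rewrite (bigD1 (Ordinal ns))//= -[eqn _ _]/(n == n) eqxx scale1r.
  rewrite big1 ?addr0// => i; rewrite -[eqn _ _]/(n == i) eq_sym -val_eqE /=.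
  by move=> /negbTE ->; rewrite scale0r.
- by rewrite big1// => i _; rewrite scale0r.
- by rewrite IH1 IH2 -big_split /=; apply: eq_bigr => i _; rewrite scalerDl.
- by rewrite IH -sumrN; apply: eq_bigr => i _; rewrite scaleNr.
- by rewrite IH scaler_sumr; apply: eq_bigr => i _; rewrite scalerA.
Qed.

(** Two linear combinations of the same vectors agree as soon as their
    coefficients do; this turns identities of vectors into identities of
    scalars. *)
Lemma lin_eval_eq s e1 e2 :
  lin_coef_eq e1 e2 (size s) -> lin_eval s e1 = lin_eval s e2.
Proof.
move=> e12; rewrite !lin_evalE; apply: eq_bigr => -[i /= si] _; congr (_ *: _).
elim: (size s) e12 si => [//|n IH] /= [en e12].
by rewrite ltnS leq_eqVlt => /orP[/eqP ->//|]; exact: IH.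
Qed.

End lin_expr.

Ltac lin_index v s :=
  lazymatch s with
  | v :: _ => constr:(0%N)
  | _ :: ?s' => let n := lin_index v s' in constr:(n.+1)
  end.

Ltac lin_atoms V s t :=
  lazymatch t with
  | ?x + ?y => let s' := lin_atoms V s x in lin_atoms V s' y
  | - ?x => lin_atoms V s x
  | ?a *: ?x => lin_atoms V s x
  | 0 => s
  | _ => match s with
         | context [t :: _] => s
         | _ => constr:(@cons V t s)
         end
  end.

Ltac lin_reify K s t :=
  lazymatch t with
  | ?x + ?y =>
      let e1 := lin_reify K s x in let e2 := lin_reify K s y in
      constr:(@LAdd K e1 e2)
  | - ?x => let e := lin_reify K s x in constr:(@LOpp K e)
  | ?a *: ?x => let e := lin_reify K s x in constr:(@LScale K a e)
  | 0 => constr:(@LZero K)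
  | _ => let n := lin_index t s in constr:(@LVar K n)
  end.

(** The atoms are collected up to syntactic equality. The goals left are the
    identities between the coefficients, one for each atom. *)
Ltac lin_coefs K V :=
  lazymatch goal with
  | |- ?x = ?y =>
      let s0 := constr:(@nil V) in
      let s1 := lin_atoms V s0 x in
      let s := lin_atoms V s1 y in
      let e1 := lin_reify K s x in
      let e2 := lin_reify K s y in
      apply: (@lin_eval_eq _ V s e1 e2);
      cbn [lin_coef_eq lin_coef eqn size]; repeat split
  end.

(** * Real-valued norms *)

Definition cabs {R : realType} (z : R[i]) : R := complex.Re `|z|.

Section norms.
Context {R : realType} {Pi : completeNormedModType R[i]}.
Implicit Types (u v w : Pi) (z : R[i]) (r e : R).

Lemma cabsE z : (cabs z)%:C = `|z|.
Proof. by apply: RRe_real; exact: normr_real. Qed.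

Lemma cabs_ge0 z : 0 <= cabs z.
Proof. by rewrite -lecR cabsE normr_ge0. Qed.

Lemma cabs_gt0 z : (0 < cabs z) = (z != 0).
Proof. by rewrite -ltcR cabsE normr_gt0. Qed.

Lemma cabs0 : cabs (0 : R[i]) = 0.
Proof. by rewrite /cabs normr0. Qed.

Lemma cabsN z : cabs (- z) = cabs z.
Proof. by rewrite /cabs normrN. Qed.

Lemma cabsM z z' : cabs (z * z') = cabs z * cabs z'.
Proof. by apply: complexI; rewrite cabsE normrM rmorphM /= !cabsE. Qed.

Lemma cabsV z : cabs z^-1 = (cabs z)^-1.
Proof. by apply: complexI; rewrite cabsE normfV fmorphV /= cabsE. Qed.

Lemma cabsD z z' : cabs (z + z') <= cabs z + cabs z'.
Proof. by rewrite -lecR rmorphD /= !cabsE ler_normD. Qed.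

Lemma cabs_real r : cabs r%:C = `|r|.
Proof. by rewrite /cabs normc_def /= expr0n addr0 sqrtr_sqr. Qed.

Lemma rnormE v : (rnorm v)%:C = `|v|.
Proof. by apply: RRe_real; exact: normr_real. Qed.

Lemma rnorm_ge0 v : 0 <= rnorm v.
Proof. by rewrite -lecR rnormE normr_ge0. Qed.

Lemma rnorm0 : rnorm (0 : Pi) = 0.
Proof. by rewrite /rnorm normr0. Qed.

Lemma rnorm_le0 v : rnorm v <= 0 -> v = 0.
Proof. by rewrite -lecR rnormE normr_le0 => /eqP. Qed.

Lemma rnormN v : rnorm (- v) = rnorm v.
Proof. by rewrite /rnorm normrN. Qed.

Lemma rnormB u v : rnorm (u - v) = rnorm (v - u).
Proof. by rewrite -rnormN opprB. Qed.

Lemma rnormD u v : rnorm (u + v) <= rnorm u + rnorm v.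
Proof. by rewrite -lecR rmorphD /= !rnormE ler_normD. Qed.

Lemma rnormBD u v : rnorm (u - v) <= rnorm u + rnorm v.
Proof. by rewrite (le_trans (rnormD _ _))// rnormN. Qed.

Lemma rnorm_tri w u v : rnorm (u - v) <= rnorm (u - w) + rnorm (w - v).
Proof. by rewrite (_ : u - v = u - w + (w - v)) ?rnormD// subrKA. Qed.

Lemma rnorm_shift u v : rnorm u <= rnorm v + rnorm (u - v).
Proof. by rewrite -{1}(subrKC v u) rnormD. Qed.

Lemma rnormZ z v : rnorm (z *: v) = cabs z * rnorm v.
Proof. by apply: complexI; rewrite rnormE normrZ rmorphM /= cabsE rnormE. Qed.

Lemma rnormZr r v : rnorm (r%:C *: v) = `|r| * rnorm v.
Proof. by rewrite rnormZ cabs_real. Qed.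

Lemma rnorm_le_eps v r : (forall e, 0 < e -> rnorm v <= r + e) -> rnorm v <= r.
Proof.
move=> H; rewrite leNgt; apply/negP => rv.
have := H ((rnorm v - r) / 2); rewrite divr_gt0 ?subr_gt0// => /(_ isT).
by move: rv; lra.
Qed.

Lemma gt0_Re (e : R[i]) : 0 < e -> 0 < complex.Re e /\ (complex.Re e)%:C = e.
Proof.
by move=> e0; have E := RRe_real (gtr0_real e0); rewrite -ltcR E.
Qed.

Lemma nbhs_rnormP v (U : set Pi) : nbhs v U <->
  exists2 e, 0 < e & forall w, rnorm (w - v) < e -> U w.
Proof.
have vU := nbhs_normP v U; split=> [/vU[e /= /gt0_Re[e0 eE] eU]|[e e0 eU]].
  exists (complex.Re e) => // w vw; apply: eU; rewrite /= distrC.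
  by rewrite -rnormE -eE ltcR.
apply/vU; exists e%:C; first by rewrite /= ltcR.
by move=> w /=; rewrite distrC -rnormE ltcR => /eU.
Qed.

Lemma nbhs_cabsP z (U : set R[i]) : nbhs (z : R[i]^o) U <->
  exists2 e, 0 < e & forall z', cabs (z' - z) < e -> U z'.
Proof.
have zU := nbhs_normP (z : R[i]^o) U; split=> [/zU[e /= /gt0_Re[e0 eE] eU]|[e e0 eU]].
  exists (complex.Re e) => // w vw; apply: eU; rewrite /= distrC.
  by rewrite -cabsE -eE ltcR.
apply/zU; exists e%:C; first by rewrite /= ltcR.
by move=> w /=; rewrite distrC -cabsE ltcR => /eU.
Qed.

Lemma rnorm_complete (u : nat -> Pi) :
  (forall e, 0 < e -> exists N, forall m n, (N <= m)%N -> (N <= n)%N ->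
     rnorm (u m - u n) <= e) ->
  exists l, forall e, 0 < e -> exists N, forall n, (N <= n)%N ->
    rnorm (u n - l) <= e.
Proof.
move=> uC; suff /cauchy_cvgP uc : cauchy (u @ \oo).
  exists (lim (u @ \oo)) => e e0.
  have : \forall n \near \oo, `|u n - lim (u @ \oo)| <= e%:C.
    by apply: cvgr_distC_le => //; rewrite ltcR.
  by move=> [N _ NP]; exists N => n /NP; rewrite -rnormE lecR.
apply/cauchy_ballP => e /gt0_Re[e0 eE].
have [|N uN] := uC (complex.Re e / 2); first by rewrite divr_gt0.
exists ([set u n | n in [set n | (N <= n)%N]],
        [set u n | n in [set n | (N <= n)%N]]) => /=.
  by split; exists N => // n Nn; exists n.
move=> [_ _] /= [[m Nm <-] [n Nn <-]].
rewrite -ball_normE /= -rnormE -eE ltcR (le_lt_trans (uN _ _ Nm Nn))//.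
by rewrite ltr_pdivrMr// mulr_natr mulr2n ltrDl.
Qed.

End norms.

(** * Arguments by continuity along an interval *)

Section intervals.
Context {R : realType}.
Implicit Types (a b d t s : R) (P : R -> Prop).

(** The supremum of the points up to which [P] holds cannot be smaller than
    [b]: by the assumption on left limits [P] holds there, and by the last
    assumption it holds a little further on. *)
Lemma real_induction a b P : a <= b -> P a ->
  (forall t, a < t -> t <= b -> (forall s, a <= s -> s < t -> P s) -> P t) ->
  (forall t, a <= t -> t < b -> (forall s, a <= s -> s <= t -> P s) ->
     exists2 d, 0 < d & forall s, t < s -> s < t + d -> s <= b -> P s) ->
  forall t, a <= t -> t <= b -> P t.
Proof.
move=> ab Pa Pl Pr.
pose S := [set t | a <= t <= b /\ forall s, a <= s -> s <= t -> P s].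
have Sa : S a.
  by split; [rewrite lexx|move=> s s1 s2; have -> : s = a by apply/le_anti/andP].
have Sb : ubound S b by move=> x [/andP[]].
have Ss : has_sup S by split; [exists a|exists b].
set c := sup S.
have ac : a <= c by apply: ub_le_sup => //; exists b.
have cb : c <= b by apply: ge_sup => //; exists a.
have Plt s : a <= s -> s < c -> P s.
  move=> s1 s2; have [|x [xb xP] sx] := @sup_adherent _ _ (c - s) _ Ss; first by rewrite subr_gt0.
  by apply: xP => //; move: sx; rewrite -/c; lra.
have Pc : P c.
  by move: ac; rewrite le_eqVlt => /orP[/eqP <-//|ac]; exact: Pl.
have Ple s : a <= s -> s <= c -> P s.
  by move=> s1; rewrite le_eqVlt => /orP[/eqP ->//|]; exact: Plt.
suff cbE : c = b by move=> t t1 t2; apply: Ple => //; rewrite cbE.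
apply/le_anti; rewrite cb /= leNgt; apply/negP => cb'.
have [d d0 Pd] := Pr c ac cb' Ple.
pose x := Num.min b (c + d / 2).
have cx : c < x by rewrite lt_min cb' /= ltrDl divr_gt0.
suff /(ub_le_sup (ex_intro _ b Sb)) : S x by rewrite -/c leNgt cx.
have xb : x <= b by rewrite ge_min lexx.
have xd : x <= c + d / 2 by rewrite ge_min lexx orbT.
split; first by rewrite xb (le_trans ac)// ltW.
move=> s s1 s2; have [sc|cs] := leP s c; first exact: Ple.
by apply: Pd => //; [move: s2 xd d0; lra|exact: le_trans xb].
Qed.

(** This is how compactness of the interval is used: the radii of tubes and the
    reciprocals of bounds can be chosen locally. *)
Lemma uniform_on_segment a b (Q : R -> R -> Prop) : a <= b ->
  (forall r r' t, Q r t -> 0 < r' -> r' <= r -> Q r' t) ->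
  (forall t, a <= t -> t <= b -> exists r d, [/\ 0 < r, 0 < d &
     forall s, a <= s -> s <= b -> `|s - t| < d -> Q r s]) ->
  exists2 r, 0 < r & forall t, a <= t -> t <= b -> Q r t.
Proof.
move=> ab Qm Ql.
pose P t := exists2 r, 0 < r & forall s, a <= s -> s <= t -> Q r s.
have glue t s x r1 : a <= s -> s <= x -> x <= b -> P s -> 0 < r1 ->
    (forall y, s < y -> y <= x -> Q r1 y) -> P x.
  move=> s1 sx xb [r2 r20 Q2] r10 Q1; exists (Num.min r1 r2).
    by rewrite lt_min r10.
  move=> y y1 y2; have [ys|sy] := leP y s.
    by apply: (Qm r2); [exact: Q2|rewrite lt_min r10|rewrite ge_min lexx orbT].
  by apply: (Qm r1); [exact: Q1|rewrite lt_min r10|rewrite ge_min lexx].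
suff /(_ b ab (lexx b)) : forall t, a <= t -> t <= b -> P t by [].
apply: real_induction => //.
- have [r [d [r0 d0 Qd]]] := Ql a (lexx a) ab; exists r => // s s1 s2.
  have -> : s = a by apply/le_anti/andP.
  by apply: Qd => //; rewrite subrr normr0.
- move=> t at_ tb Pt; have [r [d [r0 d0 Qd]]] := Ql t (ltW at_) tb.
  pose s := Num.max a (t - d / 2).
  have as_ : a <= s by rewrite le_max lexx.
  have ds : t - d / 2 <= s by rewrite le_max lexx orbT.
  have st : s < t by rewrite gt_max at_ /=; move: d0; lra.
  apply: (glue t s t r) => //; [exact: ltW|exact: Pt|].
  move=> y sy yt; apply: Qd; [lra|lra|].
  by rewrite ler0_norm; lra.
- move=> t at_ tb Pt; have [r [d [r0 d0 Qd]]] := Ql t at_ (ltW tb).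
  exists d => // s ts sd sb; apply: (glue t t s r) => //; [exact: ltW|exact: Pt|].
  move=> y ty ys; apply: Qd; [lra|lra|].
  by rewrite ger0_norm; lra.
Qed.

End intervals.

(** * Differential calculus of curves *)

Section curves.
Context {R : realType} {Pi : completeNormedModType R[i]}.
Implicit Types (a b t s d e : R) (F G v w : R -> Pi).

(** Differentiability up to the error [e], a notion that also covers polygons
    approximating a primitive and that passes to differences and limits. *)
Definition near_primitive a b e F v := forall t, a <= t <= b ->
  exists2 d, 0 < d & forall s, a <= s <= b -> `|s - t| < d ->
    rnorm (F s - F t - (s - t)%:C *: v t) <= e * `|s - t|.

Definition primitive a b F v := forall e, 0 < e -> near_primitive a b e F v.

Definition continuous_curve a b v := forall t, a <= t <= b ->
  forall e, 0 < e -> exists2 d, 0 < d & forall s, a <= s <= b ->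
    `|s - t| < d -> rnorm (v s - v t) <= e.

Lemma near_primitive_continuous a b e F v :
  0 <= e -> near_primitive a b e F v -> continuous_curve a b F.
Proof.
move=> e0 Fv t tab h h0; have [d d0 Fd] := Fv t tab.
pose K := e + rnorm (v t) + 1.
have K0 : 0 < K by rewrite ltr_wpDl// addr_ge0// rnorm_ge0.
exists (Num.min d (h / K)); first by rewrite lt_min d0 divr_gt0.
move=> s sab; rewrite lt_min => /andP[sd sh].
have := Fd s sab sd; set x := _ - _ *: _ => xe.
have -> : F s - F t = x + (s - t)%:C *: v t by rewrite /x subrK.
apply: (le_trans (rnormD _ _)); rewrite rnormZr.
apply: (@le_trans _ _ (K * `|s - t|)).
  rewrite /K !mulrDl mul1r [rnorm _ * _]mulrC; have := normr_ge0 (s - t); lra.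
by rewrite mulrC -ler_pdivlMr// ltW.
Qed.

Lemma primitive_continuous a b F v : primitive a b F v -> continuous_curve a b F.
Proof. by move=> Fv; apply: (near_primitive_continuous ler01); exact: Fv. Qed.

Lemma near_primitiveB a b e e' F G v w :
  near_primitive a b e F v -> near_primitive a b e' G w ->
  near_primitive a b (e + e') (fun t => F t - G t) (fun t => v t - w t).
Proof.
move=> Fv Gw t tab; have [d d0 Fd] := Fv t tab; have [d' d'0 Gd] := Gw t tab.
exists (Num.min d d'); first by rewrite lt_min d0.
move=> s sab; rewrite lt_min => /andP[sd sd'].
have -> : F s - G s - (F t - G t) - (s - t)%:C *: (v t - w t) =
    (F s - F t - (s - t)%:C *: v t) - (G s - G t - (s - t)%:C *: w t).
  by lin_coefs R[i] Pi; ring.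
by rewrite (le_trans (rnormBD _ _))// mulrDl lerD ?Fd ?Gd.
Qed.

Lemma primitiveB a b F G v w : primitive a b F v -> primitive a b G w ->
  primitive a b (fun t => F t - G t) (fun t => v t - w t).
Proof.
move=> Fv Gw e e0; rewrite [e]splitr.
by apply: near_primitiveB; [apply: Fv|apply: Gw]; rewrite divr_gt0.
Qed.

Lemma primitiveZ a b F v (z : R[i]) : primitive a b F v ->
  primitive a b (fun t => z *: F t) (fun t => z *: v t).
Proof.
move=> Fv e e0 t tab.
have K0 : 0 < cabs z + 1 by rewrite ltr_wpDl// cabs_ge0.
have [d d0 Fd] := Fv (e / (cabs z + 1)) (divr_gt0 e0 K0) t tab.
exists d => // s sab sd.
have -> : z *: F s - z *: F t - (s - t)%:C *: (z *: v t) =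
    z *: (F s - F t - (s - t)%:C *: v t).
  by lin_coefs R[i] Pi; ring.
rewrite rnormZ (@le_trans _ _ ((cabs z + 1) * (e / (cabs z + 1) * `|s - t|)))//.
  by rewrite ler_pM ?cabs_ge0 ?rnorm_ge0 ?Fd// lerDl.
by rewrite mulrA [_ * (e / _)]mulrC divfK ?gt_eqF.
Qed.

Lemma primitive_const a b (c : Pi) : primitive a b (fun=> c) (fun=> 0).
Proof.
move=> e e0 t _; exists 1 => // s _ _.
by rewrite scaler0 subrr subr0 rnorm0 mulr_ge0// ltW.
Qed.

Lemma near_primitive_ext a b e F G v w : (forall t, a <= t <= b -> F t = G t) ->
  (forall t, a <= t <= b -> v t = w t) ->
  near_primitive a b e F v -> near_primitive a b e G w.
Proof.
move=> FG vw Fv t tab; have [d d0 Fd] := Fv t tab; exists d => // s sab sd.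
by rewrite -!FG// -vw//; exact: Fd.
Qed.

Lemma primitive_ext a b F G v w : (forall t, a <= t <= b -> F t = G t) ->
  (forall t, a <= t <= b -> v t = w t) -> primitive a b F v -> primitive a b G w.
Proof. by move=> FG vw Fv e e0; exact/(near_primitive_ext FG vw)/Fv. Qed.

Lemma primitiveBc a b F v (c : Pi) : primitive a b F v ->
  primitive a b (fun t => F t - c) v.
Proof.
move=> Fv; apply: primitive_ext (primitiveB Fv (primitive_const c)) => //.
by move=> t _; rewrite subr0.
Qed.

Lemma near_primitive_close a b e e' F v w : near_primitive a b e F v ->
  (forall t, a <= t <= b -> rnorm (v t - w t) <= e') ->
  near_primitive a b (e + e') F w.
Proof.
move=> Fv vw t tab; have [d d0 Fd] := Fv t tab; exists d => // s sab sd.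
have -> : F s - F t - (s - t)%:C *: w t =
    (F s - F t - (s - t)%:C *: v t) + (s - t)%:C *: (v t - w t).
  by lin_coefs R[i] Pi; ring.
rewrite (le_trans (rnormD _ _))// mulrDl lerD ?Fd// rnormZr mulrC.
by rewrite ler_wpM2r// vw.
Qed.

Lemma near_primitive_subset a b a' b' e F v : a <= a' -> b' <= b ->
  near_primitive a b e F v -> near_primitive a' b' e F v.
Proof.
move=> aa bb Fv t /andP[t1 t2].
have [|d d0 Fd] := Fv t; first by rewrite (le_trans aa) ?(le_trans _ bb).
exists d => // s /andP[s1 s2]; apply: Fd.
by rewrite (le_trans aa) ?(le_trans _ bb).
Qed.

Lemma near_primitive_affine a b a' b' e F v (c k : R) : `|k| = 1 ->
  (forall t, a' <= t <= b' -> a <= c + k * t <= b) ->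
  near_primitive a b e F v ->
  near_primitive a' b' e (fun t => F (c + k * t)) (fun t => k%:C *: v (c + k * t)).
Proof.
move=> k1 cab Fv t tab; have [d d0 Fd] := Fv _ (cab t tab).
have E s : c + k * s - (c + k * t) = k * (s - t) by ring.
have N s : `|k * (s - t)| = `|s - t| by rewrite normrM k1 mul1r.
exists d => // s sab sd; have := Fd _ (cab s sab); rewrite E N => /(_ sd).
by rewrite scalerA -rmorphM /= [(s - t) * k]mulrC.
Qed.

(** Where the bound by [g] holds, the speed of the curve together with the error
    [e] of the near primitive is at most the slope [g' t] of a line supporting
    [g] from below at [t]. So the bound is preserved a little longer and cannot
    fail for a first time. *)
Lemma barrier a e F v (g g' : R -> R) : 0 <= a -> 0 <= e ->
  near_primitive 0 a e F v ->
  (forall t s, 0 <= t -> t <= s -> g' t * (s - t) <= g s - g t) ->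
  rnorm (F 0) <= g 0 ->
  (forall t, 0 <= t <= a -> rnorm (F t) <= g t -> rnorm (v t) + e <= g' t) ->
  forall t, 0 <= t <= a -> rnorm (F t) <= g t.
Proof.
move=> a0 e0 Fv gg' F0 vg t /andP[].
apply: (real_induction (P := fun t => rnorm (F t) <= g t)) => // {t}.
- move=> t t0 ta Fl; apply: rnorm_le_eps => h h0.
  have tab : 0 <= t <= a by rewrite ltW.
  have [d d0 Fd] := near_primitive_continuous e0 Fv tab h0.
  pose s := Num.max 0 (t - d / 2).
  have s0 : 0 <= s by rewrite le_max lexx.
  have ds : t - d / 2 <= s by rewrite le_max lexx orbT.
  have st : s < t by rewrite gt_max t0 /=; move: d0; lra.
  have sa : 0 <= s <= a by rewrite s0 /= (le_trans (ltW st)).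
  have Fs := Fl s s0 st.
  have g's : 0 <= g' s.
    by rewrite (le_trans _ (vg s sa Fs))// addr_ge0// rnorm_ge0.
  have gst : g s <= g t.
    rewrite -subr_ge0 (le_trans _ (gg' s t s0 (ltW st)))//.
    by rewrite mulr_ge0// subr_ge0 ltW.
  have := Fd s sa; rewrite ler0_norm ?subr_le0 ?(ltW st)// => /(_ _)H.
  have := rnorm_shift (F t) (F s); rewrite rnormB.
  have := H ltac:(lra); lra.
- move=> t t0 ta Fl.
  have tab : 0 <= t <= a by rewrite t0 ltW.
  have [d d0 Fd] := Fv t tab; exists d => // s ts sd sa.
  have Ft := Fl t t0 (lexx t).
  have sab : 0 <= s <= a by rewrite sa (le_trans t0)// ltW.
  have st0 : 0 < s - t by rewrite subr_gt0.
  have := Fd s sab; rewrite gtr0_norm// ltrBlDl => /(_ sd).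
  set x := _ - _ *: _ => xe.
  have xE : F s - F t = x + (s - t)%:C *: v t by rewrite /x subrK.
  have := rnorm_shift (F s) (F t); rewrite xE.
  have := rnormD x ((s - t)%:C *: v t); rewrite rnormZr gtr0_norm//.
  have := gg' t s t0 (ltW ts).
  have := ler_wpM2r (ltW st0) (vg t tab Ft).
  by move: Ft xe; lra.
Qed.

(** [barrier] with a linear function of slope [M + e]. *)
Lemma mean_value a b e F v M : 0 <= e -> near_primitive a b e F v ->
  (forall t, a <= t <= b -> rnorm (v t) <= M) ->
  forall s t, a <= s <= b -> a <= t <= b ->
    rnorm (F t - F s) <= (M + e) * `|t - s|.
Proof.
move=> e0 Fv vM.
suff H s t : a <= s -> t <= b -> s <= t -> rnorm (F t - F s) <= (M + e) * `|t - s|.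
  move=> s t /andP[s1 s2] /andP[t1 t2]; have [st|/ltW ts] := leP s t; first exact: H.
  by rewrite rnormB distrC; exact: H.
move=> as_ tb st; rewrite ger0_norm ?subr_ge0//.
have -> : F t - F s = F (s + 1 * (t - s)) - F s by rewrite mul1r subrKC.
have ts0 : 0 <= t - s by rewrite subr_ge0.
have sab x : 0 <= x <= t - s -> a <= s + 1 * x <= b.
  by move=> /andP[x0 x1]; apply/andP; split; lra.
apply: (@barrier (t - s) e (fun x => F (s + 1 * x) - F s)
  (fun x => 1%:C *: v (s + 1 * x)) (fun x => (M + e) * x) (fun=> M + e)) => //.
- have C : near_primitive 0 (t - s) 0 (fun=> F s) (fun=> 0).
    move=> y _; exists 1 => // z _ _.
    by rewrite scaler0 subrr subr0 rnorm0 mul0r.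
  have := near_primitiveB (near_primitive_affine _ sab Fv) C.
  rewrite addr0 normr1 => /(_ erefl); apply: near_primitive_ext => // y _.
  by rewrite subr0.
- by move=> x y _ _; rewrite mulrBr.
- by rewrite !mulr0 addr0 subrr rnorm0.
- by move=> x xs _; rewrite rnormZr normr1 mul1r lerD2r vM// sab.
- by rewrite ts0 lexx.
Qed.

Lemma mean_value_primitive a b F v M : primitive a b F v ->
  (forall t, a <= t <= b -> rnorm (v t) <= M) ->
  forall s t, a <= s <= b -> a <= t <= b ->
    rnorm (F t - F s) <= M * `|t - s|.
Proof.
move=> Fv vM s t sab tab; apply: rnorm_le_eps => h h0.
have K0 : 0 < `|t - s| + 1 by rewrite ltr_wpDl.
have e0 : 0 < h / (`|t - s| + 1) by rewrite divr_gt0.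
have := mean_value (ltW e0) (Fv _ e0) vM sab tab => /le_trans; apply.
rewrite mulrDl lerD2l mulrAC ler_pdivrMr// ler_pM2l//.
by rewrite lerDl.
Qed.

(** By the mean value inequality the differences of two members of the sequence
    are Lipschitz with a small constant. Hence convergence at the one point [c]
    spreads over the interval, and the slopes of the limit are close to those of
    the members. *)
Lemma near_primitive_limit a b c (F : nat -> R -> Pi) v : a <= c <= b ->
  (forall e, 0 < e -> exists N, forall n, (N <= n)%N -> near_primitive a b e (F n) v) ->
  (forall e, 0 < e -> exists N, forall m n, (N <= m)%N -> (N <= n)%N ->
     rnorm (F m c - F n c) <= e) ->
  exists2 G, primitive a b G v &
    forall e, 0 < e -> exists N, forall n, (N <= n)%N -> forall t, a <= t <= b ->
      rnorm (F n t - G t) <= e.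
Proof.
move=> cab Fv Fc.
have lip e : 0 < e -> exists N, forall m n, (N <= m)%N -> (N <= n)%N ->
    forall s t, a <= s <= b -> a <= t <= b ->
    rnorm ((F m t - F n t) - (F m s - F n s)) <= e * `|t - s|.
  move=> e0; have [|N FN] := Fv (e / 2); first by rewrite divr_gt0.
  exists N => m n Nm Nn s t sab tab.
  have := near_primitiveB (FN m Nm) (FN n Nn); rewrite -splitr => Fmn.
  have := mean_value (M := 0) (ltW e0) Fmn _ sab tab.
  rewrite add0r; apply => x xab.
  by rewrite subrr rnorm0.
have ab : 0 < `|b - a| + 1 by rewrite ltr_wpDl.
have cauchy e : 0 < e -> exists N, forall m n, (N <= m)%N -> (N <= n)%N ->
    forall t, a <= t <= b -> rnorm (F m t - F n t) <= e.
  move=> e0; have e20 : 0 < e / 2 by rewrite divr_gt0.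
  have [N1 FN1] := lip (e / 2 / (`|b - a| + 1)) (divr_gt0 e20 ab).
  have [N2 FN2] := Fc (e / 2) e20.
  exists (maxn N1 N2) => m n; rewrite !geq_max => /andP[m1 m2] /andP[n1 n2] t tab.
  have := FN1 m n m1 n1 c t cab tab; have := FN2 m n m2 n2.
  have := rnorm_shift (F m t - F n t) (F m c - F n c).
  have tc : `|t - c| <= `|b - a| + 1.
    move: cab tab => /andP[c1 c2] /andP[t1 t2].
    have ba : 0 <= b - a by lra.
    by rewrite (ger0_norm ba) ler_norml; apply/andP; split; lra.
  have : e / 2 / (`|b - a| + 1) * `|t - c| <= e / 2.
    by rewrite mulrAC ler_pdivrMr// ler_pM2l.
  by lra.
have lim t : exists l, a <= t <= b -> forall e, 0 < e -> exists N, forall n, (N <= n)%N ->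
    rnorm (F n t - l) <= e.
  have [tab|tab] := boolP (a <= t <= b); last by exists 0.
  have [|l lP] := @rnorm_complete _ _ (fun n => F n t).
    by move=> e /cauchy[N FN]; exists N => m n Nm Nn; exact: FN.
  by exists l.
have [G GP] := choice lim.
exists G; last first.
  move=> e e0; have [N FN] := cauchy e e0; exists N => n Nn t tab.
  apply: rnorm_le_eps => h h0; have [N' GN] := GP t tab h h0.
  have := GN (maxn N N') (leq_maxr _ _).
  have := FN n (maxn N N') Nn (leq_maxl _ _) t tab.
  have := rnorm_tri (F (maxn N N') t) (F n t) (G t); lra.
move=> e e0 t tab.
have e30 : 0 < e / 3 by rewrite divr_gt0.
have [N1 FN1] := lip _ e30; have [N2 FN2] := Fv _ e30.
pose n := maxn N1 N2.
have [d d0 Fd] := FN2 n (leq_maxr _ _) t tab.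
exists d => // s sab sd; have := Fd s sab sd; set x := _ - _ *: _ => xe.
have -> : G s - G t - (s - t)%:C *: v t =
    x - (F n s - G s - (F n t - G t)).
  by rewrite /x; lin_coefs R[i] Pi; ring.
have : rnorm (F n s - G s - (F n t - G t)) <= e / 3 * `|s - t|.
  apply: rnorm_le_eps => h h0.
  have h20 : 0 < h / 2 by rewrite divr_gt0.
  have [N3 G3] := GP s sab _ h20; have [N4 G4] := GP t tab _ h20.
  pose m := maxn N1 (maxn N3 N4).
  have m3 : (N3 <= m)%N by rewrite !leq_max leqnn orbT.
  have m4 : (N4 <= m)%N by rewrite !leq_max leqnn !orbT.
  have := FN1 n m (leq_maxl _ _) (leq_maxl _ _) t s tab sab.
  have -> : F n s - G s - (F n t - G t) = (F n s - F m s - (F n t - F m t)) +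
      ((F m s - G s) - (F m t - G t)).
    by lin_coefs R[i] Pi; ring.
  have := G3 m m3; have := G4 m m4.
  have := rnormD (F n s - F m s - (F n t - F m t)) ((F m s - G s) - (F m t - G t)).
  have := rnormBD (F m s - G s) (F m t - G t).
  lra.
have := rnormBD x (F n s - G s - (F n t - G t)).
by have := mulr_ge0 (ltW e0) (normr_ge0 (s - t)); lra.
Qed.

End curves.

(** * Ordinary differential equations *)

Section ode.
Context {R : realType} {Pi : completeNormedModType R[i]}.
Implicit Types (a b t s d e : R) (F G v w y : R -> Pi).

Lemma half_expr_gt0 n : 0 < 2 ^- n :> R.
Proof. by rewrite invr_gt0 exprn_gt0. Qed.

Lemma half_exprS n : 2 ^- n.+1 = 2 ^- n / 2 :> R.
Proof. by rewrite exprS invfM mulrC. Qed.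

Lemma half_expr_small (C e : R) : 0 <= C -> 0 < e ->
  exists N, forall n, (N <= n)%N -> C * 2 ^- n <= e.
Proof.
move=> C0 e0; exists (Num.bound (C / e)) => n /upper_nthrootP.
by rewrite ltr_pdivrMr// mulrC -ltr_pdivrMr ?exprn_gt0// => /ltW.
Qed.

Lemma half_expr_cauchy (u : nat -> Pi) (C : R) : 0 <= C ->
  (forall n, rnorm (u n.+1 - u n) <= C * 2 ^- n) ->
  forall m n, (n <= m)%N -> rnorm (u m - u n) <= 2 * C * 2 ^- n.
Proof.
move=> C0 uC m n /subnK <-; move: (m - n)%N => k.
suff: rnorm (u (k + n)%N - u n) <= 2 * C * 2 ^- n - 2 * C * 2 ^- (k + n).
  move=> /le_trans; apply; rewrite gerBl.
  by rewrite !mulr_ge0// ltW// half_expr_gt0.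
elim: k => [|k IH]; first by rewrite add0n !subrr rnorm0.
rewrite addSn; have := rnorm_tri (u (k + n)%N) (u (k + n).+1) (u n).
have := uC (k + n)%N; rewrite half_exprS; lra.
Qed.

Lemma near_primitive_glue a b e F v (s : R) (c : Pi) : a <= s <= b -> 0 <= e ->
  near_primitive a s e F v -> (forall t, s <= t <= b -> rnorm (c - v t) <= e) ->
  near_primitive a b e (fun t => if t <= s then F t else F s + (t - s)%:C *: c) v.
Proof.
move=> /andP[as_ sb] e0 Fv cv t /andP[at_ tb].
have right x : s <= t -> t < x -> rnorm ((x - t)%:C *: (c - v t)) <= e * `|x - t|.
  by move=> st tx; rewrite rnormZr mulrC ler_wpM2r// cv// st.
case: (ltgtP t s) => [ts|st|ts].
- have [|d d0 Fd] := Fv t; first by rewrite at_ ltW.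
  exists (Num.min d (s - t)); first by rewrite lt_min d0 subr_gt0.
  move=> x /andP[ax xb]; rewrite lt_min => /andP[xd xs].
  have xs' : x <= s by have := ler_norm (x - t); lra.
  by rewrite xs'; apply: Fd => //; rewrite ax.
- exists (t - s); first by rewrite subr_gt0.
  move=> x /andP[ax xb]; rewrite ltr_norml => /andP[x1 x2].
  have -> : x <= s = false by apply/negbTE; rewrite -ltNge; lra.
  have -> : F s + (x - s)%:C *: c - (F s + (t - s)%:C *: c) - (x - t)%:C *: v t =
      (x - t)%:C *: (c - v t) by lin_coefs R[i] Pi; ring.
  by rewrite rnormZr mulrC ler_wpM2r// cv// ltW.
- have [|d d0 Fd] := Fv t; first by rewrite at_ ts lexx.
  exists d => // x /andP[ax xb] xd.
  have [xs|sx] := leP x s; first by apply: Fd => //; rewrite ax.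
  have -> : F s + (x - s)%:C *: c - F t - (x - t)%:C *: v t =
      (x - t)%:C *: (c - v t) by rewrite ts; lin_coefs R[i] Pi; ring.
  by apply: right; rewrite ts.
Qed.

(** By continuity along the interval there are polygons with slopes close
    to [v]; [near_primitive_limit] applies to them. *)
Lemma primitive_exists a b v : a <= b -> continuous_curve a b v ->
  exists F, primitive a b F v.
Proof.
move=> ab vc.
have poly e : 0 < e -> exists F, F a = 0 /\ near_primitive a b e F v.
  move=> e0; pose P t := exists F, F a = 0 /\ near_primitive a t e F v.
  have glue s t c : a <= s -> s <= t -> P s ->
      (forall x, s <= x <= t -> rnorm (c - v x) <= e) -> P t.
    move=> as_ st [F [Fa Fv]] cv.
    eexists; split; last first.
      by apply: (near_primitive_glue _ _ Fv cv); rewrite ?as_// ltW.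
    by rewrite /= as_.
  suff /(_ b ab (lexx b)) : forall t, a <= t -> t <= b -> P t by [].
  apply: real_induction => //.
  - exists (fun=> 0); split=> // t /le_anti <-; exists 1 => // s /le_anti <- _.
    by rewrite !subrr scale0r subrr rnorm0 normr0 mulr0.
  - move=> t at_ tb Pt; have [|d d0 vd] := vc t _ e e0; first by rewrite ltW.
    pose s := Num.max a (t - d / 2).
    have as_ : a <= s by rewrite le_max lexx.
    have ds : t - d / 2 <= s by rewrite le_max lexx orbT.
    have st : s < t by rewrite gt_max at_ /=; move: d0; lra.
    apply: (glue s t (v t)) => //; [exact: ltW|exact: Pt|].
    move=> x /andP[sx xt]; rewrite rnormB; apply: vd; first by apply/andP; lra.
    by rewrite ler0_norm; lra.
  - move=> t at_ tb Pt; have [|d d0 vd] := vc t _ e e0; first by rewrite at_ ltW.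
    exists d => // s ts sd sb; apply: (glue t s (v t)) => //; [exact: ltW|exact: Pt|].
    move=> x /andP[tx xs]; rewrite rnormB; apply: vd; first by apply/andP; lra.
    by rewrite ger0_norm; lra.
have /choice[F FP] n := poly _ (half_expr_gt0 n).
have aab : a <= a <= b by rewrite lexx.
have [|e e0|G GP _] := @near_primitive_limit _ _ a b a F v aab; last by exists G.
- move=> e e0; have [N HN] := half_expr_small ler01 e0; exists N => n Nn t tab.
  have [_ /(_ t tab)[d d0 Fd]] := FP n; exists d => // s sab sd.
  rewrite (le_trans (Fd s sab sd))// ler_wpM2r//.
  by have := HN n Nn; rewrite mul1r.
- exists 0%N => m n _ _.
  by have [-> _] := FP m; have [-> _] := FP n; rewrite subrr rnorm0 ltW.
Qed.

Lemma continuous_curve_bounded a b v : a <= b -> continuous_curve a b v ->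
  exists2 K, 0 < K & forall t, a <= t <= b -> rnorm (v t) <= K.
Proof.
move=> ab vc.
have [|t at_ tb|r r0 vr] :=
    @uniform_on_segment _ a b (fun r t => rnorm (v t) <= r^-1) ab.
- move=> r r' t H r'0 rr'; rewrite (le_trans H)// lef_pV2// posrE//.
  exact: lt_le_trans rr'.
- have [|d d0 vd] := vc t _ 1 ltr01; first by rewrite at_.
  have K0 : 0 < rnorm (v t) + 1 by rewrite ltr_wpDl// rnorm_ge0.
  exists (rnorm (v t) + 1)^-1, d; split=> //; first by rewrite invr_gt0.
  move=> s as_ sb sd; rewrite invrK (le_trans (rnorm_shift _ (v t)))//.
  by rewrite lerD2l vd// as_.
- by exists r^-1; [rewrite invr_gt0|move=> t /andP[at_ tb]; exact: vr].
Qed.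

(** The two halves of the interval are traversed starting from its midpoint, the
    left one with reversed orientation. *)
Lemma barrier_around (t0 a e : R) F v (g g' : R -> R) : 0 <= e ->
  near_primitive (t0 - a) (t0 + a) e F v ->
  (forall t s, 0 <= t -> t <= s -> g' t * (s - t) <= g s - g t) ->
  rnorm (F t0) <= g 0 ->
  (forall t, t0 - a <= t <= t0 + a -> rnorm (F t) <= g `|t - t0| ->
     rnorm (v t) + e <= g' `|t - t0|) ->
  forall t, t0 - a <= t <= t0 + a -> rnorm (F t) <= g `|t - t0|.
Proof.
move=> e0 Fv gg' F0 vg t tab.
have a0 : 0 <= a by move/andP: tab; lra.
suff H k : `|k| = 1 -> forall s, 0 <= s <= a -> rnorm (F (t0 + k * s)) <= g s.
  have [t0t|tt0] := leP t0 t.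
    have := H 1 (normr1 _) `|t - t0|; rewrite ger0_norm ?subr_ge0//.
    by rewrite mul1r subrKC; apply; move/andP: tab => tab; apply/andP; lra.
  have := H (-1) (normrN1 _) `|t - t0|; rewrite ltr0_norm ?subr_lt0//.
  by rewrite mulrNN mul1r subrKC; apply; move/andP: tab => tab; apply/andP; lra.
move=> k1; have sab s : 0 <= s <= a -> t0 - a <= t0 + k * s <= t0 + a.
  move=> /andP[s0 sa].
  have : `|k * s| <= a by rewrite normrM k1 mul1r ger0_norm.
  by rewrite ler_norml => /andP[? ?]; apply/andP; lra.
have dist s : 0 <= s <= a -> `|t0 + k * s - t0| = s.
  by move=> /andP[s0 sa]; rewrite addrC addKr normrM k1 mul1r ger0_norm.
apply: (barrier a0 e0 (near_primitive_affine k1 sab Fv) gg').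
  by rewrite /= mulr0 addr0.
move=> s ss Fs; rewrite rnormZr k1 mul1r.
have := vg _ (sab s ss); rewrite dist//; exact.
Qed.

Lemma expR_ge1 (x : R) : 0 <= x -> 1 <= expR x.
Proof. by move=> x0; rewrite -[leLHS]expR0 ler_expR. Qed.

Lemma expR_slope (K k t s : R) : 0 <= K ->
  K * k * expR (k * t) * (s - t) <= K * expR (k * s) - K * expR (k * t).
Proof.
move=> K0; rewrite -mulrBr -!mulrA ler_wpM2l//.
have -> : k * s = k * t + k * (s - t) by ring.
rewrite expRD; have := expR_ge1Dx (k * (s - t)).
move=> /(ler_wpM2l (expR_ge0 (k * t))); lra.
Qed.

(** [barrier_around] with the exponential [q * expR ((L + 2) * s)]. Since the
    latter is at most [r], the velocity has to be controlled only in the ball of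
    radius [r]: this allows right hand sides that are known only near a given
    curve. *)
Lemma gronwall (t0 a L q r : R) F v : 0 <= L -> 0 < q ->
  primitive (t0 - a) (t0 + a) F v -> rnorm (F t0) <= q ->
  q * expR ((L + 2) * a) <= r ->
  (forall t, t0 - a <= t <= t0 + a -> rnorm (F t) <= r ->
     rnorm (v t) <= L * rnorm (F t) + q) ->
  forall t, t0 - a <= t <= t0 + a -> rnorm (F t) <= q * expR ((L + 2) * a).
Proof.
move=> L0 q0 Fv F0 qr vF.
(* In [L + 2] one unit accounts for the inhomogeneity [q], the other one for the
   error [q] with which [F] is treated as a near primitive. *)
have L2 : 0 <= L + 2 by rewrite addr_ge0.
have ga t : t0 - a <= t <= t0 + a ->
    q * expR ((L + 2) * `|t - t0|) <= q * expR ((L + 2) * a).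
  move=> /andP[t1 t2]; rewrite ler_pM2l// ler_expR ler_wpM2l//.
  by rewrite ler_norml; apply/andP; lra.
move=> t tab; apply: le_trans (ga t tab).
apply: (@barrier_around t0 a q F v (fun s => q * expR ((L + 2) * s))
  (fun s => q * (L + 2) * expR ((L + 2) * s))) tab => //.
- exact: ltW.
- exact: Fv.
- by move=> x y _ _; apply: expR_slope; exact: ltW.
- by rewrite mulr0 expR0 mulr1.
move=> x xab Fx; have := vF x xab (le_trans Fx (le_trans (ga x xab) qr)).
have := ler_wpM2l L0 Fx.
have /(ler_wpM2l (ltW q0)) : 1 <= expR ((L + 2) * `|x - t0|).
  by apply: expR_ge1; exact: mulr_ge0.
lra.
Qed.

(** The successive approximations converge geometrically with respect to an
    exponential weight, hence uniformly on the whole interval at once, and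
    [near_primitive_limit] identifies the velocity of the limit. *)
Lemma ode_exists (t0 a L : R) (f : R -> Pi -> Pi) (xi : Pi) : 0 <= a -> 0 <= L ->
  (forall t (x z : Pi), t0 - a <= t <= t0 + a ->
     rnorm (f t x - f t z) <= L * rnorm (x - z)) ->
  (forall y, continuous_curve (t0 - a) (t0 + a) y ->
     continuous_curve (t0 - a) (t0 + a) (fun t => f t (y t))) ->
  exists2 y, primitive (t0 - a) (t0 + a) y (fun t => f t (y t)) & y t0 = xi.
Proof.
set J := (t0 - a : R) => a0 L0 fL fc.
have J0 : J <= t0 <= t0 + a by rewrite /J; apply/andP; lra.
have JJ : J <= t0 + a by case/andP: J0 => /le_trans; apply.
have step (y : R -> Pi) : exists z, continuous_curve J (t0 + a) y ->
    primitive J (t0 + a) z (fun t => f t (y t)) /\ z t0 = xi.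
  have [yc|] := pselect (continuous_curve J (t0 + a) y); last by exists y.
  have [F Fv] := primitive_exists JJ (fc y yc).
  exists (fun t => F t - (F t0 - xi)) => _; split; first exact: primitiveBc.
  by rewrite opprB addrC subrK.
have [S SP] := choice step; pose y n := iter n S (fun=> xi).
have yc n : continuous_curve J (t0 + a) (y n).
  elim: n => [|n IH]; first exact: primitive_continuous (primitive_const xi).
  by have [/primitive_continuous] := SP _ IH.
have yv n : primitive J (t0 + a) (y n.+1) (fun t => f t (y n t)).
  by have [] := SP _ (yc n).
have y0 n : y n t0 = xi by case: n => [//|n]; have [] := SP _ (yc n).
pose D n t := y n.+1 t - y n t.
have Dc : continuous_curve J (t0 + a) (D 0%N).
  exact: primitive_continuous (primitiveBc xi (yv 0%N)).
have [K K0 DK] := continuous_curve_bounded JJ Dc.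
(* With the weight [expR (k * `|t - t0|)] each step halves the distance, since
   the slope of the weight is [k] times the weight; the summand [1] absorbs the
   error of near primitives. *)
pose k := 2 * (L + 1).
have k0 : 0 <= k by rewrite mulr_ge0// addr_ge0.
have DB n t : J <= t <= t0 + a -> rnorm (D n t) <= K * 2 ^- n * expR (k * `|t - t0|).
  elim: n t => [|n IH] t tab.
    rewrite expr0 invr1 mulr1 (le_trans (DK t tab))//.
    by rewrite -[leLHS]mulr1 ler_pM2l//; apply: expR_ge1; exact: mulr_ge0.
  have e0 : 0 < K * 2 ^- n by rewrite mulr_gt0// half_expr_gt0.
  have Ke0 : 0 <= K * 2 ^- n.+1 by rewrite mulr_ge0// ltW// half_expr_gt0.
  apply: (@barrier_around t0 a (K * 2 ^- n) (D n.+1)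
    (fun t => f t (y n.+1 t) - f t (y n t))
    (fun s => K * 2 ^- n.+1 * expR (k * s))
    (fun s => K * 2 ^- n.+1 * k * expR (k * s))) tab => //.
  - exact: ltW.
  - by apply: primitiveB.
  - by move=> s s' _ _; exact: expR_slope.
  - by rewrite /D !y0 subrr rnorm0 mulr_ge0// expR_ge0.
  move=> s sab _; rewrite half_exprS /k.
  have := fL s (y n.+1 s) (y n s) sab.
  have := ler_wpM2l L0 (IH s sab); rewrite -/(D n s).
  have /(ler_wpM2l (ltW e0)) : 1 <= expR (k * `|s - t0|).
    by apply: expR_ge1; exact: mulr_ge0.
  rewrite /k; lra.
pose C := K * expR (k * a).
have C0 : 0 <= C by rewrite mulr_ge0 ?expR_ge0// ltW.
have DC n t : J <= t <= t0 + a -> rnorm (D n t) <= C * 2 ^- n.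
  move=> tab; rewrite (le_trans (DB n t tab))// /C mulrAC.
  rewrite ler_wpM2r ?(ltW (half_expr_gt0 n))// ler_pM2l// ler_expR ler_wpM2l//.
  by move/andP: tab; rewrite /J ler_norml => tab; apply/andP; lra.
have yC t : J <= t <= t0 + a -> forall m n, (n <= m)%N ->
    rnorm (y m t - y n t) <= 2 * C * 2 ^- n.
  by move=> tab; apply: half_expr_cauchy => // n; exact: DC.
have C20 : 0 <= 2 * C by rewrite mulr_ge0.
have lim t : exists l, J <= t <= t0 + a -> forall n, rnorm (y n t - l) <= 2 * C * 2 ^- n.
  have [tab|tab] := boolP (J <= t <= t0 + a); last by exists 0.
  have [|l lP] := @rnorm_complete _ _ (fun n => y n t).
    move=> e e0; have [N HN] := half_expr_small C20 e0; exists N => m n Nm Nn.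
    have [mn|/ltnW nm] := leqP m n; last by rewrite (le_trans (yC t tab m n nm))// HN.
    by rewrite rnormB (le_trans (yC t tab n m mn))// HN.
  exists l => _ n; apply: rnorm_le_eps => e e0; have [N HN] := lP e e0.
  have := HN (maxn n N) (leq_maxr _ _).
  have := yC t tab (maxn n N) n (leq_maxl _ _); rewrite rnormB.
  have := rnorm_tri (y (maxn n N) t) (y n t) l; lra.
have [Y YP] := choice lim.
have [|e e0|G GP yG] := @near_primitive_limit _ _ J (t0 + a) t0 (fun n => y n.+1)
    (fun t => f t (Y t)) J0.
- move=> e e0; have e20 : 0 < e / 2 by rewrite divr_gt0.
  have [N HN] := half_expr_small (mulr_ge0 L0 C20) e20; exists N => n Nn.
  rewrite [e]splitr; apply: (near_primitive_close (yv n _ e20)) => t tab.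
  rewrite (le_trans (fL _ _ _ tab))// (le_trans (ler_wpM2l L0 (YP t tab n)))//.
  by rewrite mulrA HN.
- by exists 0%N => m n _ _; rewrite !y0 subrr rnorm0 ltW.
have GY t : J <= t <= t0 + a -> G t = Y t.
  move=> tab; apply/eqP; rewrite -subr_eq0; apply/eqP/rnorm_le0.
  apply: rnorm_le_eps => e e0; rewrite add0r.
  have e20 : 0 < e / 2 by rewrite divr_gt0.
  have [N1 H1] := yG _ e20; have [N2 H2] := half_expr_small C20 e20.
  have := H1 (maxn N1 N2) (leq_maxl _ _) t tab.
  have := YP t tab (maxn N1 N2).+1.
  have := H2 (maxn N1 N2).+1 (leqW (leq_maxr _ _)).
  rewrite [rnorm (_ - G t)]rnormB.
  have := rnorm_tri (y (maxn N1 N2).+1 t) (G t) (Y t); lra.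
exists G.
  by apply: primitive_ext GP => // t tab; rewrite GY.
apply/eqP; rewrite -subr_eq0; apply/eqP/rnorm_le0.
apply: rnorm_le_eps => e e0; rewrite add0r; have [N H] := yG e e0.
by have := H N (leqnn N) t0 J0; rewrite y0 rnormB.
Qed.

End ode.

(** * Cauchy estimates *)

Section goursat.
Context {R : realType} {Pi : completeNormedModType R[i]}.
Implicit Types (a b t s d e x y : R).

Lemma nested_halving (W : R) (u : nat -> R) : 0 <= W ->
  (forall n, u n <= u n.+1 <= u n + W * 2 ^- n.+1) ->
  exists x, forall n, u n <= x <= u n + W * 2 ^- n.
Proof.
move=> W0 uW.
have incr m n : (m <= n)%N -> u m <= u n.
  move=> /subnK <-; elim: (n - m)%N => [//|k IH].
  by rewrite addSn (le_trans IH)//; case/andP: (uW (k + m)%N).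
have decr m n : (m <= n)%N -> u n + W * 2 ^- n <= u m + W * 2 ^- m.
  move=> /subnK <-; elim: (n - m)%N => [//|k IH].
  rewrite addSn (le_trans _ IH)//; case/andP: (uW (k + m)%N) => _.
  by rewrite half_exprS; lra.
have W2 n : 0 <= W * 2 ^- n by rewrite mulr_ge0// ltW// half_expr_gt0.
have ub n : ubound (range u) (u n + W * 2 ^- n).
  move=> _ [m _ <-]; have [mn|/ltnW nm] := leqP m n.
    by rewrite (le_trans (incr _ _ mn))// lerDl.
  by rewrite (le_trans _ (decr _ _ nm))// lerDl.
exists (sup (range u)) => n; apply/andP; split.
  by apply: ub_le_sup; [exists (u 0%N + W * 2 ^- 0); exact: ub|exists n].
by apply: ge_sup; [exists (u 0%N), 0%N|exact: ub].
Qed.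

(** The successively chosen quarters shrink to a point, as their lower left
    corners increase and their upper right corners decrease. *)
Lemma quadrisection (W H x0 y0 : R) (bad : nat -> R -> R -> Prop) :
  0 <= W -> 0 <= H -> bad 0%N x0 y0 ->
  (forall n x y, bad n x y -> exists i j : bool,
     bad n.+1 (x + i%:R * (W * 2 ^- n.+1)) (y + j%:R * (H * 2 ^- n.+1))) ->
  exists x y, forall n, exists xn yn, [/\ bad n xn yn,
    xn <= x <= xn + W * 2 ^- n & yn <= y <= yn + H * 2 ^- n].
Proof.
move=> W0 H0 b0 bS.
have step (p : nat * (R * R)) : exists q : bool * bool, bad p.1 p.2.1 p.2.2 ->
    bad p.1.+1 (p.2.1 + q.1%:R * (W * 2 ^- p.1.+1))
               (p.2.2 + q.2%:R * (H * 2 ^- p.1.+1)).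
  have [/bS[i [j ij]]|nb] := pselect (bad p.1 p.2.1 p.2.2); first by exists (i, j).
  by exists (true, true).
have [f fP] := choice step.
pose next (p : nat * (R * R)) := (p.1.+1,
  (p.2.1 + (f p).1%:R * (W * 2 ^- p.1.+1),
   p.2.2 + (f p).2%:R * (H * 2 ^- p.1.+1))).
pose st n := iter n next (0%N, (x0, y0)).
have stS n : st n.+1 = next (st n) by [].
have st1 n : (st n).1 = n by elim: n => [//|n IH]; rewrite stS /= IH.
have stb n : bad n (st n).2.1 (st n).2.2.
  elim: n => [//|n IH]; rewrite stS /= st1; have := fP (st n).
  by rewrite st1; apply.
have half (c : bool) (K : R) n : 0 <= K -> forall z,
    z <= z + c%:R * (K * 2 ^- n) <= z + K * 2 ^- n.
  move=> K0 z; have K2 : 0 <= K * 2 ^- n by rewrite mulr_ge0// ltW// half_expr_gt0.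
  have zz : z <= z + K * 2 ^- n by rewrite lerDl.
  by case: c; rewrite ?mul1r ?mul0r ?addr0 lexx ?zz.
have [|x xP] := @nested_halving W (fun n => (st n).2.1) W0.
  by move=> n; rewrite stS /= st1; exact: half.
have [|y yP] := @nested_halving H (fun n => (st n).2.2) H0.
  by move=> n; rewrite stS /= st1; exact: half.
by exists x, y => n; exists (st n).2.1, (st n).2.2.
Qed.

(** Along the line $s\mapsto z+sk$, the function $\zeta u+\zeta^2 l/2$ is a
    primitive of the affine function $u+\zeta l$. *)
Lemma quadratic_primitive a b (z k : R[i]) (u l : Pi) :
  primitive a b (fun s => (z + s%:C * k) *: u + ((z + s%:C * k) ^+ 2 / 2) *: l)
    (fun s => k *: (u + (z + s%:C * k) *: l)).
Proof.
move=> e e0 t tab; pose K := cabs (k ^+ 2 / 2) * rnorm l + 1.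
have K0 : 0 < K by rewrite ltr_wpDl// mulr_ge0 ?cabs_ge0 ?rnorm_ge0.
exists (e / K); first by rewrite divr_gt0.
move=> s sab sd; set x := (X in rnorm X).
have -> : x = ((s - t)%:C * (s - t)%:C) *: ((k ^+ 2 / 2) *: l).
  by rewrite /x; lin_coefs R[i] Pi; field.
rewrite !rnormZ cabsM !cabs_real mulrC mulrA ler_wpM2r//.
apply: (@le_trans _ _ (K * `|s - t|)); first by rewrite ler_wpM2r// lerDl.
by rewrite mulrC -ler_pdivlMr// ltW.
Qed.

Definition differentiable_on_rect (a b c d : R) (phi : R -> R -> Pi) :=
  forall x y, a <= x <= b -> c <= y <= d -> exists l, forall e, 0 < e ->
  exists2 h, 0 < h & forall x' y', a <= x' <= b -> c <= y' <= d ->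
    `|x' - x| + `|y' - y| < h ->
    rnorm (phi x' y' - phi x y - ((x' - x) +i* (y' - y)) *: l)
      <= e * (`|x' - x| + `|y' - y|).

(** The integral along the boundary of a rectangle, expressed by primitives
    [X y] along the horizontal and [Y x] along the vertical lines. *)
Definition boundary_increment (X Y : R -> R -> Pi) x1 x2 y1 y2 : Pi :=
  (X y1 x2 - X y1 x1) + 'i *: (Y x2 y2 - Y x2 y1)
    - (X y2 x2 - X y2 x1) - 'i *: (Y x1 y2 - Y x1 y1).

Lemma boundary_increment_quarter (X Y : R -> R -> Pi) (x y w h M : R) :
  4 * M <= rnorm (boundary_increment X Y x (x + w + w) y (y + h + h)) ->
  exists i j : bool, M <= rnorm (boundary_increment X Y
    (x + i%:R * w) (x + i%:R * w + w) (y + j%:R * h) (y + j%:R * h + h)).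
Proof.
pose circ := boundary_increment X Y; rewrite -/circ => big.
have split : circ x (x + w + w) y (y + h + h) =
    (circ x (x + w) y (y + h) + circ (x + w) (x + w + w) y (y + h)) +
    (circ x (x + w) (y + h) (y + h + h) +
     circ (x + w) (x + w + w) (y + h) (y + h + h)).
  by rewrite /circ /boundary_increment; lin_coefs R[i] Pi; ring.
apply: contrapT => none.
have small (i j : bool) : rnorm (circ (x + i%:R * w) (x + i%:R * w + w)
    (y + j%:R * h) (y + j%:R * h + h)) < M.
  by rewrite ltNge; apply/negP => MM; apply: none; exists i, j.
move: (small false false) (small true false) (small false true) (small true true) big.
rewrite split !mul1r !mul0r !addr0 {small none split}.
move: (circ x (x + w) y (y + h)) (circ (x + w) (x + w + w) y (y + h))
  (circ x (x + w) (y + h) (y + h + h))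
  (circ (x + w) (x + w + w) (y + h) (y + h + h)) => c1 c2 c3 c4.
have := rnormD (c1 + c2) (c3 + c4); have := rnormD c1 c2; have := rnormD c3 c4.
lra.
Qed.

(** The boundary increment vanishes for an affine function in place of [phi], so
    only the defect of the approximation of [phi] counts. *)
Lemma boundary_increment_affine (phi X Y : R -> R -> Pi) (x y e : R) (u l : Pi) p1 p2 q1 q2 :
  p1 <= p2 -> q1 <= q2 -> 0 <= e ->
  (forall t, q1 <= t <= q2 -> primitive p1 p2 (X t) (phi ^~ t)) ->
  (forall s, p1 <= s <= p2 -> primitive q1 q2 (Y s) (phi s)) ->
  (forall s t, p1 <= s <= p2 -> q1 <= t <= q2 ->
    rnorm (phi s t - (u + ((s - x) +i* (t - y)) *: l)) <= e) ->
  rnorm (boundary_increment X Y p1 p2 q1 q2) <= 2 * e * ((p2 - p1) + (q2 - q1)).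
Proof.
move=> p12 q12 e0 Xphi Yphi defect.
have pp : p1 <= p1 <= p2 by rewrite lexx.
have pp' : p1 <= p2 <= p2 by rewrite lexx p12.
have qq : q1 <= q1 <= q2 by rewrite lexx.
have qq' : q1 <= q2 <= q2 by rewrite lexx q12.
(* [Psi] is a primitive of the affine function in both directions; its
   increments along the four sides cancel. *)
pose Psi s t := ((s - x) +i* (t - y)) *: u
  + (((s - x) +i* (t - y)) ^+ 2 / 2) *: l.
have zE s t : (s - x) +i* (t - y) = ((s - x)%:C + (t - y)%:C * 'i : R[i]).
  by rewrite [LHS]complexE /= mulrC.
have hor t : q1 <= t <= q2 -> rnorm ((X t p2 - X t p1) - (Psi p2 t - Psi p1 t))
    <= e * (p2 - p1).
  move=> tq; have := primitiveB (Xphi t tq) (@quadratic_primitive p1 p2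
    (- x%:C + (t - y)%:C * 'i) 1 u l).
  move=> /(@mean_value_primitive _ _ _ _ _ _ e) MV.
  have := MV _ p1 p2 pp pp'; rewrite (ger0_norm (_ : 0 <= p2 - p1)) ?subr_ge0//.
  have PsiE s : (- x%:C + (t - y)%:C * 'i + s%:C * 1) = (s - x) +i* (t - y).
    by rewrite zE; ring.
  rewrite !PsiE -/(Psi p2 t) -/(Psi p1 t) => /(_ _).
  have -> : X t p2 - Psi p2 t - (X t p1 - Psi p1 t) =
    (X t p2 - X t p1) - (Psi p2 t - Psi p1 t) by lin_coefs R[i] Pi; ring.
  apply=> s sp; rewrite PsiE scale1r; exact: defect.
have ver s : p1 <= s <= p2 -> rnorm ('i *: (Y s q2 - Y s q1) - (Psi s q2 - Psi s q1))
    <= e * (q2 - q1).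
  move=> sp; have := primitiveB (primitiveZ 'i (Yphi s sp)) (@quadratic_primitive q1 q2
    ((s - x)%:C - y%:C * 'i) 'i u l).
  move=> /(@mean_value_primitive _ _ _ _ _ _ e) MV.
  have := MV _ q1 q2 qq qq'; rewrite (ger0_norm (_ : 0 <= q2 - q1)) ?subr_ge0//.
  have PsiE t : ((s - x)%:C - y%:C * 'i + t%:C * 'i) = (s - x) +i* (t - y).
    by rewrite zE; ring.
  rewrite !PsiE -/(Psi s q2) -/(Psi s q1) => /(_ _).
  have -> : 'i *: Y s q2 - Psi s q2 - ('i *: Y s q1 - Psi s q1) =
    'i *: (Y s q2 - Y s q1) - (Psi s q2 - Psi s q1) by lin_coefs R[i] Pi; ring.
  apply=> t tq; rewrite PsiE -scalerBr rnormZ.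
  have -> : cabs ('i : R[i]) = 1 by rewrite /cabs normc_def /= expr0n expr1n add0r sqrtr1.
  by rewrite mul1r; exact: defect.
move: (hor _ qq) (ver _ pp') (hor _ qq') (ver _ pp).
have -> : boundary_increment X Y p1 p2 q1 q2 =
    (((X q1 p2 - X q1 p1) - (Psi p2 q1 - Psi p1 q1)) +
    ('i *: (Y p2 q2 - Y p2 q1) - (Psi p2 q2 - Psi p2 q1))) -
    (((X q2 p2 - X q2 p1) - (Psi p2 q2 - Psi p1 q2)) +
    ('i *: (Y p1 q2 - Y p1 q1) - (Psi p1 q2 - Psi p1 q1))).
  by rewrite /boundary_increment; lin_coefs R[i] Pi; ring.
move: (_ - (Psi p2 q1 - _)) (_ - (Psi p2 q2 - Psi p2 q1)) (_ - (Psi p2 q2 - Psi p1 q2))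
  (_ - (Psi p1 q2 - _)) => c1 c2 c3 c4 {hor ver defect Xphi Yphi zE Psi}.
have := rnormBD (c1 + c2) (c3 + c4); have := rnormD c1 c2; have := rnormD c3 c4.
lra.
Qed.

(** Goursat's lemma for rectangles. If the boundary increment did not vanish,
    quadrisection would produce small rectangles on which it is not small
    compared with the area, in contradiction to differentiability at the point
    to which they shrink. *)
Lemma goursat (a b c d : R) (phi X Y : R -> R -> Pi) : a <= b -> c <= d ->
  differentiable_on_rect a b c d phi ->
  (forall y, c <= y <= d -> primitive a b (X y) (phi ^~ y)) ->
  (forall x, a <= x <= b -> primitive c d (Y x) (phi x)) ->
  boundary_increment X Y a b c d = 0.
Proof.
move=> ab cd dphi Xphi Yphi.
pose circ := boundary_increment X Y.
rewrite -/(circ a b c d); set N := rnorm (circ a b c d).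
pose W := b - a; pose H := d - c.
have W0 : 0 <= W by rewrite subr_ge0.
have H0 : 0 <= H by rewrite subr_ge0.
pose bad n x y := [/\ a <= x, x + W * 2 ^- n <= b, c <= y, y + H * 2 ^- n <= d &
  N * 2 ^- n * 2 ^- n <= rnorm (circ x (x + W * 2 ^- n) y (y + H * 2 ^- n))].
have b0 : bad 0%N a c.
  by split; rewrite ?expr0 ?invr1 ?mulr1 ?/W ?/H ?subrKC.
have bS n x y : bad n x y -> exists i j : bool,
    bad n.+1 (x + i%:R * (W * 2 ^- n.+1)) (y + j%:R * (H * 2 ^- n.+1)).
  move=> [ax xb cy yd].
  have Wn : W * 2 ^- n = W * 2 ^- n.+1 + W * 2 ^- n.+1.
    by rewrite half_exprS mulrA -splitr.
  have Hn : H * 2 ^- n = H * 2 ^- n.+1 + H * 2 ^- n.+1.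
    by rewrite half_exprS mulrA -splitr.
  have w0 : 0 <= W * 2 ^- n.+1 by rewrite mulr_ge0// ltW// half_expr_gt0.
  have h0 : 0 <= H * 2 ^- n.+1 by rewrite mulr_ge0// ltW// half_expr_gt0.
  have -> : N * 2 ^- n * 2 ^- n = 4 * (N * 2 ^- n.+1 * 2 ^- n.+1).
    by rewrite half_exprS; field.
  move: xb yd; rewrite Wn Hn 2!addrA => xb yd.
  move=> /boundary_increment_quarter[i [j ij]]; exists i, j.
  have inside (k : bool) (z g w : R) : 0 <= w -> z + w + w <= g ->
      z <= z + k%:R * w /\ z + k%:R * w + w <= g.
    by case: k => /= w_ge0 zg; rewrite ?mul1r ?mul0r; split; lra.
  have [x1 x2] := inside i _ _ _ w0 xb; have [y1 y2] := inside j _ _ _ h0 yd.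
  by split=> //; [exact: le_trans x1|exact: le_trans y1].
have [x [y xy]] := quadrisection W0 H0 b0 bS.
have [x1 [y1 [[xa xb ya yb _] /andP[x1x xx2] /andP[y1y yy2]]]] := xy 0%N.
have xab : a <= x <= b by rewrite (le_trans xa)// (le_trans xx2).
have yab : c <= y <= d by rewrite (le_trans ya)// (le_trans yy2).
have [l lP] := dphi x y xab yab.
apply/rnorm_le0/rnorm_le_eps => e e0; rewrite add0r -/N.
pose T := 2 * (W + H) ^+ 2 + 1.
have T0 : 0 < T by rewrite ltr_wpDl// mulr_ge0// sqr_ge0.
have eT : 0 < e / T by rewrite divr_gt0.
have [h h0 hP] := lP _ eT.
have [n nP] := half_expr_small (addr_ge0 W0 H0) (divr_gt0 h0 (ltr0Sn R 1)).
have {}nP := nP n (leqnn n).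
have [p1 [q1 [[ap pb cq qd] big /andP[p1x xp2] /andP[q1y yq2]]]] := xy n.
set p2 := p1 + W * 2 ^- n in pb big xp2; set q2 := q1 + H * 2 ^- n in qd big yq2.
pose D := (W + H) * 2 ^- n.
have DE : D = (p2 - p1) + (q2 - q1) by rewrite /D /p2 /q2; ring.
have Dh : D < h.
  by apply: le_lt_trans nP _; rewrite ltr_pdivrMr// mulr_natr mulr2n ltrDl.
have p12 : p1 <= p2 by exact: le_trans xp2.
have q12 : q1 <= q2 by exact: le_trans yq2.
have D0 : 0 <= D by rewrite DE addr_ge0// subr_ge0.
have sub_p s : p1 <= s <= p2 -> a <= s <= b.
  by move=> /andP[s1 s2]; rewrite (le_trans ap)// (le_trans s2).
have sub_q t : q1 <= t <= q2 -> c <= t <= d.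
  by move=> /andP[t1 t2]; rewrite (le_trans cq)// (le_trans t2).
have dist (r r1 r2 s : R) : r1 <= r -> r <= r2 -> r1 <= s <= r2 -> `|s - r| <= r2 - r1.
  by move=> ? ? /andP[? ?]; rewrite ler_norml lerB// opprB andbT lerB.
have small : rnorm (circ p1 p2 q1 q2) <= 2 * (e / T * D) * D.
  rewrite {2}DE; apply: (@boundary_increment_affine phi X Y x y _ (phi x y) l) => //.
  - by rewrite mulr_ge0// ltW.
  - move=> t tq e' e'0; apply: (near_primitive_subset ap pb).
    by apply: Xphi => //; exact: sub_q.
  - move=> s sp e' e'0; apply: (near_primitive_subset cq qd).
    by apply: Yphi => //; exact: sub_p.
  - move=> s t sp tq; rewrite opprD addrA.
    have st : `|s - x| + `|t - y| <= D by rewrite DE lerD// dist.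
    apply: (le_trans (hP s t (sub_p s sp) (sub_q t tq) (le_lt_trans st Dh))).
    by rewrite ler_wpM2l// ltW.
have := le_trans big small; rewrite /D.
have -> : 2 * (e / T * ((W + H) * 2 ^- n)) * ((W + H) * 2 ^- n) =
   2 * (e / T) * (W + H) ^+ 2 * 2 ^- n * 2 ^- n by ring.
rewrite !ler_pM2r ?half_expr_gt0// => /le_trans; apply.
have -> : 2 * (e / T) * (W + H) ^+ 2 = 2 * (W + H) ^+ 2 * e / T by ring.
by rewrite ler_pdivrMr// [e * T]mulrC ler_pM2r// /T lerDl.
Qed.

End goursat.

Section polar.
Context {R : realType}.
Implicit Types (a b s t e d x h : R).

(** The complex exponential at $s+it$. *)
Definition cexp s t : R[i] := (expR s)%:C * (cos t +i* sin t).

Lemma is_derive_eps (f : R -> R) x l : is_derive x 1 f l ->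
  forall e, 0 < e -> exists2 d, 0 < d & forall h, `|h| < d ->
    `|f (x + h) - f x - h * l| <= e * `|h|.
Proof.
move=> [fx lE] e e0.
have : h^-1 *: ((f \o shift x) (h *: (1 : R)) - f x) @[h --> 0^'] --> l.
  by rewrite -lE; exact: fx.
move=> /cvgrPdist_le/(_ _ e0); rewrite near_withinE => /nbhs_normP[d /= d0 dP].
exists d => // h hd; have [->|h0] := eqVneq h 0.
  by rewrite addr0 subrr mul0r subrr normr0 mulr0.
have := dP h; rewrite /= sub0r normrN => /(_ hd h0).
rewrite /GRing.scale /= mulr1 [h + x]addrC => H.
have -> : f (x + h) - f x - h * l = - h * (l - h^-1 * (f (x + h) - f x)).
  by field.
by rewrite normrM normrN mulrC ler_wpM2r.
Qed.

Lemma cabs_i : cabs ('i : R[i]) = 1.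
Proof. by rewrite /cabs normc_def /= expr0n expr1n add0r sqrtr1. Qed.

Lemma cabs_le x h : cabs (x +i* h) <= `|x| + `|h|.
Proof.
rewrite [_ +i* _]complexE /= (le_trans (cabsD _ _))//.
by rewrite cabsM cabs_i mul1r !cabs_real.
Qed.

Lemma cabs_cexp s t : cabs (cexp s t) = expR s.
Proof.
rewrite cabsM cabs_real ger0_norm ?expR_ge0// /cabs normc_def /=.
by rewrite cos2Dsin2 sqrtr1 mulr1.
Qed.

Lemma cexpD s t a b : cexp (s + a) (t + b) = cexp s t * cexp a b.
Proof.
rewrite /cexp expRD cosD sinD; simpc.
by congr (_ +i* _); ring.
Qed.

(** Differentiability of the exponential at [0]; by [cexpD] this is enough for
    all points. *)
Lemma cexp_linear_part e : 0 < e -> exists2 d, 0 < d & forall s t,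
  `|s| + `|t| < d -> cabs (cexp s t - 1 - (s +i* t)) <= e * (`|s| + `|t|).
Proof.
move=> e0; pose h := Num.min 1 (e / 5).
have h0 : 0 < h by rewrite lt_min ltr01 divr_gt0.
have h1 : h <= 1 by rewrite ge_min lexx.
have he : 5 * h <= e.
  have : h <= e / 5 by rewrite ge_min lexx orbT.
  by rewrite ler_pdivlMr// mulrC.
have [d1 d10 H1] := is_derive_eps (is_derive_expR 0) h0.
have [d2 d20 H2] := is_derive_eps (is_derive_cos 0) h0.
have [d3 d30 H3] := is_derive_eps (is_derive_sin 0) h0.
exists (Num.min (Num.min d1 d2) (Num.min d3 (h / 2))).
  by rewrite !lt_min d10 d20 d30 divr_gt0.
move=> s t; rewrite !lt_min => /andP[/andP[st1 st2] /andP[st3 sth]].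
have s0 := normr_ge0 s; have t0 := normr_ge0 t.
have := H1 s; rewrite expR0 add0r mulr1 => /(_ ltac:(lra)) {}H1.
have := H2 t; rewrite cos0 sin0 add0r oppr0 mulr0 subr0 => /(_ ltac:(lra)) {}H2.
have := H3 t; rewrite cos0 sin0 add0r mulr1 subr0 => /(_ ltac:(lra)) {}H3.
have -> : cexp s t - 1 - (s +i* t) =
    ((expR s - 1 - s) * cos t + (1 + s) * (cos t - 1)) +i*
    ((expR s - 1) * sin t + (sin t - t)).
  rewrite /cexp; simpc; congr (_ +i* _); ring.
apply: (le_trans (cabs_le _ _)).
have c1 : `|cos t| <= 1 by rewrite ler_norml cos_geN1 cos_le1.
have e2 : `|expR s - 1| <= h.
  have -> : expR s - 1 = (expR s - 1 - s) + s by ring.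
  have := ler_normD (expR s - 1 - s) s; have := ler_wpM2r s0 h1; lra.
have n2 : `|sin t| <= 2 * `|t|.
  have -> : sin t = (sin t - t) + t by ring.
  have := ler_normD (sin t - t) t; have := ler_wpM2r t0 h1; lra.
have b1 : `|(expR s - 1 - s) * cos t| <= h * `|s|.
  by rewrite normrM -[leRHS]mulr1 ler_pM.
have b2 : `|(1 + s) * (cos t - 1)| <= 2 * (h * `|t|).
  rewrite normrM ler_pM//; have := ler_normD 1 s; rewrite normr1; lra.
have b3 : `|(expR s - 1) * sin t| <= h * (2 * `|t|) by rewrite normrM ler_pM.
have := ler_normD ((expR s - 1 - s) * cos t) ((1 + s) * (cos t - 1)).
have := ler_normD ((expR s - 1) * sin t) (sin t - t).
have := ler_wpM2r (addr_ge0 s0 t0) he.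
have := mulr_ge0 (ltW h0) s0; lra.
Qed.

End polar.

Section complex_derivative.
Context {R : realType} {Pi : completeNormedModType R[i]}.
Implicit Types (f h k : R[i] -> Pi) (z w u : R[i]) (l : Pi) (e d r M : R).

Definition has_cderiv f z l := forall e, 0 < e -> exists2 d, 0 < d &
  forall u, cabs u < d -> rnorm (f (z + u) - f z - u *: l) <= e * cabs u.

Lemma has_cderiv_local f h z l d : 0 < d ->
  (forall u, cabs u < d -> f (z + u) = h (z + u)) ->
  has_cderiv f z l -> has_cderiv h z l.
Proof.
move=> d0 fh fl e e0; have [d' d'0 H] := fl e e0.
exists (Num.min d d'); first by rewrite lt_min d0.
move=> u; rewrite lt_min => /andP[ud ud'].
rewrite -fh// -[in h z](addr0 z) -fh ?cabs0// addr0; exact: H.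
Qed.

Lemma has_cderivB f h z l l' : has_cderiv f z l -> has_cderiv h z l' ->
  has_cderiv (fun x => f x - h x) z (l - l').
Proof.
move=> fl hl e e0; have e20 : 0 < e / 2 by rewrite divr_gt0.
have [d d0 H] := fl _ e20; have [d' d'0 H'] := hl _ e20.
exists (Num.min d d'); first by rewrite lt_min d0.
move=> u; rewrite lt_min => /andP[ud ud'].
have -> : f (z + u) - h (z + u) - (f z - h z) - u *: (l - l') =
   (f (z + u) - f z - u *: l) - (h (z + u) - h z - u *: l').
  by lin_coefs R[i] Pi; ring.
have := rnormBD (f (z + u) - f z - u *: l) (h (z + u) - h z - u *: l').
have := H u ud; have := H' u ud'; lra.
Qed.

Lemma has_cderiv_const (c : Pi) z : has_cderiv (fun=> c) z 0.
Proof.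
move=> e e0; exists 1 => // u _.
by rewrite subrr scaler0 subr0 rnorm0 mulr_ge0 ?cabs_ge0// ltW.
Qed.

Lemma has_cderiv_shift f w z l : has_cderiv f (w + z) l ->
  has_cderiv (fun x => f (w + x)) z l.
Proof.
by move=> fl e e0; have [d d0 H] := fl e e0; exists d => // u; rewrite addrA; exact: H.
Qed.

Lemma has_cderiv_quotient f z l : z != 0 -> has_cderiv f z l ->
  has_cderiv (fun x => x^-1 *: f x) z (z^-1 *: l - (z ^+ 2)^-1 *: f z).
Proof.
move=> z0 fl e e0; pose m := cabs z.
have m0 : 0 < m by rewrite cabs_gt0.
pose K := rnorm (f z) / m ^+ 2 + rnorm l / m.
have K0 : 0 <= K by rewrite addr_ge0// divr_ge0 ?rnorm_ge0 ?exprn_ge0 ?(ltW m0).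
have [|d d0 H] := fl (e * m / 4); first by rewrite divr_gt0// mulr_gt0.
exists (Num.min d (Num.min (m / 2) (e * m / (4 * (K + 1))))).
  by rewrite !lt_min d0 !divr_gt0 ?mulr_gt0// ltr_wpDl.
move=> u; rewrite !lt_min => /andP[ud /andP[um uK]].
have zu : m / 2 <= cabs (z + u).
  by have := cabsD (z + u) (- u); rewrite addrK cabsN -/m; lra.
have zu0 : 0 < cabs (z + u) by rewrite (lt_le_trans _ zu)// divr_gt0.
have zun : z + u != 0 by rewrite -cabs_gt0.
have -> : (z + u)^-1 *: f (z + u) - z^-1 *: f z - u *: (z^-1 *: l - (z ^+ 2)^-1 *: f z) =
    (z + u)^-1 *: ((f (z + u) - f z - u *: l) +
      (u ^+ 2) *: ((z ^+ 2)^-1 *: f z - z^-1 *: l)).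
  by lin_coefs R[i] Pi; field; rewrite ?zun ?z0.
rewrite rnormZ cabsV mulrC ler_pdivrMr//.
apply: (le_trans (rnormD _ _)); rewrite rnormZ.
have Kz : rnorm ((z ^+ 2)^-1 *: f z - z^-1 *: l) <= K.
  rewrite (le_trans (rnormBD _ _))// !rnormZ !cabsV expr2 cabsM -/m /K expr2.
  by rewrite mulrC [_ * rnorm l]mulrC.
have u0 := cabs_ge0 u; have := H u ud.
have : cabs (u ^+ 2) * rnorm ((z ^+ 2)^-1 *: f z - z^-1 *: l) <= e * m / 4 * cabs u.
  rewrite expr2 cabsM -mulrA mulrC ler_wpM2r//.
  rewrite (@le_trans _ _ (cabs u * (K + 1)))//.
    by rewrite ler_wpM2l// (le_trans Kz)// lerDl.
  move: uK; rewrite ltr_pdivlMr ?mulr_gt0 ?ltr_wpDl// => /ltW; lra.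
have := ler_wpM2l (mulr_ge0 (ltW e0) u0) zu; lra.
Qed.

Lemma polar_differentiable a b c d f :
  (forall s t, a <= s <= b -> c <= t <= d -> exists l, has_cderiv f (cexp s t) l) ->
  differentiable_on_rect a b c d (fun s t => f (cexp s t)).
Proof.
move=> fl s t sab tcd; have [l lP] := fl s t sab tcd.
set z := cexp s t in lP *; exists (z *: l) => e e0.
have m0 : 0 < cabs z by rewrite cabs_cexp expR_gt0.
have [d1 d10 H1] := lP _ (divr_gt0 e0 (mulr_gt0 (ltr0Sn R 5) m0)).
have K0 : 0 < 2 * (cabs z * rnorm l + 1).
  by rewrite mulr_gt0// ltr_wpDl// mulr_ge0 ?rnorm_ge0// ltW.
have [d2 d20 H2] := cexp_linear_part (@ltr01 R).
have [d3 d30 H3] := cexp_linear_part (divr_gt0 e0 K0).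
exists (Num.min d2 (Num.min d3 (d1 / (3 * cabs z)))).
  by rewrite !lt_min d20 d30 divr_gt0// mulr_gt0.
move=> s' t' _ _; rewrite !lt_min => /andP[st2 /andP[st3 st1]].
have := H2 _ _ st2; have := H3 _ _ st3; move: st1.
set x := s' - s; set y := t' - t; set N := `|x| + `|y|.
have N0 : 0 <= N by rewrite addr_ge0.
have -> : cexp s' t' = z * cexp x y by rewrite -cexpD !subrKC.
set q := cexp x y - 1 => st1 h3 h2.
have qN : cabs q <= 2 * N.
  have := cabsD (q - (x +i* y)) (x +i* y); rewrite subrK.
  by have := cabs_le x y; rewrite -/N; lra.
have -> : z * cexp x y = z + z * q by rewrite /q; ring.
have zq : cabs (z * q) <= 2 * N * cabs z by rewrite cabsM mulrC ler_wpM2r// ltW.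
have zqd : cabs (z * q) < d1.
  by move: st1; rewrite ltr_pdivlMr ?mulr_gt0//; have := mulr_ge0 N0 (ltW m0); lra.
have := H1 _ zqd => h1.
have -> : f (z + z * q) - f z - (x +i* y) *: (z *: l) =
   (f (z + z * q) - f z - (z * q) *: l) + (z * (q - (x +i* y))) *: l.
  by lin_coefs R[i] Pi; ring.
apply: (le_trans (rnormD _ _)); rewrite rnormZ cabsM.
have a1 : e / (6 * cabs z) * cabs (z * q) <= e / 3 * N.
  have -> : e / 3 * N = e / (6 * cabs z) * (2 * N * cabs z).
    by field; rewrite gt_eqF.
  by rewrite ler_wpM2l// divr_ge0 ?mulr_ge0 ?ltW.
have a2 : cabs z * cabs (q - (x +i* y)) * rnorm l <= e / 2 * N.
  have zl0 : 0 <= cabs z * rnorm l by rewrite mulr_ge0 ?rnorm_ge0 ?ltW.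
  rewrite mulrAC; apply: (le_trans (ler_wpM2l zl0 h3)).
  have -> : e / 2 * N = (cabs z * rnorm l + 1) *
      (e / (2 * (cabs z * rnorm l + 1)) * N).
    by field; rewrite gt_eqF// ltr_wpDl.
  rewrite ler_wpM2r ?lerDl// mulr_ge0// divr_ge0 ?ltW//.
have := mulr_ge0 (ltW e0) N0; lra.
Qed.

End complex_derivative.

Section cauchy.
Context {R : realType} {Pi : completeNormedModType R[i]}.
Implicit Types (f h k : R[i] -> Pi) (z w u : R[i]) (l : Pi) (a b c d e s t r M : R).

Lemma linear_primitive a b (c : Pi) : primitive a b (fun t => t%:C *: c) (fun=> c).
Proof.
move=> e e0 t _; exists 1 => // s _ _.
have -> : s%:C *: c - t%:C *: c - (s - t)%:C *: c = 0.
  by lin_coefs R[i] Pi; ring.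
by rewrite rnorm0 mulr_ge0// ltW.
Qed.

Lemma locally_lipschitz_continuous a b (F : R -> Pi) :
  (forall t, a <= t <= b -> exists K d, [/\ 0 <= K, 0 < d & forall s, a <= s <= b ->
     `|s - t| < d -> rnorm (F s - F t) <= K * `|s - t|]) ->
  continuous_curve a b F.
Proof.
move=> H t tab e e0; have [K [d [K0 d0 Fd]]] := H t tab.
have K1 : 0 < K + 1 by rewrite ltr_wpDl.
exists (Num.min d (e / (K + 1))); first by rewrite lt_min d0 divr_gt0.
move=> s sab; rewrite lt_min ltr_pdivlMr// => /andP[sd se].
by have := Fd s sab sd; have := normr_ge0 (s - t); lra.
Qed.

Lemma differentiable_on_rect_continuous a b c d (phi : R -> R -> Pi) :
  differentiable_on_rect a b c d phi ->
  (forall t, c <= t <= d -> continuous_curve a b (phi ^~ t)) /\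
  (forall s, a <= s <= b -> continuous_curve c d (phi s)).
Proof.
move=> dphi; split=> [t tcd|s sab]; apply: locally_lipschitz_continuous;
  [move=> s sab|move=> t tcd]; have [l lP] := dphi s t sab tcd; have [h h0 H] := lP 1 ltr01;
  exists (rnorm l + 1), h; (split=> //; first by rewrite addr_ge0 ?rnorm_ge0).
- move=> s' s'ab sh; have := H s' t s'ab tcd; rewrite subrr normr0 addr0 => /(_ sh).
  have := rnormD (phi s' t - phi s t - ((s' - s) +i* 0) *: l) (((s' - s) +i* 0) *: l).
  rewrite subrK rnormZ; have := cabs_le (s' - s) 0; rewrite normr0 addr0.
  by move=> /(ler_wpM2r (rnorm_ge0 l)); lra.
- move=> t' t'cd th; have := H s t' sab t'cd; rewrite subrr normr0 add0r => /(_ th).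
  have := rnormD (phi s t' - phi s t - (0 +i* (t' - t)) *: l) ((0 +i* (t' - t)) *: l).
  rewrite subrK rnormZ; have := cabs_le 0 (t' - t); rewrite normr0 add0r.
  by move=> /(ler_wpM2r (rnorm_ge0 l)); lra.
Qed.

(** In polar coordinates $z=e^{s+it}$ the punctured disc becomes a half-strip,
    and Goursat's lemma applies to its truncations. By periodicity the sides with
    constant $t$ cancel, hence the mean over a circle does not depend on
    its radius; on small circles it is close to [f 0] by continuity. *)
Lemma center_bound f r M : 0 < r ->
  (forall z, 0 < cabs z -> cabs z <= r -> exists l, has_cderiv f z l) ->
  (forall e, 0 < e -> exists2 d, 0 < d & forall z, cabs z < d ->
     rnorm (f z - f 0) <= e) ->
  (forall z, cabs z = r -> rnorm (f z) <= M) -> rnorm (f 0) <= M.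
Proof.
move=> r0 fl fc fM; apply: rnorm_le_eps => e e0.
have [d d0 fd] := fc e e0.
pose b := ln r; pose a := Num.min b (ln (d / 2)).
have d20 : 0 < d / 2 by rewrite divr_gt0.
have eb : expR b = r by rewrite lnK.
have ea : expR a < d.
  have : expR a <= d / 2 by rewrite -[leRHS]lnK ?posrE// ler_expR ge_min lexx orbT.
  by move: d0; lra.
have ab : a <= b by rewrite ge_min lexx.
pose T : R := pi *+ 2.
have T0 : 0 < T by rewrite mulrn_wgt0// pi_gt0.
have per s : cexp s T = cexp s 0 by rewrite /cexp cos2pi sin2pi cos0 sin0.
pose phi s t := f (cexp s t).
have dphi : differentiable_on_rect a b 0 T phi.
  apply: polar_differentiable => s t /andP[_ sb] _; apply: fl; rewrite cabs_cexp.
    exact: expR_gt0.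
  by rewrite -eb ler_expR.
have [cphi1 cphi2] := differentiable_on_rect_continuous dphi.
have Xex t : exists F, 0 <= t <= T -> primitive a b F (phi ^~ t).
  have [tT|_] := boolP (0 <= t <= T); last by exists (fun=> 0).
  by have [F FP] := primitive_exists ab (cphi1 t tT); exists F.
have Yex s : exists F, a <= s <= b -> primitive 0 T F (phi s).
  have [sab|_] := boolP (a <= s <= b); last by exists (fun=> 0).
  by have [F FP] := primitive_exists (ltW T0) (cphi2 s sab); exists F.
have [X XP] := choice Xex; have [Y YP] := choice Yex.
have := goursat ab (ltW T0) dphi XP YP; rewrite /boundary_increment.
have T00 : (0 : R) <= 0 <= T by rewrite lexx ltW.
have T0T : 0 <= T <= T by rewrite lexx ltW.
have aab : a <= a <= b by rewrite lexx.
have bab : a <= b <= b by rewrite lexx ab.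
have hor : (X 0 b - X T b) - (X 0 a - X T a) = 0.
  apply: rnorm_le0.
  have := @mean_value_primitive _ _ _ _ _ _ 0 (primitiveB (XP 0 T00) (XP T T0T)) _
    a b aab bab.
  by rewrite mul0r; apply=> s _; rewrite /phi per subrr rnorm0.
have ver_b : rnorm (Y b T - Y b 0) <= M * T.
  have := @mean_value_primitive _ _ _ _ _ _ M (YP b bab) _ 0 T T00 T0T.
  rewrite subr0 (gtr0_norm T0); apply=> t _.
  by apply: fM; rewrite cabs_cexp.
have ver_a : rnorm ((Y a T - T%:C *: f 0) - (Y a 0 - 0%:C *: f 0)) <= e * T.
  have := @mean_value_primitive _ _ _ _ _ _ e
    (primitiveB (YP a aab) (@linear_primitive 0 T (f 0))) _ 0 T T00 T0T.
  rewrite subr0 (gtr0_norm T0); apply=> t _.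
  by apply: fd; rewrite cabs_cexp.
have -> : X 0 b - X 0 a + 'i *: (Y b T - Y b 0) - (X T b - X T a)
    - 'i *: (Y a T - Y a 0) =
    (X 0 b - X T b) - (X 0 a - X T a) + 'i *: ((Y b T - Y b 0) - (Y a T - Y a 0)).
  by lin_coefs R[i] Pi; ring.
rewrite hor add0r => /(congr1 rnorm); rewrite rnormZ cabs_i mul1r rnorm0 => same.
have {}same : Y b T - Y b 0 = Y a T - Y a 0.
  by apply/eqP; rewrite -subr_eq0; apply/eqP/rnorm_le0; rewrite same.
rewrite -(ler_pM2r T0) mulrDl [leLHS]mulrC.
have -> : T * rnorm (f 0) = rnorm (T%:C *: f 0) by rewrite rnormZr gtr0_norm.
have -> : T%:C *: f 0 = (Y b T - Y b 0)
    - ((Y a T - T%:C *: f 0) - (Y a 0 - 0%:C *: f 0)).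
  by rewrite same; lin_coefs R[i] Pi; ring.
by have := rnormBD (Y b T - Y b 0) ((Y a T - T%:C *: f 0) - (Y a 0 - 0%:C *: f 0)); lra.
Qed.

(** Schwarz's lemma: [center_bound] applies to [z^-1 *: f z], extended to the
    centre by the derivative. *)
Lemma schwarz f r M l : 0 < r -> f 0 = 0 -> has_cderiv f 0 l ->
  (forall z, cabs z <= r -> exists l', has_cderiv f z l') ->
  (forall z, cabs z = r -> rnorm (f z) <= M) -> rnorm l <= M / r.
Proof.
move=> r0 f0 fl fd fM.
(* The quotient is continuous, but perhaps not differentiable, at the centre. *)
pose h z := if z == 0 then l else z^-1 *: f z.
have -> : l = h 0 by rewrite /h eqxx.
apply: (@center_bound h r) => //.
- move=> z z0 zr; have [l' fl'] := fd z zr.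
  have zn : z != 0 by rewrite -cabs_gt0.
  exists (z^-1 *: l' - (z ^+ 2)^-1 *: f z).
  apply: (has_cderiv_local z0 _ (has_cderiv_quotient zn fl')) => u uz.
  rewrite /h ifF//; apply/negbTE; rewrite -cabs_gt0.
  by have := cabsD (z + u) (- u); rewrite addrK cabsN; lra.
- move=> e e0; have [d d0 H] := fl e e0; exists d => // z zd.
  rewrite /h eqxx; have [_|zn] := eqVneq z 0; first by rewrite subrr rnorm0 ltW.
  have := H z zd; rewrite add0r f0 subr0 => zP.
  have -> : z^-1 *: f z - l = z^-1 *: (f z - z *: l).
    by lin_coefs R[i] Pi; field.
  by rewrite rnormZ cabsV mulrC ler_pdivrMr// cabs_gt0.
- move=> z zr; have zn : z != 0 by rewrite -cabs_gt0 zr.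
  rewrite /h (negbTE zn) rnormZ cabsV zr mulrC.
  by rewrite ler_pM2r ?invr_gt0// fM.
Qed.

Lemma cauchy_estimate f w r M l : 0 < r -> has_cderiv f w l ->
  (forall z, cabs z <= r -> exists l', has_cderiv f (w + z) l') ->
  (forall z, cabs z <= r -> rnorm (f (w + z)) <= M) -> rnorm l <= 2 * M / r.
Proof.
move=> r0 fl fd fM; rewrite -[l]subr0.
apply: (@schwarz (fun z => f (w + z) - f w)) => //.
- by rewrite addr0 subrr.
- apply: has_cderivB; last exact: has_cderiv_const.
  by apply: has_cderiv_shift; rewrite addr0.
- move=> z /fd[l' fl']; exists (l' - 0).
  apply: has_cderivB; last exact: has_cderiv_const.
  exact: has_cderiv_shift.
- move=> z zr; rewrite (le_trans (rnormBD _ _))//.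
  have := fM z; rewrite zr => /(_ (lexx _)).
  by have := fM 0; rewrite addr0 cabs0 => /(_ (ltW r0)); lra.
Qed.

(** Restriction to the real line through [w] with direction [u]. *)
Lemma has_cderiv_line f w u (l : R -> Pi) a b :
  (forall s, a <= s <= b -> has_cderiv f (w + s%:C * u) (l s)) ->
  primitive a b (fun s => f (w + s%:C * u)) (fun s => u *: l s).
Proof.
move=> fl e e0 s sab; have K0 : 0 < cabs u + 1 by rewrite ltr_wpDl// cabs_ge0.
have [d d0 H] := fl s sab _ (divr_gt0 e0 K0).
exists (d / (cabs u + 1)); first by rewrite divr_gt0.
move=> t tab; rewrite ltr_pdivlMr// => td.
have E : cabs ((t - s)%:C * u) = `|t - s| * cabs u by rewrite cabsM cabs_real.
have := H ((t - s)%:C * u); rewrite E.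
have -> : w + s%:C * u + (t - s)%:C * u = w + t%:C * u by ring.
rewrite scalerA => /(_ _)h; apply: (le_trans (h _)).
  by have := normr_ge0 (t - s); lra.
rewrite mulrA mulrAC ler_wpM2r// mulrAC ler_pdivrMr// ler_pM2l// lerDl//.
Qed.

Lemma cabs_segment z w s r : 0 <= s <= 1 -> cabs z <= r -> cabs w <= r ->
  cabs (w + s%:C * (z - w)) <= r.
Proof.
move=> /andP[s0 s1] zr wr.
have -> : w + s%:C * (z - w) = (1 - s)%:C * w + s%:C * z by ring.
have := cabsD ((1 - s)%:C * w) (s%:C * z).
rewrite !cabsM !cabs_real !ger0_norm ?subr_ge0//.
have := ler_wpM2l s0 zr; have : (1 - s) * cabs w <= (1 - s) * r.
  by rewrite ler_wpM2l// subr_ge0.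
lra.
Qed.

Lemma lipschitz_half_disc f r M : 0 < r ->
  (forall z, cabs z <= 2 * r -> exists l, has_cderiv f z l) ->
  (forall z, cabs z <= 2 * r -> rnorm (f z) <= M) ->
  forall z w, cabs z <= r -> cabs w <= r ->
    rnorm (f z - f w) <= 2 * M / r * cabs (z - w).
Proof.
move=> r0 fd fM z w zr wr.
have /choice[g gP] (u : R[i]) : exists l, cabs u <= r -> has_cderiv f u l.
  have [ur|ur] := boolP (cabs u <= r); last by exists 0.
  by have [|l lP] := fd u; [lra|exists l].
have := has_cderiv_line (fun s s01 => gP _ (cabs_segment s01 zr wr)).
move=> /(@mean_value_primitive _ _ _ _ _ _ (2 * M / r * cabs (z - w))) MV.
have := MV _ 0 1; rewrite !lexx ler01 subr0 normr1 mulr1 mul0r addr0 mul1r.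
rewrite subrKC; apply=> // s s01; rewrite rnormZ mulrC ler_wpM2r ?cabs_ge0//.
have sr := cabs_segment s01 zr wr.
apply: (cauchy_estimate r0 (gP _ sr)) => u ur.
  by apply: fd; have := cabsD (w + s%:C * (z - w)) u; lra.
by apply: fM; have := cabsD (w + s%:C * (z - w)) u; lra.
Qed.

(** The derivative of [f] at [w] minus that at [0] is the derivative at [0] of
    [fun u => f (w + u) - f u], whose variation is of the order of [w] by the
    Lipschitz estimate. So the derivative is Lipschitz at [0], and the mean value
    inequality on the segment from [0] to [z] gives the quadratic bound. *)
Lemma quadratic_remainder f r M l : 0 < r ->
  (forall z, cabs z <= 4 * r -> exists l', has_cderiv f z l') ->
  (forall z, cabs z <= 4 * r -> rnorm (f z) <= M) -> has_cderiv f 0 l ->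
  forall z, cabs z <= r ->
    rnorm (f z - f 0 - z *: l) <= 2 * M / r ^+ 2 * cabs z ^+ 2.
Proof.
move=> r0 fd fM fl z zr.
have r20 : 0 < 2 * r by rewrite mulr_gt0.
have r4 : 2 * (2 * r) = 4 * r by ring.
have lip w w' : cabs w <= 2 * r -> cabs w' <= 2 * r ->
    rnorm (f w - f w') <= M / r * cabs (w - w').
  move=> wr w'r; have := lipschitz_half_disc (M := M) r20 _ _ wr w'r.
  have -> : 2 * M / (2 * r) = M / r by field; rewrite gt_eqF.
  by rewrite r4; exact.
have /choice[g gP] (u : R[i]) : exists l', cabs u <= r -> has_cderiv f u l'.
  have [ur|ur] := boolP (cabs u <= r); last by exists 0.
  by have [|l' lP] := fd u; [lra|exists l'].
have gl w : cabs w <= r -> rnorm (g w - l) <= 2 * M / r ^+ 2 * cabs w.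
  move=> wr.
  have -> : 2 * M / r ^+ 2 * cabs w = (2 * (M / r) * cabs w) / r.
    by field; rewrite gt_eqF.
  rewrite (_ : g w - l = (g w - 0) - (l - 0)); last by rewrite !subr0.
  apply: (@schwarz (fun u => f (w + u) - f w - (f u - f 0))) => //.
  - by rewrite addr0 !subrr.
  - apply: has_cderivB; apply: has_cderivB => //; try exact: has_cderiv_const.
    by apply: has_cderiv_shift; rewrite addr0; exact: gP.
  - move=> u ur; have [|l1 l1P] := fd (w + u); first by have := cabsD w u; lra.
    have [|l2 l2P] := fd u; first by lra.
    exists ((l1 - 0) - (l2 - 0)).
    apply: has_cderivB; apply: has_cderivB => //; try exact: has_cderiv_const.
    exact: has_cderiv_shift.
  - move=> u ur.
    have -> : f (w + u) - f w - (f u - f 0) = (f (w + u) - f u) - (f w - f 0).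
      by lin_coefs R[i] Pi; ring.
    have := rnormBD (f (w + u) - f u) (f w - f 0).
    have := lip (w + u) u; rewrite addrK => /(_ _ _)h1.
    have := lip w 0; rewrite subr0 cabs0 => /(_ _ _)h2.
    have := h1 ltac:(by have := cabsD w u; lra) ltac:(lra).
    have := h2 ltac:(lra) ltac:(lra).
    lra.
have zz : forall s, 0 <= s <= 1 -> cabs (0 + s%:C * z) <= cabs z.
  move=> s /andP[s0 s1]; rewrite add0r cabsM cabs_real ger0_norm//.
  by rewrite ler_piMl// cabs_ge0.
have line : primitive 0 1 (fun s => f (0 + s%:C * z) - s%:C *: (z *: l))
    (fun s => z *: g (0 + s%:C * z) - z *: l).
  apply: primitiveB; last exact: linear_primitive.
  by apply: has_cderiv_line => s s01; apply: gP; exact: le_trans (zz s s01) zr.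
have := @mean_value_primitive _ _ _ _ _ _ (2 * M / r ^+ 2 * cabs z ^+ 2) line _ 0 1.
rewrite !lexx ler01 subr0 normr1 mulr1 mul0r addr0 add0r mul1r.
have -> : f z - 1 *: (z *: l) - (f 0 - 0 *: (z *: l)) = f z - f 0 - z *: l.
  by lin_coefs R[i] Pi; ring.
apply=> // s s01; rewrite -scalerBr rnormZ.
have := gl _ (le_trans (zz s s01) zr).
have M0 : 0 <= M by rewrite (le_trans (rnorm_ge0 (f 0)))// fM// cabs0 mulr_ge0// ltW.
have := zz s s01 => /(ler_wpM2l (_ : 0 <= 2 * M / r ^+ 2)) h.
have := h ltac:(by rewrite divr_ge0 ?mulr_ge0 ?exprn_ge0 ?(ltW r0)) => h1 h2.
rewrite expr2 mulrA mulrC ler_wpM2r ?cabs_ge0//.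
exact: le_trans h2 h1.
Qed.

End cauchy.

(** * Functions of the class E along curves *)

Section right_hand_sides.
Context {R : realType} {Pi : completeNormedModType R[i]} {I : set R}.
Context {O : relopen (I `*` [set: Pi])}.
Implicit Types (phi psi : E_space O) (t s e d r M : R) (x w xi : Pi).

(** The partial function of [phi] at [t], extended by [0] outside of [O]. *)
Definition section_fun phi t xi : Pi := graph_fun (section_graph phi t) xi.

Lemma E_valP phi : Eset phi.
Proof. by have := valP phi; rewrite inE. Qed.

Lemma section_fun_val phi t xi (h : relopen_set O (t, xi)) :
  section_fun phi t xi = phi (relopen_pt h).
Proof. exact: section_funE. Qed.

Lemma section_funD phi psi (a : R[i]) t xi :
  section_fun (a *: phi + psi) t xi = a *: section_fun phi t xi + section_fun psi t xi.
Proof. exact: (congr1 (fun f => f xi) (section_fun_lin phi psi t a)). Qed.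

Lemma section_funB phi psi t xi :
  section_fun (phi - psi) t xi = section_fun phi t xi - section_fun psi t xi.
Proof.
have := section_funD (phi - psi) psi 1 t xi; rewrite !scale1r subrK => ->.
by rewrite addrK.
Qed.

Lemma relopen_near p : relopen_set O p -> exists2 d, 0 < d & forall q, I q.1 ->
  `|q.1 - p.1| < d -> rnorm (q.2 - p.2) < d -> relopen_set O q.
Proof.
have [U oU OU] := relopenP O; rewrite OU => -[_ Up].
have : nbhs p U by exact: open_nbhs_nbhs.
move=> [[V W] /= [/nbhs_ballP[d1 /= d10 H1] /nbhs_rnormP[d2 d20 H2]] VWU].
exists (Num.min d1 d2); first by rewrite lt_min d10.
move=> q Iq; rewrite !lt_min => /andP[q1 _] /andP[_ q2]; split=> //.
apply: VWU; split; last exact: H2.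
by apply: H1; rewrite -ball_normE /= distrC.
Qed.

Lemma relopen_fst p : relopen_set O p -> I p.1.
Proof. by have [U oU OU] := relopenP O; rewrite OU => -[[]]. Qed.

Lemma section_fun_continuous phi p : relopen_set O p -> forall e, 0 < e ->
  exists2 d, 0 < d & forall q, relopen_set O q ->
    `|q.1 - p.1| < d -> rnorm (q.2 - p.2) < d ->
    rnorm (section_fun phi q.1 q.2 - section_fun phi p.1 p.2) < e.
Proof.
move=> Op e e0; have [phic _ _] := E_valP phi.
have := phic (relopen_pt Op) [set v | rnorm (v - phi (relopen_pt Op)) < e].
case; first by apply/nbhs_rnormP; exists e.
move=> V [[U oU <-] Up] UV.
have : nbhs p U by exact: open_nbhs_nbhs.
move=> [[V1 V2] /= [/nbhs_ballP[d1 /= d10 H1] /nbhs_rnormP[d2 d20 H2]] VWU].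
exists (Num.min d1 d2); first by rewrite lt_min d10.
move=> q Oq; rewrite !lt_min => /andP[q1 _] /andP[_ q2].
have Oq' : relopen_set O (q.1, q.2) by rewrite -surjective_pairing.
have Op' : relopen_set O (p.1, p.2) by rewrite -surjective_pairing.
rewrite (section_fun_val phi Oq') (section_fun_val phi Op').
have -> : relopen_pt Op' = relopen_pt Op by apply: val_inj; rewrite /= -surjective_pairing.
apply: (UV (relopen_pt Oq')); apply: VWU; split; last exact: H2.
by apply: H1; rewrite -ball_normE /= distrC.
Qed.

Lemma section_fun_curve_continuous phi a b (y : R -> Pi) :
  (forall t, a <= t <= b -> relopen_set O (t, y t)) ->
  continuous_curve a b y -> continuous_curve a b (fun t => section_fun phi t (y t)).
Proof.
move=> Oy yc t tab e e0; have [d d0 H] := section_fun_continuous phi (Oy t tab) e0.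
have d20 : 0 < d / 2 by rewrite divr_gt0.
have [d' d'0 H'] := yc t tab _ d20; exists (Num.min d d'); first by rewrite lt_min d0.
move=> s sab; rewrite lt_min => /andP[sd sd'].
apply/ltW/(H (s, y s)) => //=; first exact: Oy.
by have := H' s sab sd'; lra.
Qed.

Lemma section_fun_bounded phi B : Ebornology O B ->
  exists2 M, 0 < M & forall p, B p -> rnorm (section_fun phi p.1 p.2) <= M.
Proof.
move=> BB; have [_ _ /(_ B BB)/bounded_setP[r r0 rP]] := E_valP phi.
have [r'0 rE] := gt0_Re r0; exists (complex.Re r) => // p Bp.
have [BO _ _] := BB; have Op := BO p Bp.
have Op' : relopen_set O (p.1, p.2) by rewrite -surjective_pairing.
rewrite (section_fun_val phi Op') -lecR rnormE rE; apply: rP.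
by exists (relopen_pt Op') => //; change (B (p.1, p.2)); rewrite -surjective_pairing.
Qed.

Lemma section_fun_cderiv phi t x w (z : R[i]) : relopen_set O (t, x + z *: w) ->
  exists l, has_cderiv (fun z => section_fun phi t (x + z *: w)) z l.
Proof.
move=> Oz; have [_ /(_ t (relopen_fst Oz))[_ _ _ _ _ _ D] _] := E_valP phi.
have [|l lP] := D (x + z *: w) w; first by rewrite section_dom.
exists l => e e0; have := lP [set v | rnorm (v - l) < e].
move=> /(_ _)H; have {H} : nbhs (0 : R[i]^o)^' [set tau : R[i] | rnorm (
   tau^-1 *: (section_fun phi t (x + z *: w + tau *: w) - section_fun phi t (x + z *: w))
   - l) < e].
  by apply: H; apply/nbhs_rnormP; exists e.
move=> /nbhs_cabsP[d d0 H]; exists d => // u ud.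
have [->|u0] := eqVneq u 0.
  by rewrite addr0 subrr scale0r subr0 rnorm0 cabs0 mulr0.
have /= := H u; rewrite subr0 => /(_ ud u0) /ltW; rewrite -(ler_pM2l (_ : 0 < cabs u)).
  rewrite -rnormZ mulrC; apply: le_trans.
  rewrite le_eqVlt; apply/orP; left; apply/eqP; congr rnorm.
  have -> : x + (z + u) *: w = x + z *: w + u *: w by lin_coefs R[i] Pi; ring.
  by lin_coefs R[i] Pi; field.
by rewrite cabs_gt0.
Qed.

(** The mean value inequality along the segment from [w'] to [w]. Every point of
    the segment has distance at most [r] from the centre, so that Cauchy's
    estimate applies on a disc of radius [r / 2] about it in the complex line
    through the two points. *)
Lemma section_fun_lipschitz phi t x r M : 0 < r ->
  (forall w, rnorm w < 2 * r -> relopen_set O (t, x + w)) ->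
  (forall w, rnorm w < 2 * r -> rnorm (section_fun phi t (x + w)) <= M) ->
  forall w w', rnorm w <= r -> rnorm w' <= r ->
    rnorm (section_fun phi t (x + w) - section_fun phi t (x + w'))
      <= 4 * M / r * rnorm (w - w').
Proof.
move=> r0 Ow Mw w w' wr w'r.
have M0 : 0 <= M.
  by rewrite (le_trans (rnorm_ge0 (section_fun phi t (x + 0))))// Mw// rnorm0 mulr_gt0.
have [->|D0] := eqVneq w w'; first by rewrite !subrr rnorm0 mulr0.
set D := rnorm (w - w').
have {}D0 : 0 < D.
  rewrite lt0r rnorm_ge0 andbT; apply: contra D0 => /eqP D0.
  by rewrite -subr_eq0; apply/eqP/rnorm_le0; rewrite -/D D0.
pose f z := section_fun phi t (x + w' + z *: (w - w')).
have seg s : 0 <= s <= 1 -> rnorm (w' + s%:C *: (w - w')) <= r.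
  move=> /andP[s0 s1].
  have -> : w' + s%:C *: (w - w') = (1 - s)%:C *: w' + s%:C *: w.
    by lin_coefs R[i] Pi; ring.
  have := rnormD ((1 - s)%:C *: w') (s%:C *: w).
  rewrite !rnormZr !ger0_norm ?subr_ge0//.
  have := ler_wpM2l s0 wr; have : (1 - s) * rnorm w' <= (1 - s) * r.
    by rewrite ler_wpM2l// subr_ge0.
  lra.
have dom s z : 0 <= s <= 1 -> cabs z <= r / 2 / D ->
    rnorm (w' + (s%:C + z) *: (w - w')) < 2 * r.
  move=> s01; rewrite ler_pdivlMr// => zr.
  have -> : w' + (s%:C + z) *: (w - w') = (w' + s%:C *: (w - w')) + z *: (w - w').
    by lin_coefs R[i] Pi; ring.
  have := rnormD (w' + s%:C *: (w - w')) (z *: (w - w')); rewrite rnormZ -/D.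
  by have := seg s s01; lra.
have fd s z : 0 <= s <= 1 -> cabs z <= r / 2 / D -> exists l, has_cderiv f (s%:C + z) l.
  by move=> s01 zr; apply: section_fun_cderiv; rewrite -addrA; exact/Ow/dom.
have rD : 0 < r / 2 / D by rewrite !divr_gt0.
have /choice[g gP] s : exists l, 0 <= s <= 1 -> has_cderiv f (0 + s%:C * 1) l.
  have [s01|s01] := boolP (0 <= s <= 1); last by exists 0.
  have [|l lP] := fd s 0 s01; first by rewrite cabs0 ltW.
  by exists l; rewrite add0r mulr1; move: lP; rewrite addr0.
have := has_cderiv_line gP.
move=> /(@mean_value_primitive _ _ _ _ _ _ (4 * M / r * D)) MV.
have := MV _ 0 1; rewrite !lexx ler01 subr0 normr1 !mulr1 !add0r.
rewrite /f scale0r addr0 scale1r -[x + w' + _]addrA subrKC; apply=> // s s01.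
rewrite scale1r; have gs := gP s s01; move: gs; rewrite add0r mulr1 => gs.
have -> : 4 * M / r * D = 2 * M / (r / 2 / D).
  by field; rewrite !gt_eqF.
apply: (cauchy_estimate rD gs) => z zr; first exact: fd.
by rewrite /f -addrA; exact/Mw/dom.
Qed.

(** Both difference quotients are compared with the derivative in the direction
    [w] by means of [quadratic_remainder]; uniformity in [w] is what matters. *)
Lemma section_fun_quotients phi t x r M K : 0 < r -> 0 < K ->
  (forall w, rnorm w < 2 * r -> relopen_set O (t, x + w)) ->
  (forall w, rnorm w < 2 * r -> rnorm (section_fun phi t (x + w)) <= M) ->
  forall w (z z' : R[i]), rnorm w <= K -> z != 0 -> z' != 0 ->
    cabs z <= r / (4 * K) -> cabs z' <= r / (4 * K) ->
    rnorm (z^-1 *: (section_fun phi t (x + z *: w) - section_fun phi t x) -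
           z'^-1 *: (section_fun phi t (x + z' *: w) - section_fun phi t x))
      <= 2 * M / (r / (4 * K)) ^+ 2 * (cabs z + cabs z').
Proof.
move=> r0 K0 Ow Mw w z z' wK z0 z'0 zr z'r.
set q := r / (4 * K) in zr z'r *.
have q0 : 0 < q by rewrite divr_gt0// mulr_gt0.
pose f u := section_fun phi t (x + u *: w).
have dom u : cabs u <= 4 * q -> rnorm (u *: w) < 2 * r.
  have -> : 4 * q = r / K by rewrite /q; field; rewrite gt_eqF.
  rewrite ler_pdivlMr// rnormZ => uK.
  have := ler_wpM2l (cabs_ge0 u) wK; lra.
have fd u : cabs u <= 4 * q -> exists l, has_cderiv f u l.
  by move=> /dom uq; apply: section_fun_cderiv; exact: Ow.
have [|l lP] := fd 0; first by rewrite cabs0 mulr_ge0// ltW.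
have rem u : u != 0 -> cabs u <= q ->
    rnorm (u^-1 *: (f u - f 0) - l) <= 2 * M / q ^+ 2 * cabs u.
  move=> u0 uq.
  have := quadratic_remainder q0 fd (fun v vq => Mw _ (dom v vq)) lP uq.
  have cu : 0 < cabs u by rewrite cabs_gt0.
  have -> : f u - f 0 - u *: l = u *: (u^-1 *: (f u - f 0) - l).
    by lin_coefs R[i] Pi; field.
  by rewrite rnormZ expr2 mulrA mulrC ler_pM2r.
have f0 : section_fun phi t x = f 0 by rewrite /f scale0r addr0.
rewrite f0 -/(f z) -/(f z').
have := rnorm_tri l (z^-1 *: (f z - f 0)) (z'^-1 *: (f z' - f 0)).
rewrite [rnorm (l - _)]rnormB; have := rem z z0 zr; have := rem z' z'0 z'r.
lra.
Qed.

End right_hand_sides.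

(** * The spaces E and $C^1$ *)

Section C1.
Context {R : realType} {Pi : completeNormedModType R[i]} {t0 : R} {A : {posnum R}}.
Local Notation a := (t0 - A%:num).
Local Notation b := (t0 + A%:num).
Local Notation J := (ivl t0 A).
Implicit Types (Y Z : C1_space Pi t0 A) (t s e d : R).

#[local] Existing Instance ivl_dnbhs_proper.

Lemma ivlP t : J t <-> a <= t <= b.
Proof. by rewrite /ivl /= in_itv /=. Qed.

Lemma ivl_le (t : J) : a <= val t <= b.
Proof. by apply: (proj1 (ivlP (val t))); exact: (set_valP t). Qed.

Definition ivl_pt t (tab : a <= t <= b) : J :=
  exist _ t (mem_set (proj2 (ivlP t) tab)).

Lemma ivl_nbhsP (t : J) (P : set J) : nbhs t P <->
  exists2 e, 0 < e & forall s : J, `|val s - val t| < e -> P s.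
Proof.
split=> [[_ [[U oU <-] /= Ut] UP]|[e e0 eP]].
  have /nbhs_ballP[e /= e0 eU] : nbhs (val t) U by exact: open_nbhs_nbhs.
  exists e => // s st; apply: UP; apply: eU.
  by rewrite /= -ball_normE /= distrC.
have vt : (val : J -> R) @ t --> val t by exact: initial_continuous.
have Ft : Filter (nbhs t) by exact: nbhs_filter.
move/cvgrPdist_lt : vt => /(_ _ e0); apply: filterS => s.
by rewrite /= distrC; exact: eP.
Qed.

(** Elements of $C^1$ as functions on the whole line, to which the calculus of
    curves applies. *)
Definition curve (y : J -> Pi) : R -> Pi := valL_ 0 y.

Lemma curve_val (y : J -> Pi) (t : J) : curve y (val t) = y t.
Proof. exact: (congr1 (fun f => f t) (valLK 0 y)). Qed.

Lemma curve_pt (y : J -> Pi) t (tab : a <= t <= b) : curve y t = y (ivl_pt tab).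
Proof. exact: (curve_val y (ivl_pt tab)). Qed.

Lemma curve_continuous (y : J -> Pi) : continuous y -> continuous_curve a b (curve y).
Proof.
move=> yc t tab e e0.
have := yc (ivl_pt tab) [set v | rnorm (v - y (ivl_pt tab)) < e].
case/(_ _)/ivl_nbhsP; first by apply/nbhs_rnormP; exists e.
move=> d d0 H; exists d => // s sab sd.
by rewrite (curve_pt y sab) (curve_pt y tab); exact/ltW/H.
Qed.

Lemma C1_primitive Y : primitive a b (curve Y) (curve (ivl_deriv Y)).
Proof.
move=> e e0 t tab; have [/(_ (ivl_pt tab)) Yd _] := C1_valP Y.
have := Yd [set v | rnorm (v - ivl_deriv Y (ivl_pt tab)) < e].
case/(_ _)/ivl_nbhsP; first by apply/nbhs_rnormP; exists e.
move=> d d0 H; exists d => // s sab sd.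
have [st|st] := eqVneq s t.
  by rewrite st !subrr scale0r subr0 rnorm0 normr0 mulr0.
rewrite (curve_pt _ sab) !(curve_pt _ tab).
have := H (ivl_pt sab) sd; rewrite -val_eqE => /(_ st) /ltW.
rewrite /= /diff_quotient /= => h.
have st0 : (s - t)%:C != 0 :> R[i].
  by rewrite fmorph_eq0 subr_eq0.
have -> : Y (ivl_pt sab) - Y (ivl_pt tab) - (s - t)%:C *: ivl_deriv Y (ivl_pt tab) =
    (s - t)%:C *: (((s - t)^-1)%:C *: (Y (ivl_pt sab) - Y (ivl_pt tab))
      - ivl_deriv Y (ivl_pt tab)).
  rewrite fmorphV /=; move: ((s - t)%:C) st0 => z z0.
  by lin_coefs R[i] Pi; field.
by rewrite rnormZr mulrC ler_wpM2r.
Qed.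

Lemma C1_deriv_continuous Y : continuous_curve a b (curve (ivl_deriv Y)).
Proof. by apply: curve_continuous; have [] := C1_valP Y. Qed.

(** Restriction to the interval turns derivatives of curves into the one-sided
    notion at the endpoints. *)
Lemma C1_of_primitive (y v : R -> Pi) : primitive a b y v -> continuous_curve a b v ->
  exists Y : C1_space Pi t0 A, (forall t : J, Y t = y (val t)) /\
    (forall t : J, ivl_deriv Y t = v (val t)).
Proof.
move=> yv vc; pose y' (t : J) := y (val t).
have dy (t : J) : diff_quotient y' t @ t^' --> v (val t).
  move=> U /nbhs_rnormP[e e0 eU].
  have e20 : 0 < e / 2 by rewrite divr_gt0.
  have [d d0 H] := yv _ e20 _ (ivl_le t).
  apply/ivl_nbhsP; exists d => // s st sn; apply: eU.
  have {}sn : val s - val t != 0.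
    by rewrite subr_eq0; apply: contra sn => /eqP/val_inj ->.
  have n0 : 0 < `|val s - val t| by rewrite normr_gt0.
  apply: (@le_lt_trans _ _ (e / 2)); last by move: e0; lra.
  have := H _ (ivl_le s) st; rewrite mulrC -ler_pdivrMl//; apply: le_trans.
  rewrite le_eqVlt; apply/orP; left; apply/eqP.
  rewrite -[`|_|^-1]ger0_norm ?invr_ge0// -normfV normr_id -rnormZr; congr rnorm.
  have sn' : (val s - val t)%:C != 0 :> R[i].
    by rewrite fmorph_eq0.
  rewrite /diff_quotient /y' !fmorphV /=; move: ((val s - val t)%:C) sn' => z z0.
  by lin_coefs R[i] Pi; field.
have dE : ivl_deriv y' = fun t : J => v (val t).
  by apply/funext => t; apply: cvg_lim; [exact: norm_hausdorff|exact: dy].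
have y'C : y' \in C1pred (A := A).
  rewrite inE; split=> [t|]; first by apply/cvg_ex; exists (v (val t)); exact: dy.
  rewrite dE => t U /nbhs_rnormP[e e0 eU].
  have e20 : 0 < e / 2 by rewrite divr_gt0.
  have [d d0 H] := vc _ (ivl_le t) _ e20.
  apply/ivl_nbhsP; exists d => // s st; apply: eU.
  by have := H _ (ivl_le s) st; move: e0; lra.
by exists (MkC1 y'C); split=> // t; rewrite -[ivl_deriv _]/(ivl_deriv y') dE.
Qed.

Lemma C1_ext Y Z : (forall t : J, Y t = Z t) -> Y = Z.
Proof. by move=> YZ; apply: val_inj; apply/funext. Qed.

Lemma C1_derivB Y Z (t : J) :
  ivl_deriv (Y - Z : C1_space Pi t0 A) t = ivl_deriv Y t - ivl_deriv Z t.
Proof.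
rewrite (_ : Y - Z = (-1) *: Z + Y); last by rewrite scaleN1r addrC.
by rewrite C1_deriv_lin scaleN1r addrC.
Qed.

Lemma C1_nbhsP Y (U : set (C1_space Pi t0 A)) : nbhs Y U <->
  exists2 e, 0 < e & forall Z, (forall t : J, rnorm (Z t - Y t) < e /\
    rnorm (ivl_deriv Z t - ivl_deriv Y t) < e) -> U Z.
Proof.
split=> [[_ [V /nbhs_rnormP[e e0 eV] ->] VU]|[e e0 eU]].
  exists e => // Z ZY; rewrite -(subrKC Y Z); apply: VU => t.
  by have [z1 z2] := ZY t; rewrite C1_derivB; split; apply: eV; rewrite subr0.
exists (C1zero_nbhs [set v | rnorm v < e]).
  by exists [set v | rnorm v < e] => //; apply/nbhs_rnormP; exists e => // w; rewrite subr0.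
move=> Z Ze; apply: eU => t; have [z1 z2] := Ze t.
by rewrite -C1_derivB [Y + Z]addrC addrK; split=> //; rewrite addrK.
Qed.

Lemma C1_hausdorff : hausdorff_space (C1_space Pi t0 A).
Proof.
move=> Y Z YZ; apply: C1_ext => t; apply/eqP; rewrite -subr_eq0.
apply/eqP/rnorm_le0/rnorm_le_eps => e e0; rewrite add0r.
have e20 : 0 < e / 2 by rewrite divr_gt0.
have [||W [W1 W2]] := YZ [set W | rnorm (W t - Y t) < e / 2]
    [set W | rnorm (W t - Z t) < e / 2].
- by apply/C1_nbhsP; exists (e / 2) => // W /(_ t)[].
- by apply/C1_nbhsP; exists (e / 2) => // W /(_ t)[].
move: W1 W2 => /=; have := rnorm_tri (W t) (Y t) (Z t).
by rewrite [rnorm (Y t - W t)]rnormB; lra.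
Qed.

Lemma uniform_limit_continuous (v : nat -> R -> Pi) (w : R -> Pi) :
  (forall n, continuous_curve a b (v n)) ->
  (forall e, 0 < e -> exists n, forall t, a <= t <= b -> rnorm (v n t - w t) <= e) ->
  continuous_curve a b w.
Proof.
move=> vc vw t tab e e0; have e30 : 0 < e / 3 by rewrite divr_gt0.
have [n H] := vw _ e30; have [d d0 Hd] := vc n t tab _ e30.
exists d => // s sab sd.
have := Hd s sab sd; have := H s sab; have := H t tab.
have := rnorm_tri (v n s) (w s) (w t); have := rnorm_tri (v n t) (v n s) (w t).
by rewrite [rnorm (w s - v n s)]rnormB; lra.
Qed.

Lemma C1_complete (u : nat -> C1_space Pi t0 A) :
  (forall e, 0 < e -> exists N, forall m n, (N <= m)%N -> (N <= n)%N -> forall t : J,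
     rnorm (u m t - u n t) <= e /\ rnorm (ivl_deriv (u m) t - ivl_deriv (u n) t) <= e) ->
  exists Y, forall e, 0 < e -> exists N, forall n, (N <= n)%N -> forall t : J,
    rnorm (u n t - Y t) <= e /\ rnorm (ivl_deriv (u n) t - ivl_deriv Y t) <= e.
Proof.
move=> uC.
have lim (t : R) : exists l, forall tab : a <= t <= b, forall e, 0 < e -> exists N,
    forall n, (N <= n)%N -> rnorm (ivl_deriv (u n) (ivl_pt tab) - l) <= e.
  have [tab|ntab] := pselect (a <= t <= b); last by exists 0 => tab; case: (ntab tab).
  have [|l lP] := @rnorm_complete _ _ (fun n => ivl_deriv (u n) (ivl_pt tab)).
    by move=> e /uC[N HN]; exists N => m n Nm Nn; have [] := HN m n Nm Nn (ivl_pt tab).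
  by exists l => tab'; rewrite (Prop_irrelevance tab' tab).
have [w wP] := choice lim.
have uw e : 0 < e -> exists N, forall n, (N <= n)%N -> forall t, a <= t <= b ->
    rnorm (curve (ivl_deriv (u n)) t - w t) <= e.
  move=> e0; have [N HN] := uC e e0; exists N => n Nn t tab.
  rewrite (curve_pt _ tab).
  apply: rnorm_le_eps => h h0; have [N' HN'] := wP t tab h h0.
  have := HN' (maxn N N') (leq_maxr _ _).
  have [_] := HN n (maxn N N') Nn (leq_maxl _ _) (ivl_pt tab).
  have := rnorm_tri (ivl_deriv (u (maxn N N')) (ivl_pt tab))
    (ivl_deriv (u n) (ivl_pt tab)) (w t).
  lra.
have t0ab : a <= t0 <= b by apply/ivlP; have := ivl_center_subproof t0 A; rewrite inE.
have [||G Gw uG] := @near_primitive_limit _ _ a b t0 (fun n => curve (u n)) w t0ab.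
- move=> e e0; have e20 : 0 < e / 2 by rewrite divr_gt0.
  have [N HN] := uw _ e20; exists N => n Nn; rewrite [e]splitr.
  exact: near_primitive_close (C1_primitive (u n) e20) (HN n Nn).
- move=> e e0; have [N HN] := uC e e0; exists N => m n Nm Nn.
  by have [+ _] := HN m n Nm Nn (ivl_center t0 A); rewrite -!curve_val.
have wc : continuous_curve a b w.
  apply: (uniform_limit_continuous (fun n => C1_deriv_continuous (u n))).
  by move=> e /uw[N HN]; exists N; exact: HN.
have [Y [YG Yw]] := C1_of_primitive Gw wc; exists Y => e e0.
have [N HN] := uG e e0; have [N' HN'] := uw e e0.
exists (maxn N N') => n; rewrite geq_max => /andP[Nn N'n] t.
rewrite YG Yw; split.
  by have := HN n Nn _ (ivl_le t); rewrite curve_val.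
by have := HN' n N'n _ (ivl_le t); rewrite curve_val.
Qed.

(** A bounded disk is bounded in the norm of $C^1$, hence Mackey-Cauchy sequences
    are Cauchy. *)
Lemma C1_mackey_complete : mackey_complete (C1_space Pi t0 A).
Proof.
move=> u [B [Bb _ Bu]].
have [|r r0 Br] := Bb [set Z | forall t : J, rnorm (Z t) <= 1 /\ rnorm (ivl_deriv Z t) <= 1].
  apply/C1_nbhsP; exists 1 => // Z Z1 t; have [] := Z1 t.
  by rewrite -C1_derivB !subr0 => /ltW ? /ltW.
have [|Y YP] := @C1_complete u.
  move=> e e0; have er : 0 < e%:C / r by rewrite divr_gt0// ltcR.
  have [N HN] := Bu _ er; exists N => m n Nm Nn t.
  have [_ /Br[Z Z1 <-]] := HN m n Nm Nn.
  rewrite scalerA divfK ?gt_eqF// => uE; have [z1 z2] := Z1 t.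
  rewrite -C1_derivB -[u m t - u n t]/((u m - u n) t) uE C1_deriv_scale !rnormZr.
  by rewrite gtr0_norm//; split; rewrite -[leRHS]mulr1 ler_pM2l.
exists Y => U /C1_nbhsP[e e0 eU].
have e20 : 0 < e / 2 by rewrite divr_gt0.
have [N HN] := YP _ e20; exists N => // n Nn; apply: eU => t.
by have [] := HN n Nn t; move: e0; lra.
Qed.

End C1.

Section E.
Context {R : realType} {Pi : completeNormedModType R[i]} {I : set R}.
Context {O : relopen (I `*` [set: Pi])}.
Implicit Types (phi psi : E_space O) (e : R).

Lemma E_nbhs phi B e : Ebornology O B -> 0 < e ->
  nbhs phi [set psi | forall p, B p ->
    rnorm (section_fun psi p.1 p.2 - section_fun phi p.1 p.2) < e].
Proof.
move=> BB e0; exists (Ezero_nbhs (O := O) B [set v | rnorm v < e]).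
  exists B, [set v | rnorm v < e]; split=> //.
  by apply/nbhs_rnormP; exists e => // w; rewrite subr0.
move=> psi psiB /= p Bp; have [BO _ _] := BB.
rewrite -section_funB addrC addKr.
have Op : relopen_set O (p.1, p.2) by rewrite -surjective_pairing; exact: BO.
rewrite (section_fun_val psi Op); apply: psiB.
by exists (relopen_pt Op) => //; change (B (p.1, p.2)); rewrite -surjective_pairing.
Qed.

Lemma Ebornology_point p : relopen_set O p -> Ebornology O [set p].
Proof.
move=> Op; split; first by move=> _ ->.
  apply/bounded_setP; exists (`|p.2| + 1); first by rewrite ltr_wpDl.
  by move=> _ [_ -> <-]; rewrite lerDl.
have [d d0 H] := relopen_near Op; exists [set w | rnorm w < d].
  by apply/nbhs_rnormP; exists d => // w; rewrite subr0.
move=> _ w -> wd; apply: H => /=; first exact: relopen_fst Op.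
  by rewrite subrr normr0.
by rewrite addrC addKr.
Qed.

(** Singletons belong to the bornology, so the topology of [E_space] is finer
    than that of pointwise convergence. *)
Lemma E_hausdorff : hausdorff_space (E_space O).
Proof.
move=> phi psi pp; apply: val_inj; apply/funext => p.
have Op : relopen_set O (val p) by exact: set_valP.
apply/eqP; rewrite -subr_eq0; apply/eqP/rnorm_le0/rnorm_le_eps => e e0.
rewrite add0r; have e20 : 0 < e / 2 by rewrite divr_gt0.
have [x []] := pp _ _ (E_nbhs phi (Ebornology_point Op) e20)
  (E_nbhs psi (Ebornology_point Op) e20).
move=> /(_ _ erefl) h1 /(_ _ erefl) h2.
have Op' : relopen_set O ((val p).1, (val p).2) by rewrite -surjective_pairing.
have pE : relopen_pt Op' = p by apply: val_inj; rewrite /= -surjective_pairing.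
move: h1 h2; rewrite !(section_fun_val _ Op') pE.
have := rnorm_tri (x p) (phi p) (psi p).
rewrite [rnorm (phi p - x p)]rnormB -[E_fun phi p]/(val phi p) -[E_fun psi p]/(val psi p).
by lra.
Qed.

End E.

(** * The initial value problem *)

Section retraction.
Context {R : realType} {Pi : completeNormedModType R[i]}.
Implicit Types (v w : Pi) (r : R).

Definition ball_retract r v : Pi :=
  if rnorm v <= r then v else (r / rnorm v)%:C *: v.

Lemma ball_retract_id r v : rnorm v <= r -> ball_retract r v = v.
Proof. by rewrite /ball_retract => ->. Qed.

Lemma ball_retract_le r v : 0 <= r -> rnorm (ball_retract r v) <= r.
Proof.
move=> r0; rewrite /ball_retract; case: ifPn => // vr.
have v0 : 0 < rnorm v by rewrite (le_lt_trans r0)// ltNge.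
have rv0 : 0 <= r / rnorm v by rewrite divr_ge0// ltW.
by rewrite rnormZr ger0_norm// divfK ?gt_eqF.
Qed.

Lemma ball_retract_contract r v : 0 <= r -> rnorm (ball_retract r v) <= rnorm v.
Proof.
move=> r0; have := ball_retract_le v r0; rewrite /ball_retract; case: ifPn => // vr.
by move=> /le_trans; apply; rewrite ltW// ltNge.
Qed.

Lemma ball_retract_lipschitz r v w : 0 <= r ->
  rnorm (ball_retract r v - ball_retract r w) <= 2 * rnorm (v - w).
Proof.
move=> r0.
suff H v' w' : rnorm v' <= rnorm w' ->
    rnorm (ball_retract r v' - ball_retract r w') <= 2 * rnorm (v' - w').
  have [vw|/ltW wv] := leP (rnorm v) (rnorm w); first exact: H.
  by rewrite rnormB [rnorm (v - w)]rnormB; exact: H.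
move: v' w' => {}v {}w vw; rewrite /ball_retract.
have d0 := rnorm_ge0 (v - w).
have wv : rnorm w - rnorm v <= rnorm (v - w).
  by have := rnorm_shift w v; rewrite rnormB; lra.
case: ifPn => [vr|]; case: ifPn => [wr|].
- by move=> *; lra.
- rewrite -ltNge => rw; have w0 : 0 < rnorm w by rewrite (le_lt_trans r0).
  have -> : v - (r / rnorm w)%:C *: w = (v - w) + (1 - r / rnorm w)%:C *: w.
    by lin_coefs R[i] Pi; ring.
  have := rnormD (v - w) ((1 - r / rnorm w)%:C *: w); rewrite rnormZr.
  rewrite ger0_norm ?subr_ge0 ?ler_pdivrMr ?mul1r ?(ltW rw)//.
  by rewrite mulrBl mul1r divfK ?gt_eqF//; lra.
- by rewrite -ltNge; lra.
- rewrite -!ltNge => rw rv; have w0 : 0 < rnorm w by rewrite (le_lt_trans r0).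
  have v0 : 0 < rnorm v by rewrite (le_lt_trans r0).
  have -> : (r / rnorm v)%:C *: v - (r / rnorm w)%:C *: w =
      (r / rnorm v)%:C *: (v - w) + (r / rnorm v - r / rnorm w)%:C *: w.
    by lin_coefs R[i] Pi; ring.
  have := rnormD ((r / rnorm v)%:C *: (v - w)) ((r / rnorm v - r / rnorm w)%:C *: w).
  have rv1 : r / rnorm v <= 1 by rewrite ler_pdivrMr// mul1r ltW.
  have rv0 : 0 <= r / rnorm v by rewrite divr_ge0// ltW.
  have rwv : r / rnorm w <= r / rnorm v.
    by rewrite ler_wpM2l// lef_pV2.
  rewrite !rnormZr !ger0_norm ?subr_ge0//.
  have -> : (r / rnorm v - r / rnorm w) * rnorm w =
      r / rnorm v * (rnorm w - rnorm v).
    by field; rewrite !gt_eqF.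
  have wv0 : 0 <= rnorm w - rnorm v by rewrite subr_ge0.
  have := ler_wpM2r d0 rv1; have := ler_wpM2r wv0 rv1; lra.
Qed.

End retraction.

Section ivp.
Context {R : realType} {Pi : completeNormedModType R[i]} {t0 : R} {A : {posnum R}}.
Context {O : relopen (ivl t0 A `*` [set: Pi])}.
Local Notation a := (t0 - A%:num).
Local Notation b := (t0 + A%:num).
Local Notation J := (ivl t0 A).
Implicit Types (phi psi : E_space O) (xi : Pi) (y z : R -> Pi) (t s r q M K : R).

Definition solves xi phi y :=
  [/\ forall t, a <= t <= b -> relopen_set O (t, y t),
      primitive a b y (fun t => section_fun phi t (y t)) & y t0 = xi].

Lemma ab_mid : a <= t0 <= b.
Proof. by apply/ivlP; have := ivl_center_subproof t0 A; rewrite inE. Qed.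

Lemma ab_le : a <= b.
Proof. by have /andP[/le_trans] := ab_mid; apply. Qed.

Lemma ivp_deriv xi phi (Y : C1_space Pi t0 A) : ivp_solution xi phi Y ->
  forall t : J, ivl_deriv Y t = section_fun phi (val t) (Y t).
Proof. by move=> [YO [Yd _]] t; rewrite Yd (section_fun_val phi (YO t)). Qed.

Lemma ivp_solves xi phi (Y : C1_space Pi t0 A) :
  ivp_solution xi phi Y -> solves xi phi (curve Y).
Proof.
move=> sol; have Yd := ivp_deriv sol; have [YO [_ Y0]] := sol; split.
- by move=> t tab; rewrite (curve_pt _ tab); exact: (YO (ivl_pt tab)).
- apply: primitive_ext (C1_primitive Y) => // t tab.
  by rewrite !(curve_pt _ tab) Yd.
- by rewrite -Y0 -(curve_val Y).
Qed.

Lemma solves_ivp xi phi y : solves xi phi y ->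
  exists Y : C1_space Pi t0 A, ivp_solution xi phi Y /\ forall t : J, Y t = y (val t).
Proof.
move=> [yO yd y0].
have yc := primitive_continuous yd.
have [Y [Yy Yd]] := C1_of_primitive yd (section_fun_curve_continuous phi yO yc).
have YO (t : J) : relopen_set O (val t, Y t) by rewrite Yy; apply/yO/ivl_le.
exists Y; split=> //; exists YO; split; last by rewrite Yy.
by move=> t; rewrite Yd -Yy (section_fun_val phi (YO t)).
Qed.

Definition tube y r : set (R * Pi) :=
  [set p | a <= p.1 <= b /\ rnorm (p.2 - y p.1) < r].

Lemma tube_pt y r t (w : Pi) : a <= t <= b -> rnorm w < r -> tube y r (t, y t + w).
Proof. by move=> tab wr; split=> //=; rewrite addrC addKr. Qed.

(** The radius is chosen such that [O] even contains the tube of radius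
    [4 * r]: a member of the bornology stays in [O] under small shifts. *)
Lemma tube_bornology y : continuous_curve a b y ->
  (forall t, a <= t <= b -> relopen_set O (t, y t)) ->
  exists2 r, 0 < r & Ebornology O (tube y (2 * r)).
Proof.
move=> yc yO.
have [|t ta tb|r r0 rO] := @uniform_on_segment _ a b
  (fun r t => forall w, rnorm w < 4 * r -> relopen_set O (t, y t + w)) ab_le.
- by move=> r r' t H r'0 rr' w wr; apply: H; rewrite (lt_le_trans wr)// ler_pM2l.
- have tab : a <= t <= b by rewrite ta.
  have [d d0 H] := relopen_near (yO t tab).
  have d20 : 0 < d / 2 by rewrite divr_gt0.
  have [d' d'0 H'] := yc t tab _ d20.
  exists (d / 8), (Num.min d d'); split; [by rewrite divr_gt0|by rewrite lt_min d0|].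
  move=> s as_ sb; rewrite lt_min => /andP[sd sd'] w wd.
  have sab : a <= s <= b by rewrite as_.
  apply: H; [exact: (proj2 (ivlP s) sab)|exact: sd|rewrite /=].
  have := rnormD (y s - y t) w; rewrite addrAC; have := H' s sab sd'; lra.
exists r => //; split.
- move=> [t x] [/= /andP[ta tb] xr]; rewrite -(subrKC (y t) x); apply: rO => //.
  by lra.
- have [K K0 yK] := continuous_curve_bounded ab_le yc.
  apply/bounded_setP; exists (K + 2 * r)%:C; first by rewrite ltcR addr_gt0// mulr_gt0.
  move=> _ [[t x] [/= tab xr] <-] /=; rewrite -rnormE lecR.
  by have := rnorm_shift x (y t); have := yK t tab; lra.
- exists [set w | rnorm w < 2 * r].
    by apply/nbhs_rnormP; exists (2 * r); [rewrite mulr_gt0|move=> w; rewrite subr0].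
  move=> [t x] w [/= /andP[ta tb] xr] /= wr.
  rewrite -(subrKC (y t) x) -addrA; apply: rO => //.
  by have := rnormD (x - y t) w; lra.
Qed.

Lemma tube_lipschitz phi y r M : 0 < r -> tube y (2 * r) `<=` relopen_set O ->
  (forall p, tube y (2 * r) p -> rnorm (section_fun phi p.1 p.2) <= M) ->
  forall t (w w' : Pi), a <= t <= b -> rnorm w <= r -> rnorm w' <= r ->
    rnorm (section_fun phi t (y t + w) - section_fun phi t (y t + w'))
      <= 4 * M / r * rnorm (w - w').
Proof.
move=> r0 yO yM t w w' tab; apply: section_fun_lipschitz => // v vr.
  by apply: yO; exact: tube_pt.
by apply: (yM (t, y t + v)); exact: tube_pt.
Qed.

(** Composition with the radial retraction onto the tube of radius [r] makes the
    right hand side globally Lipschitz. A solution that stays in this tube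
    solves the original equation. *)
Lemma truncated_solution phi y r M xi : continuous_curve a b y -> 0 < r ->
  tube y (2 * r) `<=` relopen_set O ->
  (forall p, tube y (2 * r) p -> rnorm (section_fun phi p.1 p.2) <= M) ->
  exists2 z, primitive a b z (fun t =>
    section_fun phi t (y t + ball_retract r (z t - y t))) & z t0 = xi.
Proof.
move=> yc r0 yO yM; have lip := tube_lipschitz r0 yO yM.
have M0 : 0 <= M.
  apply: le_trans (rnorm_ge0 _) (yM (t0, y t0 + 0) _).
  by apply: tube_pt ab_mid _; rewrite rnorm0 mulr_gt0.
have rr (v : Pi) : rnorm (ball_retract r v) <= r by apply: ball_retract_le; exact: ltW.
pose L := 4 * M / r * 2.
have L0 : 0 <= 4 * M / r by rewrite divr_ge0 ?mulr_ge0// ltW.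
apply: (@ode_exists _ _ t0 A%:num L
  (fun t x => section_fun phi t (y t + ball_retract r (x - y t)))) => //.
- by rewrite /L mulr_ge0.
- move=> t x x' tab /=.
  apply: (le_trans (lip t _ _ tab (rr (x - y t)) (rr (x' - y t)))).
  rewrite /L -[_ * 2 * _]mulrA ler_wpM2l//.
  by rewrite (le_trans (ball_retract_lipschitz _ _ (ltW r0)))// opprB addrA subrK.
- move=> z zc; apply: section_fun_curve_continuous => [t tab|t tab e e0].
    by apply/yO/tube_pt => //; have := rr (z t - y t); lra.
  have e50 : 0 < e / 5 by rewrite divr_gt0.
  have [d d0 H] := yc t tab _ e50; have [d' d'0 H'] := zc t tab _ e50.
  exists (Num.min d d'); first by rewrite lt_min d0.
  move=> s sab; rewrite lt_min => /andP[sd sd'].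
  have := H s sab sd; have := H' s sab sd'.
  have := ball_retract_lipschitz (z s - y s) (z t - y t) (ltW r0).
  have -> : z s - y s - (z t - y t) = (z s - z t) - (y s - y t).
    by lin_coefs R[i] Pi; ring.
  have -> : y s + ball_retract r (z s - y s) - (y t + ball_retract r (z t - y t)) =
    (y s - y t) + (ball_retract r (z s - y s) - ball_retract r (z t - y t)).
    by lin_coefs R[i] Pi; ring.
  have := rnormD (y s - y t) (ball_retract r (z s - y s) - ball_retract r (z t - y t)).
  have := rnormBD (z s - z t) (y s - y t).
  by have := rnorm_ge0 (z s - z t); lra.
Qed.

(** The difference of two solutions obeys a homogeneous linear differential
    inequality as long as it is bounded by the radius of a tube around the first
    one; [gronwall] applies with an arbitrarily small initial bound [q]. *)
Lemma solves_unique xi phi y z : solves xi phi y -> solves xi phi z ->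
  forall t, a <= t <= b -> y t = z t.
Proof.
move=> [yO yd y0] [zO zd z0] t tab.
have [r r0 rB] := tube_bornology (primitive_continuous yd) yO.
have [M M0 yM] := section_fun_bounded phi rB; have [rO _ _] := rB.
have lip := tube_lipschitz r0 rO yM.
pose L := 4 * M / r; pose C := expR ((L + 2) * A%:num).
have L0 : 0 <= L by rewrite divr_ge0 ?mulr_ge0// ltW.
have C0 : 0 < C by exact: expR_gt0.
apply/eqP; rewrite -subr_eq0; apply/eqP/rnorm_le0/rnorm_le_eps => e e0.
rewrite add0r rnormB; pose q := Num.min (e / C) (r / C).
have q0 : 0 < q by rewrite lt_min !divr_gt0.
have qe : q * C <= e by rewrite -ler_pdivlMr// ge_min lexx.
have qr : q * C <= r by rewrite -ler_pdivlMr// ge_min lexx orbT.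
apply: (le_trans (gronwall L0 q0 (primitiveB zd yd) _ qr _ tab)) => //.
  by rewrite z0 y0 subrr rnorm0 ltW.
move=> s sab dr; have := lip s (z s - y s) 0 sab dr.
by rewrite rnorm0 addr0 subr0 subrKC => /(_ (ltW r0)); rewrite -/L; lra.
Qed.

(** On the tube [psi] is bounded by [M + 1], which determines its Lipschitz
    constant [L]. The solution of the truncated equation differs from [y] by at
    most [q * C] by [gronwall], so the truncation is not felt. *)
Lemma solution_near xi phi y r M : solves xi phi y -> 0 < r -> 0 <= M ->
  tube y (2 * r) `<=` relopen_set O ->
  (forall p, tube y (2 * r) p -> rnorm (section_fun phi p.1 p.2) <= M) ->
  let L := 4 * (M + 1) / r in let C := expR ((L + 2) * A%:num) in
  forall q xi' psi, 0 < q -> q <= 1 -> q * C <= r -> rnorm (xi' - xi) <= q ->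
  (forall p, tube y (2 * r) p ->
     rnorm (section_fun psi p.1 p.2 - section_fun phi p.1 p.2) <= q) ->
  exists2 z, solves xi' psi z & forall t, a <= t <= b ->
    rnorm (z t - y t) <= q * C /\
    rnorm (section_fun psi t (z t) - section_fun phi t (y t)) <= (L * C + 1) * q.
Proof.
move=> [yO yd y0] r0 M0 rO yM L C q xi' psi q0 q1 qr xiq psiq.
have psiM p : tube y (2 * r) p -> rnorm (section_fun psi p.1 p.2) <= M + 1.
  move=> yp; have := rnorm_shift (section_fun psi p.1 p.2) (section_fun phi p.1 p.2).
  by have := psiq p yp; have := yM p yp; lra.
have lip := tube_lipschitz r0 rO psiM.
have L0 : 0 <= L by rewrite divr_ge0 ?mulr_ge0 ?addr_ge0// ltW.
have [z zd z0] := truncated_solution xi' (primitive_continuous yd) r0 rO psiM.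
have vel t : a <= t <= b ->
    rnorm (section_fun psi t (y t + ball_retract r (z t - y t))
      - section_fun phi t (y t)) <= L * rnorm (z t - y t) + q.
  move=> tab.
  have := rnorm_tri (section_fun psi t (y t + 0))
    (section_fun psi t (y t + ball_retract r (z t - y t))) (section_fun phi t (y t)).
  have := lip t (ball_retract r (z t - y t)) 0 tab (ball_retract_le _ (ltW r0)).
  rewrite rnorm0 subr0 -/L => /(_ (ltW r0)).
  have := psiq (t, y t + 0); rewrite /= addr0 => /(_ _)h.
  have := h ltac:(by split=> //=; rewrite subrr rnorm0 mulr_gt0).
  have := ler_wpM2l L0 (ball_retract_contract (z t - y t) (ltW r0)).
  by lra.
have dist t : a <= t <= b -> rnorm (z t - y t) <= q * C.
  apply: (gronwall L0 q0 (primitiveB zd yd) _ qr) => [|s sab _]; last exact: vel.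
  by rewrite z0 y0.
have zr t : a <= t <= b -> ball_retract r (z t - y t) = z t - y t.
  by move=> tab; rewrite ball_retract_id// (le_trans (dist t tab)).
exists z; last first.
  move=> t tab; split; first exact: dist.
  have := vel t tab; rewrite zr// subrKC => /le_trans; apply.
  by have := ler_wpM2l L0 (dist t tab); lra.
split=> // [t tab|].
  rewrite -(subrKC (y t) (z t)); apply/rO/tube_pt => //.
  by have := dist t tab; lra.
by apply: primitive_ext zd => // t tab; rewrite zr// subrKC.
Qed.

End ivp.

Section solution_map.
Context {R : realType} {Pi : completeNormedModType R[i]} {t0 : R} {A : {posnum R}}.
Context {O : relopen (ivl t0 A `*` [set: Pi])}.
Local Notation a := (t0 - A%:num).
Local Notation b := (t0 + A%:num).
Local Notation J := (ivl t0 A).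
Local Notation C1 := (C1_space Pi t0 A).
Implicit Types (phi psi : E_space O) (xi : Pi) (y z : R -> Pi) (t s r q M K : R).

(** The difference of the two difference quotients of the solutions obeys a linear
    differential inequality, whose inhomogeneous part is of the order of
    [cabs u + cabs u'] by [section_fun_quotients]. It vanishes at [t0], so that
    [gronwall] gives the bound. *)
Lemma quotients_near xi eta phi psi y r M K : solves xi phi y -> 0 < r -> 0 <= M ->
  @tube _ _ t0 A y (2 * r) `<=` relopen_set O ->
  (forall p, @tube _ _ t0 A y (2 * r) p -> rnorm (section_fun phi p.1 p.2) <= M) ->
  (forall p, @tube _ _ t0 A y (2 * r) p -> rnorm (section_fun psi p.1 p.2) <= M) ->
  0 < K -> exists2 C, 0 <= C & forall (u u' : R[i]) z z',
    u != 0 -> u' != 0 -> cabs u <= r / (4 * K) -> cabs u' <= r / (4 * K) ->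
    solves (xi + u *: eta) (u *: psi + phi) z ->
    solves (xi + u' *: eta) (u' *: psi + phi) z' ->
    (forall t, a <= t <= b -> rnorm (z t - y t) <= K * cabs u) ->
    (forall t, a <= t <= b -> rnorm (z' t - y t) <= K * cabs u') ->
    forall t, a <= t <= b ->
    rnorm (u^-1 *: (z t - y t) - u'^-1 *: (z' t - y t)) <= C * (cabs u + cabs u') /\
    rnorm (u^-1 *: (section_fun (u *: psi + phi) t (z t) - section_fun phi t (y t)) -
           u'^-1 *: (section_fun (u' *: psi + phi) t (z' t) - section_fun phi t (y t)))
      <= C * (cabs u + cabs u').
Proof.
move=> [yO yd y0] r0 M0 rO phiM psiM K0.
have lip := tube_lipschitz r0 rO phiM; have lip' := tube_lipschitz r0 rO psiM.
set L := 4 * M / r in lip lip' *.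
have L0 : 0 <= L by rewrite divr_ge0 ?mulr_ge0// ltW.
pose C2 := 2 * M / (r / (4 * K)) ^+ 2.
have rK0 : 0 < r / (4 * K) by rewrite divr_gt0// mulr_gt0.
have C20 : 0 <= C2 by apply: divr_ge0; [exact: mulr_ge0|exact: sqr_ge0].
pose Q := C2 + L * K + 1; pose E := expR ((L + 2) * A%:num).
have Q0 : 0 < Q by rewrite ltr_wpDl// addr_ge0// mulr_ge0// ltW.
have E0 : 0 < E by exact: expR_gt0.
have QE0 : 0 < Q * E by rewrite mulr_gt0.
have LQE0 : 0 <= L * (Q * E) by rewrite mulr_ge0// ltW.
exists (Q * E + (L * (Q * E) + Q)); first by move: QE0 LQE0 Q0; lra.
move=> u u' z z' un u'n ur u'r [zO zd z0] [z'O z'd z'0] zy z'y.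
have cu : 0 < cabs u by rewrite cabs_gt0.
have cu' : 0 < cabs u' by rewrite cabs_gt0.
pose d t := u^-1 *: (z t - y t); pose d' t := u'^-1 *: (z' t - y t).
have dK t : a <= t <= b -> rnorm (d t) <= K.
  by move=> tab; rewrite rnormZ cabsV mulrC ler_pdivrMr// zy.
have d'K t : a <= t <= b -> rnorm (d' t) <= K.
  by move=> tab; rewrite rnormZ cabsV mulrC ler_pdivrMr// z'y.
have zE t : z t = y t + u *: d t by rewrite /d scalerA divff// scale1r subrKC.
have z'E t : z' t = y t + u' *: d' t by rewrite /d' scalerA divff// scale1r subrKC.
pose v t := u^-1 *: (section_fun (u *: psi + phi) t (z t) - section_fun phi t (y t)).
pose v' t := u'^-1 *: (section_fun (u' *: psi + phi) t (z' t) - section_fun phi t (y t)).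
pose S := cabs u + cabs u'.
have S0 : 0 < S by rewrite addr_gt0.
have small (w : R[i]) (x : Pi) : cabs w <= r / (4 * K) -> rnorm x <= K ->
    rnorm (w *: x) <= r.
  rewrite ler_pdivlMr ?mulr_gt0// => wr xK; rewrite rnormZ.
  by have := ler_wpM2l (cabs_ge0 w) xK; have := mulr_ge0 (cabs_ge0 w) (ltW K0); lra.
have vel t : a <= t <= b -> rnorm (v t - v' t) <= L * rnorm (d t - d' t) + Q * S.
  move=> tab.
  have uy w x : section_fun (w *: psi + phi) t x =
     w *: section_fun psi t x + section_fun phi t x by exact: section_funD.
  rewrite /v /v' !uy zE z'E.
  set p0 := section_fun phi t (y t).
  have -> : u^-1 *: (u *: section_fun psi t (y t + u *: d t)
        + section_fun phi t (y t + u *: d t) - p0)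
      - u'^-1 *: (u' *: section_fun psi t (y t + u' *: d' t)
        + section_fun phi t (y t + u' *: d' t) - p0) =
      u^-1 *: (section_fun phi t (y t + u *: d t) - section_fun phi t (y t + u *: d' t))
      + (u^-1 *: (section_fun phi t (y t + u *: d' t) - p0)
         - u'^-1 *: (section_fun phi t (y t + u' *: d' t) - p0))
      + (section_fun psi t (y t + u *: d t) - section_fun psi t (y t + u' *: d' t)).
    by lin_coefs R[i] Pi; field; rewrite ?un ?u'n.
  set x1 := _ *: _; set x2 := _ *: _ - _ *: _; set x3 := _ - section_fun psi _ _.
  have h1 : rnorm x1 <= L * rnorm (d t - d' t).
    rewrite /x1 rnormZ cabsV mulrC ler_pdivrMr//.
    have := lip t (u *: d t) (u *: d' t) tab (small _ _ ur (dK t tab))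
      (small _ _ ur (d'K t tab)).
    by rewrite -scalerBr rnormZ mulrCA mulrC.
  have h2 : rnorm x2 <= C2 * S.
    apply: (section_fun_quotients r0 K0 _ _ (d'K t tab)) => // w wr.
      by apply/rO/tube_pt.
    by apply: (phiM (t, y t + w)); exact: tube_pt.
  have h3 : rnorm x3 <= L * K * S.
    have := lip' t (u *: d t) (u' *: d' t) tab (small _ _ ur (dK t tab))
      (small _ _ u'r (d'K t tab)).
    move=> /le_trans; apply; rewrite -mulrA ler_wpM2l//.
    apply: (le_trans (rnormBD _ _)).
    rewrite (rnormZ u (d t)) (rnormZ u' (d' t)) /S mulrDr.
    apply: lerD; rewrite mulrC ler_wpM2r ?cabs_ge0//; [exact: dK|exact: d'K].
  have := rnormD (x1 + x2) x3; have := rnormD x1 x2.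
  by rewrite /Q !mulrDl mul1r; lra.
have QS0 : 0 < Q * S by rewrite mulr_gt0.
have dd t : a <= t <= b -> rnorm (d t - d' t) <= Q * S * E.
  have dv : primitive a b (fun t => d t - d' t) (fun t => v t - v' t).
    by apply: primitiveB; apply: primitiveZ; apply: primitiveB.
  have d0 : rnorm (d t0 - d' t0) <= Q * S.
    rewrite /d /d' z0 z'0 y0.
    have -> : u^-1 *: (xi + u *: eta - xi) - u'^-1 *: (xi + u' *: eta - xi) = 0.
      by lin_coefs R[i] Pi; field; rewrite ?un ?u'n.
    by rewrite rnorm0; exact: ltW.
  exact: (gronwall L0 QS0 dv d0 (lexx _) (fun s sab _ => vel s sab)).
move=> t tab; split.
  apply: (le_trans (dd t tab)); rewrite -/S.
  by have := mulr_ge0 LQE0 (ltW S0); have := mulr_gt0 Q0 S0; lra.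
apply: (le_trans (vel t tab)); rewrite -/S.
have := ler_wpM2l L0 (dd t tab).
have := mulr_ge0 (ltW QS0) (ltW E0); lra.
Qed.

Lemma solution_tube xi phi (Y : C1) : ivp_solution xi phi Y ->
  exists2 r, 0 < r & Ebornology O (@tube _ _ t0 A (curve Y) (2 * r)).
Proof.
move=> /ivp_solves[yO yd _]; exact: tube_bornology (primitive_continuous yd) yO.
Qed.

(** [solution_near] for elements of $C^1$, with the distance measured in the norm
    of that space. *)
Lemma ivp_solution_near xi phi (Y : C1) r M : ivp_solution xi phi Y ->
  0 < r -> 0 <= M -> @tube _ _ t0 A (curve Y) (2 * r) `<=` relopen_set O ->
  (forall p, @tube _ _ t0 A (curve Y) (2 * r) p -> rnorm (section_fun phi p.1 p.2) <= M) ->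
  exists d K, [/\ 0 < d, 0 < K & forall q xi' psi, 0 < q -> q <= d ->
    rnorm (xi' - xi) <= q ->
    (forall p, @tube _ _ t0 A (curve Y) (2 * r) p ->
      rnorm (section_fun psi p.1 p.2 - section_fun phi p.1 p.2) <= q) ->
    exists2 Z : C1, ivp_solution xi' psi Z & forall t : J,
      rnorm (Z t - Y t) <= K * q /\ rnorm (ivl_deriv Z t - ivl_deriv Y t) <= K * q].
Proof.
move=> sol r0 M0 rO yM; have ysol := ivp_solves sol.
have /= := solution_near ysol r0 M0 rO yM.
set L := 4 * _ / r; set C := expR ((L + 2) * A%:num) => near.
have L0 : 0 <= L by rewrite divr_ge0 ?mulr_ge0 ?addr_ge0// ltW.
have C0 : 0 < C by exact: expR_gt0.
exists (Num.min 1 (r / C)), (C + (L * C + 1)); split.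
- by rewrite lt_min ltr01 divr_gt0.
- by rewrite addr_gt0// ltr_wpDl// mulr_ge0// ltW.
move=> q xi' psi q0; rewrite le_min ler_pdivlMr// => /andP[q1 qr] xiq psiq.
have [z zsol zP] := near q xi' psi q0 q1 qr xiq psiq.
have [Z [Zsol Zz]] := solves_ivp zsol; exists Z => // t.
have [d1 d2] := zP _ (ivl_le t).
rewrite (ivp_deriv sol) (ivp_deriv Zsol) Zz.
rewrite -!(curve_val Y); have LC0 : 0 <= L * C by rewrite mulr_ge0// ltW.
have := mulr_ge0 LC0 (ltW q0); have := mulr_ge0 (ltW C0) (ltW q0).
by split; lra.
Qed.

Lemma ivp_unique xi phi (Y Z : C1) :
  ivp_solution xi phi Y -> ivp_solution xi phi Z -> Y = Z.
Proof.
move=> Ysol Zsol; apply: C1_ext => t.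
have := solves_unique (ivp_solves Ysol) (ivp_solves Zsol) (ivl_le t).
by rewrite !curve_val.
Qed.

Lemma ivp_is_fun : is_fun (fun x (Y : C1) => ivp_graph O (x, Y)).
Proof. by move=> [xi phi] Y Z /= Ys Zs; exact: (ivp_unique Ys Zs). Qed.

Lemma ivp_funE xi phi (Y : C1) : ivp_solution xi phi Y ->
  graph_fun (ivp_graph O) (xi, phi) = Y.
Proof. by move=> sol; apply: fun_of_rel_uniq; [exact: ivp_is_fun|exact: sol]. Qed.

(** Openness of the domain and continuity of the solution map at once: closeness
    of right hand sides on one member of the bornology is a neighbourhood. *)
Lemma ivp_near_data xi phi (Y : C1) r M : ivp_solution xi phi Y -> 0 < r -> 0 <= M ->
  Ebornology O (@tube _ _ t0 A (curve Y) (2 * r)) ->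
  (forall p, @tube _ _ t0 A (curve Y) (2 * r) p -> rnorm (section_fun phi p.1 p.2) <= M) ->
  forall e, 0 < e -> \forall x \near (xi, phi), exists2 Z : C1, ivp_graph O (x, Z) &
    forall t : J, rnorm (Z t - Y t) < e /\ rnorm (ivl_deriv Z t - ivl_deriv Y t) < e.
Proof.
move=> sol r0 M0 rB yM e e0; have [rO _ _] := rB.
have [d [K [d0 K0 H]]] := ivp_solution_near sol r0 M0 rO yM.
pose q := Num.min d (e / (2 * K)).
have q0 : 0 < q by rewrite lt_min d0 divr_gt0// mulr_gt0.
have qd : q <= d by rewrite ge_min lexx.
have qe : K * q < e.
  have : q <= e / (2 * K) by rewrite ge_min lexx orbT.
  by rewrite ler_pdivlMr ?mulr_gt0//; move: e0; lra.
exists ([set xi' | rnorm (xi' - xi) < q], [set psi | forall p,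
    @tube _ _ t0 A (curve Y) (2 * r) p ->
    rnorm (section_fun psi p.1 p.2 - section_fun phi p.1 p.2) < q]).
  by split=> /=; [apply/nbhs_rnormP; exists q|exact: E_nbhs].
move=> [xi' psi] /= [xiq psiq].
have [|Z Zsol ZY] := H q xi' psi q0 qd (ltW xiq); first by move=> p /psiq/ltW.
exists Z => // t; have [z1 z2] := ZY t.
by split; [exact: le_lt_trans z1 qe|exact: le_lt_trans z2 qe].
Qed.

Lemma ivp_bounded_tube xi phi (Y : C1) : ivp_solution xi phi Y ->
  exists r M, [/\ 0 < r, 0 <= M, Ebornology O (@tube _ _ t0 A (curve Y) (2 * r)) &
    forall p, @tube _ _ t0 A (curve Y) (2 * r) p -> rnorm (section_fun phi p.1 p.2) <= M].
Proof.
move=> /solution_tube[r r0 rB]; have [M M0 yM] := section_fun_bounded phi rB.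
by exists r, M; split=> //; exact: ltW.
Qed.

Lemma ivp_open_dom : open (graph_dom (ivp_graph O)).
Proof.
rewrite openE => -[xi phi] [Y sol].
have [r [M [r0 M0 rB yM]]] := ivp_bounded_tube sol.
have := ivp_near_data sol r0 M0 rB yM ltr01.
by apply: filterS => x [Z Zsol _]; exists Z.
Qed.

Lemma ivp_continuous : {within graph_dom (ivp_graph O),
  continuous (graph_fun (ivp_graph O))}.
Proof.
rewrite continuous_open_subspace; last exact: ivp_open_dom.
move=> [xi phi]; rewrite inE => -[Y sol] U; rewrite (ivp_funE sol).
have [r [M [r0 M0 rB yM]]] := ivp_bounded_tube sol.
move=> /C1_nbhsP[e e0 eU]; have := ivp_near_data sol r0 M0 rB yM e0.
by apply: filterS => -[xi' psi] [Z Zsol ZY] /=; rewrite (ivp_funE Zsol); exact: eU.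
Qed.

(** The limit is found along the sequence $\rho 2^{-n}$; the assumption then
    compares all other values with those of the sequence. *)
Lemma C1_cauchy_limit (D : R[i] -> C1) (C rho : R) : 0 < rho -> 0 <= C ->
  (forall u u', u != 0 -> u' != 0 -> cabs u <= rho -> cabs u' <= rho -> forall t : J,
     rnorm (D u t - D u' t) <= C * (cabs u + cabs u') /\
     rnorm (ivl_deriv (D u) t - ivl_deriv (D u') t) <= C * (cabs u + cabs u')) ->
  exists l : C1, D @ (0 : R[i]^o)^' --> l.
Proof.
move=> rho0 C0 DC; pose w n : R[i] := (rho * 2 ^- n)%:C.
have w0 n : 0 < rho * 2 ^- n by rewrite mulr_gt0// half_expr_gt0.
have wn n : w n != 0 by rewrite fmorph_eq0 gt_eqF.
have cw n : cabs (w n) = rho * 2 ^- n by rewrite cabs_real gtr0_norm.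
have wr n : cabs (w n) <= rho.
  by rewrite cw ler_piMr ?(ltW rho0)// invf_le1 ?exprn_gt0// exprn_ege1// ler1n.
have [|l lP] := @C1_complete _ _ _ _ (fun n => D (w n)).
  move=> e e0; have [N HN] := @half_expr_small R (2 * C * rho) e
    ltac:(by rewrite !mulr_ge0// ltW) e0.
  exists N => m n Nm Nn t; have [h1 h2] := DC _ _ (wn m) (wn n) (wr m) (wr n) t.
  by move: h1 h2; rewrite !cw; have := HN m Nm; have := HN n Nn; split; lra.
exists l => U /C1_nbhsP[e e0 eU]; apply/nbhs_cabsP.
have C1_0 : 0 < C + 1 by rewrite ltr_wpDl.
exists (Num.min rho (e / 2 / (C + 1))); first by rewrite lt_min rho0 !divr_gt0.
move=> u; rewrite subr0 lt_min ltr_pdivlMr// => /andP[ur ue] un; apply: eU => t.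
have e40 : 0 < e / 4 by rewrite divr_gt0.
have [N HN] := lP _ e40.
have [N' HN'] := @half_expr_small R (C * rho) _ ltac:(by rewrite mulr_ge0// ltW) e40.
pose n := maxn N N'.
have [h1 h2] := DC _ _ un (wn n) (ltW ur) (wr n) t.
have [h3 h4] := HN n (leq_maxl _ _) t; have h5 := HN' n (leq_maxr _ _).
have h6 : C * cabs u < e / 2 by have := cabs_ge0 u; lra.
move: h1 h2; rewrite cw => h1 h2.
have := rnorm_tri (D (w n) t) (D u t) (l t).
have := rnorm_tri (ivl_deriv (D (w n)) t) (ivl_deriv (D u) t) (ivl_deriv l t).
by split; lra.
Qed.

(** The difference quotients are a Cauchy family as [u] tends to [0] by
    [quotients_near], applied with the Lipschitz bound of [ivp_solution_near]. *)
Lemma ivp_derivable : directionally_differentiable (ivp_graph O).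
Proof.
move=> [xi phi] [eta psi] [Y sol].
have [r r0 rB] := solution_tube sol; have [rO _ _] := rB.
have [M1 M10 phiM1] := section_fun_bounded phi rB.
have [M2 M20 psiM2] := section_fun_bounded psi rB.
pose M := M1 + M2; have M0 : 0 <= M by rewrite addr_ge0// ltW.
have phiM p : @tube _ _ t0 A (curve Y) (2 * r) p -> rnorm (section_fun phi p.1 p.2) <= M.
  by move=> /phiM1 /le_trans; apply; rewrite lerDl ltW.
have psiM p : @tube _ _ t0 A (curve Y) (2 * r) p -> rnorm (section_fun psi p.1 p.2) <= M.
  by move=> /psiM2 /le_trans; apply; rewrite lerDr ltW.
have [d [K [d0 K0 H]]] := ivp_solution_near sol r0 M0 rO phiM.
(* The data at [u] are within [N * cabs u] of the data at [0]. *)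
pose N := M + rnorm eta + 1.
have N0 : 0 < N by rewrite ltr_wpDl// addr_ge0 ?rnorm_ge0.
have KN0 : 0 < K * N by rewrite mulr_gt0.
have [C C0 HC] := quotients_near eta (ivp_solves sol) r0 M0 rO phiM psiM KN0.
pose rho := Num.min (d / N) (r / (4 * (K * N))).
have rho0 : 0 < rho by rewrite lt_min !divr_gt0// mulr_gt0.
have /choice[Z ZP] (u : R[i]) : exists Z : C1, u != 0 -> cabs u <= rho ->
    ivp_solution (xi + u *: eta) (u *: psi + phi) Z /\
    forall t : J, rnorm (Z t - Y t) <= K * N * cabs u.
  have [[un ur]|nu] := pselect (u != 0 /\ cabs u <= rho); last first.
    by exists Y => un ur; case: nu.
  have cu : 0 < cabs u by rewrite cabs_gt0.
  move: ur; rewrite le_min ler_pdivlMr// => /andP[ud _].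
  have [|||p yp|Z Zsol ZY] := H (cabs u * N) (xi + u *: eta) (u *: psi + phi).
  - by rewrite mulr_gt0.
  - exact: ud.
  - rewrite addrC addKr rnormZ ler_wpM2l ?cabs_ge0// /N.
    by have := rnorm_ge0 eta; lra.
  - rewrite section_funD addrK rnormZ ler_wpM2l ?cabs_ge0// /N.
    by have := psiM p yp; have := rnorm_ge0 eta; lra.
  by exists Z => _ _; split=> // t; have [+ _] := ZY t; rewrite mulrCA mulrC.
pose D (u : R[i]) : C1 := u^-1 *: (Z u - Y).
have [l Dl] : exists l : C1, D @ (0 : R[i]^o)^' --> l.
  apply: (@C1_cauchy_limit D C rho) => // u u' un u'n ur u'r t.
  have [Zsol ZY] := ZP u un ur; have [Z'sol Z'Y] := ZP u' u'n u'r.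
  have rhor (w : R[i]) : cabs w <= rho -> cabs w <= r / (4 * (K * N)).
    by rewrite le_min => /andP[].
  have near (W : C1) (w : R[i]) : (forall t : J, rnorm (W t - Y t) <= K * N * cabs w) ->
      forall t, a <= t <= b -> rnorm (curve W t - curve Y t) <= K * N * cabs w.
    by move=> WY s sab; rewrite !(curve_pt _ sab).
  have := HC u u' _ _ un u'n (rhor _ ur) (rhor _ u'r) (ivp_solves Zsol)
    (ivp_solves Z'sol) (near _ _ ZY) (near _ _ Z'Y) _ (ivl_le t).
  rewrite !curve_val -!(ivp_deriv Zsol) -!(ivp_deriv Z'sol) -!(ivp_deriv sol).
  by rewrite !C1_deriv_scale !C1_derivB.
exists l => U /Dl/nbhs_cabsP[e e0 DU]; apply/nbhs_cabsP.
exists (Num.min e rho); first by rewrite lt_min e0.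
move=> u; rewrite lt_min => /andP[ue]; rewrite subr0 => ur un.
have [Zsol _] := ZP u un (ltW ur).
change (U (u^-1 *: (graph_fun (ivp_graph O) (xi + u *: eta, phi + u *: psi)
  - graph_fun (ivp_graph O) (xi, phi)))).
have -> : phi + u *: psi = u *: psi + phi by rewrite addrC.
by rewrite (ivp_funE sol) (ivp_funE Zsol); exact: DU.
Qed.

Lemma prod_hausdorff (T U : topologicalType) :
  hausdorff_space T -> hausdorff_space U -> hausdorff_space (T * U)%type.
Proof.
move=> hT hU [x1 x2] [y1 y2] xy; congr (_, _).
  apply: hT => P Q Px Qy.
  have [||z [/= [Pz _] [Qz _]]] := xy (P `*` setT) (Q `*` setT).
  - by exists (P, setT) => //; split=> //; exact: filterT.
  - by exists (Q, setT) => //; split=> //; exact: filterT.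
  by exists z.1.
apply: hU => P Q Px Qy.
have [||z [/= [_ Pz] [_ Qz]]] := xy (setT `*` P) (setT `*` Q).
- by exists (setT, P) => //; split=> //; exact: filterT.
- by exists (setT, Q) => //; split=> //; exact: filterT.
by exists z.2.
Qed.

(** The solution of the truncated equation has speed at most [M], hence stays
    within distance [r] of [xi] and solves the original equation. *)
Lemma ivp_dom_of_bound xi phi (r M : R) : 0 < r -> M * A%:num <= r ->
  (forall t (w : Pi), a <= t <= b -> rnorm w < 2 * r -> relopen_set O (t, xi + w)) ->
  (forall t (w : Pi), a <= t <= b -> rnorm w < 2 * r ->
     rnorm (section_fun phi t (xi + w)) <= M) ->
  graph_dom (ivp_graph O) (xi, phi).
Proof.
move=> r0 MA xiO xiM.
have xic : continuous_curve a b (fun=> xi).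
  exact: primitive_continuous (primitive_const xi).
have tubeE p : @tube _ _ t0 A (fun=> xi) (2 * r) p ->
    exists t w, [/\ p = (t, xi + w), a <= t <= b & rnorm w < 2 * r].
  by case: p => t x [/= tab xr]; exists t, (x - xi); rewrite subrKC.
have rO : @tube _ _ t0 A (fun=> xi) (2 * r) `<=` relopen_set O.
  by move=> p /tubeE[t [w [-> tab wr]]]; exact: xiO.
have rM p : @tube _ _ t0 A (fun=> xi) (2 * r) p -> rnorm (section_fun phi p.1 p.2) <= M.
  by move=> /tubeE[t [w [-> tab wr]]]; exact: xiM.
have [z zd z0] := truncated_solution xi xic r0 rO rM.
have zr t : a <= t <= b -> rnorm (z t - xi) <= r.
  move=> tab.
  have := @mean_value_primitive _ _ _ _ _ _ M zd _ t0 t (@ab_mid _ t0 A) tab.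
  rewrite z0 => h; apply: (le_trans (h _)) => [s sab|].
    apply: xiM => //; apply: le_lt_trans (ball_retract_le _ (ltW r0)) _.
    by move: r0; lra.
  apply: le_trans MA.
  have M0 : 0 <= M.
    apply: le_trans (rnorm_ge0 _) (xiM t0 0 (@ab_mid _ t0 A) _).
    by rewrite rnorm0 mulr_gt0.
  rewrite ler_wpM2l// ler_norml; move/andP: tab => tab; apply/andP; lra.
have [|Y [Ysol _]] := @solves_ivp _ _ _ _ O xi phi z; last by exists Y.
split=> // [t tab|].
  rewrite -(subrKC xi (z t)); apply: xiO => //.
  by have := zr t tab; move: r0; lra.
apply: primitive_ext zd => // t tab.
by rewrite ball_retract_id ?subrKC// zr.
Qed.

End solution_map.

Theorem theorem4 (R : realType) (t0 : R) (A : {posnum R})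
    (Pi : completeNormedModType R[i])
    (O : relopen (ivl t0 A `*` [set: Pi])) :
  HT R (Pi * E_space O)%type (C1_space Pi t0 A) (ivp_graph O) /\
  forall (xi : Pi) (phi : E_space O),
    (exists2 B1 : R, 0 < B1 &
      let D : set (R * Pi) :=
        [set (t, xi + xi1) | t in ivl t0 A & xi1 in [set v : Pi | rnorm v < B1]]
      in D `<=` O /\
         (ereal_sup [set (rnorm v)%:E | v in Eimage phi D]
            < (B1 / (2 * A%:num))%:E)%E) ->
    graph_dom (ivp_graph O) (xi, phi).
Proof.
split.
  split.
  - exact: prod_hausdorff (@norm_hausdorff _ _) (@E_hausdorff _ _ _ _).
  - exact: C1_hausdorff.
  - exact: C1_mackey_complete.
  - exact: ivp_is_fun.
  - exact: ivp_open_dom.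
  - exact: ivp_continuous.
  - exact: ivp_derivable.
move=> xi phi [B1 B10 /= [DO supD]].
have B1E : 2 * (B1 / 2) = B1 by rewrite mulrC divfK.
pose D := [set (t, xi + xi1) | t in ivl t0 A & xi1 in [set v : Pi | rnorm v < B1]].
have inD t w : t0 - A%:num <= t <= t0 + A%:num -> rnorm w < B1 -> D (t, xi + w).
  by move=> tab wB; exists t; [exact/ivlP|exists w].
apply: (@ivp_dom_of_bound _ _ _ _ _ xi phi (B1 / 2) (B1 / (2 * A%:num))).
- by rewrite divr_gt0.
- by rewrite invfM mulrA divfK.
- by move=> t w tab; rewrite B1E => /(inD t w tab)/DO.
- move=> t w tab; rewrite B1E => /(inD t w tab) Dtw.
  have Otw : relopen_set O (t, xi + w) by exact: DO.
  rewrite (section_fun_val phi Otw) -lee_fin; apply: le_trans (ltW supD).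
  by apply: ereal_sup_ubound; exists (phi (relopen_pt Otw)) => //; exists (relopen_pt Otw).
Qed.
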